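(* Let $\Sigma$ be a hypersurface in a conformal manifold $(M,\boldsymbol c)$ of dimension $d\ge3$. There is a distinguished defining density $\bar\sigma\in\Gamma(\mathcal E[1])$ for $\Sigma$, unique to $\mathcal O(\sigma^{d+1})$ where $\sigma$ is any given defining density for $\Sigma$, such that $$I_{\bar\sigma}^2=1+\bar\sigma^d B_{\bar\sigma}$$ for some smooth density $B_{\bar\sigma}\in\Gamma(\mathcal E[-d])$. Moreover $\bar\sigma$ may be given by a canonical formula $\bar\sigma(\sigma)$ depending (smoothly) only on $(M,\boldsymbol c,\sigma)$.
   Context: $(M,\boldsymbol c)$ is a smooth oriented $d$-manifold with a conformal class of Riemannian metrics. $\mathcal E[w]$ is the bundle of conformal densities of weight $w$ (oriented $\frac w{2d}$-th root of $(\Lambda^dTM)^2$; a section is represented by functions $f_g$, $g\in\boldsymbol c$, with $f_{\Omega^2g}=\Omega^wf_g$); $\boldsymbol g\in\Gamma(\odot^2T^*M\otimes\mathcal E[2])$ is the conformal metric, used to raise and lower indices. For $g\in\boldsymbol c$, $\nabla$ is the Levi-Civita connection, $\Delta=\boldsymbol g^{ab}\nabla_a\nabla_b$, $\mathrm J=\mathrm{Sc}/(2(d-1))$ with $\mathrm{Sc}$ the scalar curvature. For $\sigma\in\Gamma(\mathcal E[1])$, $$I_\sigma^2:=\boldsymbol g^{ab}(\nabla_a\sigma)(\nabla_b\sigma)-\tfrac2d\,\sigma(\Delta\sigma+\mathrm J\sigma),$$ which is independent of $g\in\boldsymbol c$ (it is the squared length of the scale tractor of $\sigma$). A hypersurface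 $\Sigma$ is a smoothly embedded codimension-1 submanifold; a defining density is a $\sigma\in\Gamma(\mathcal E[1])$ with zero locus $\Sigma$ and $\nabla\sigma$ nowhere zero along $\Sigma$. Considerations are local near $\Sigma$ and defining densities are taken compatibly oriented (i.e. $\bar\sigma/\sigma>0$). $E=F+\mathcal O(\sigma^k)$ means $E-F=\sigma^kG$ with $G$ smooth. *)

(* Defs.v *)
(* MathComp-Analysis, over an arbitrary R : realType. *)
From HB Require Import structures.
From mathcomp Require Import all_boot all_order all_algebra.
From mathcomp Require Import all_classical all_reals all_analysis.

Set Implicit Arguments.
Unset Strict Implicit.
Unset Printing Implicit Defensive.

Import Order.TTheory GRing.Theory Num.Theory.
Import numFieldNormedType.Exports.

Local Open Scope classical_set_scope.
Local Open Scope ring_scope.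

Section Euclidean.
Variables (R : realType) (n : nat).
Implicit Types (A : set 'rV[R]_n) (f : 'rV[R]_n -> R).

(* [partials [:: i1; ...; ik] f] is the iterated partial derivative
   d_i1 (... (d_ik f)). *)
Definition partials (s : seq 'I_n) f : 'rV[R]_n -> R :=
  foldr (fun i h => fun y => 'D_('e_i) h y) f s.

Definition partial (i : 'I_n) f : 'rV[R]_n -> R := partials [:: i] f.

(* C^infinity on A; A is always open where this is used. *)
Definition smooth A f : Prop :=
  forall (s : seq 'I_n) (x : 'rV[R]_n), A x ->
    {for x, continuous (partials s f)} /\
    (forall i, derivable (partials s f) x 'e_i).

End Euclidean.

Section Manifolds.
Variables (R : realType) (d : nat).

(* A topological chart. [chart_inv] only matters on the image of the domain. *)
Record chart (M : topologicalType) := Chart {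
  chart_dom : set M;
  chart_map :> M -> 'rV[R]_d;
  chart_inv : 'rV[R]_d -> M;
  chart_dom_open : open chart_dom;
  chart_img_open : open (chart_map @` chart_dom);
  chart_mapK : forall x, chart_dom x -> chart_inv (chart_map x) = x;
  chart_map_cont : forall x, chart_dom x -> {for x, continuous chart_map};
  chart_inv_cont : forall y, (chart_map @` chart_dom) y ->
    {for y, continuous chart_inv}
}.

Section Transition.
Variable M : topologicalType.
Implicit Types phi psi : chart M.

Definition transition phi psi : 'rV[R]_d -> 'rV[R]_d :=
  fun y => psi (chart_inv phi y).

Definition overlap phi psi : set M := chart_dom phi `&` chart_dom psi.

Definition smooth_transition phi psi : Prop :=
  forall k : 'I_d,
    smooth (phi @` overlap phi psi) (fun y => transition phi psi y 0 k).

Definition compatible phi psi : Prop :=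
  smooth_transition phi psi /\ smooth_transition psi phi.

(* Vectors are rows: entry (i, k) is d(psi^k)/d(phi^i) at x. *)
Definition transition_jacobian phi psi (x : M) : 'M[R]_d :=
  jacobian (transition phi psi) (phi x).

End Transition.

Record manifold := Manifold {
  mcarrier :> topologicalType;
  atlas : set (chart mcarrier);
  mfd_hausdorff : hausdorff_space mcarrier;
  mfd_second_countable : @second_countable mcarrier;
  atlas_cover : forall x : mcarrier, exists2 phi, atlas phi & chart_dom phi x;
  atlas_compatible : forall phi psi, atlas phi -> atlas psi ->
    compatible phi psi;
  atlas_oriented : forall phi psi x, atlas phi -> atlas psi ->
    overlap phi psi x -> 0 < \det (transition_jacobian phi psi x)
}.

Section Geometry.
Variable M : manifold.
Implicit Types (U V S : set M) (phi psi : chart M) (f : M -> R).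

(* The function f read in the coordinates of phi. *)
Definition local_expr phi f : 'rV[R]_d -> R := fun y => f (chart_inv phi y).

Definition smooth_on U f : Prop :=
  forall phi, @atlas M phi ->
    smooth (phi @` (chart_dom phi `&` U)) (local_expr phi f).

(* A smoothly embedded hypersurface, by slice charts; these range over the
   maximal (not necessarily oriented) smooth atlas. *)
Definition hypersurface S : Prop :=
  forall p, S p -> exists psi (i : 'I_d),
    [/\ forall phi, @atlas M phi -> compatible phi psi,
        chart_dom psi p &
        forall x, chart_dom psi x -> (S x <-> psi x 0 i = 0)].

(* A Riemannian metric, given by its components in the charts of the atlas. *)
Record metric := Metric {
  mcoef :> chart M -> M -> 'M[R]_d;
  metric_sym : forall phi x, @atlas M phi -> chart_dom phi x ->
    (mcoef phi x)^T = mcoef phi x;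
  metric_pos : forall phi x (v : 'rV[R]_d), @atlas M phi -> chart_dom phi x ->
    v != 0 -> 0 < (v *m mcoef phi x *m v^T) 0 0;
  metric_smooth : forall phi (i j : 'I_d), @atlas M phi ->
    smooth (phi @` chart_dom phi) (local_expr phi (fun x => mcoef phi x i j));
  metric_tensor : forall phi psi x, @atlas M phi -> @atlas M psi ->
    overlap phi psi x ->
    mcoef phi x = transition_jacobian phi psi x *m mcoef psi x
                    *m (transition_jacobian phi psi x)^T
}.

(* g' = Omega^2 g *)
Definition rescaled_by (Omega : M -> R) (g g' : metric) : Prop :=
  [/\ smooth_on setT Omega, forall x, 0 < Omega x &
      forall phi x, @atlas M phi -> chart_dom phi x ->
        g' phi x = (Omega x) ^+ 2 *: g phi x].

Record conformal_structure := ConformalStructure {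
  conf_class : set metric;
  conf_classP : exists g0, conf_class =
    [set g | exists Omega, rescaled_by Omega g0 g]
}.

(* [density c w U s]: s is (represents) a smooth section over the open set U
   of the bundle E[w], with [s g] the function representing it in the scale g.
   Values of s at metrics outside c are irrelevant. *)
Definition density (c : conformal_structure) (w : R) U
    (s : metric -> M -> R) : Prop :=
  (forall g, conf_class c g -> smooth_on U (s g)) /\
  (forall g g' Omega, conf_class c g -> conf_class c g' ->
    rescaled_by Omega g g' -> forall x, U x -> s g' x = (Omega x) `^ w * s g x).

Section LocalGeometry.
Variables (g : metric) (phi : chart M).
Implicit Type y : 'rV[R]_d.

Definition gcomp (i j : 'I_d) : 'rV[R]_d -> R :=
  local_expr phi (fun x => g phi x i j).

Definition ginv (i j : 'I_d) : 'rV[R]_d -> R :=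
  local_expr phi (fun x => invmx (g phi x) i j).

(* Gamma^k_ij of the Levi-Civita connection *)
Definition christoffel (k i j : 'I_d) : 'rV[R]_d -> R := fun y =>
  2^-1 * \sum_(l < d) ginv k l y *
    (partial i (gcomp j l) y + partial j (gcomp i l) y
     - partial l (gcomp i j) y).

(* dx^l (R(e_i, e_j) e_k), with
   R(X, Y) = [nabla_X, nabla_Y] - nabla_[X, Y] *)
Definition riemann (i j l k : 'I_d) : 'rV[R]_d -> R := fun y =>
  partial i (christoffel l j k) y - partial j (christoffel l i k) y
  + \sum_(m < d) (christoffel l i m y * christoffel m j k y
                  - christoffel l j m y * christoffel m i k y).

Definition ricci (j k : 'I_d) : 'rV[R]_d -> R := fun y =>
  \sum_(i < d) riemann i j i k y.

Definition scalar_curvature : 'rV[R]_d -> R := fun y =>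
  \sum_(j < d) \sum_(k < d) ginv j k y * ricci j k y.

Definition schouten_trace : 'rV[R]_d -> R := fun y =>
  scalar_curvature y / (2 * (d%:R - 1)).

Definition laplacian (F : 'rV[R]_d -> R) : 'rV[R]_d -> R := fun y =>
  \sum_(i < d) \sum_(j < d) ginv i j y *
    (partials [:: i; j] F y
     - \sum_(k < d) christoffel k i j y * partial k F y).

(* I_sigma^2 at the point x, computed in the scale g, for which the weight one
   density sigma is represented by f, and in the coordinates phi. *)
Definition Isq f (x : M) : R :=
  let F := local_expr phi f in
  let y := phi x in
  \sum_(i < d) \sum_(j < d) ginv i j y * partial i F y * partial j F y
  - 2 / d%:R * F y * (laplacian F y + schouten_trace y * F y).

End LocalGeometry.

Variable c : conformal_structure.
Implicit Types s t : metric -> M -> R.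

(* s is, over the open set U, a defining density for the hypersurface S. *)
Definition defining_density U S s : Prop :=
  [/\ density c 1 U s,
      forall g x, conf_class c g -> U x -> (s g x = 0 <-> S x) &
      forall g phi x, conf_class c g -> @atlas M phi -> chart_dom phi x ->
        U x -> S x -> exists i : 'I_d, partial i (local_expr phi (s g)) (phi x) != 0].

Definition compatibly_oriented U S s t : Prop :=
  forall g x, conf_class c g -> U x -> ~ S x -> 0 < s g x / t g x.

(* E = F + O(s^k) over U, for E and F of weight w and s of weight 1. *)
Definition eq_mod_bigO (w : R) (k : nat) U s E F : Prop :=
  exists2 G, density c (w - k%:R) U G &
    forall g x, conf_class c g -> U x ->
      E g x - F g x = (s g x) ^+ k * G g x.

Definition distinguished_density U S s : Prop :=
  defining_density U S s /\
  exists2 B, density c (- d%:R) U B &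
    forall g phi x, conf_class c g -> @atlas M phi -> chart_dom phi x -> U x ->
      Isq g phi (s g) x = 1 + (s g x) ^+ d * B g x.

End Geometry.

(* Coordinates on the N-jets of pairs (metric components, function): partial
   derivatives, along words of length at most N, of the function (None) or of
   the component g_ij (Some (i, j)). Mixed partials and symmetric components
   are listed redundantly. *)
Definition jet_index (N : nat) : finType :=
  (option ('I_d * 'I_d) * N.-bseq 'I_d)%type.

Definition jet_space (N : nat) := 'rV[R]_#|jet_index N|.

Definition jet (N : nat) (M : manifold) (g : metric M) (phi : chart M)
    (f : M -> R) (x : M) : jet_space N :=
  \row_(a < #|jet_index N|)
    let: (o, w) := enum_val a in
    partials w (if o is Some (i, j) then gcomp g phi i j
                else local_expr phi f) (phi x).

(* t is obtained from s over U by the formula Phi, defined on the set W of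
   jets: in every scale and in all coordinates, the value of t at a point is
   the value of Phi on the N-jet at that point of the metric and of s. *)
Definition given_by_formula (N : nat) (W : set (jet_space N))
    (Phi : jet_space N -> R) (M : manifold) (c : conformal_structure M)
    (U : set M) (s t : metric M -> M -> R) : Prop :=
  forall g phi x, conf_class c g -> atlas phi -> chart_dom phi x -> U x ->
    W (jet N g phi (s g) x) /\ t g x = Phi (jet N g phi (s g) x).

End Manifolds.

(* Main.v *)
Require Import Defs.
From HB Require Import structures.
From mathcomp Require Import all_boot all_order all_algebra.
From mathcomp Require Import all_classical all_reals all_analysis.
From mathcomp Require Import perm ring lra.

(** Existence: put s_0 = sigma and A_0 = I^2(sigma) - 1. Given
    I^2(s_k) = 1 + s_k^k A_k with k < d, the Leibniz rule for I^2 shows that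
    s_(k+1) = s_k (1 + c_k s_k^k A_k)^(-1/2), c_k = d / ((k+1)(d-k)), satisfies
    I^2(s_(k+1)) = 1 + s_(k+1)^(k+1) A_(k+1), with A_(k+1) a universal
    expression in the derivatives of the metric and of sigma. So s_d is given by
    a formula in a finite jet. Only the invariance of I^2 is needed to see that
    the formula does not depend on the chart and has weight 1: off the
    hypersurface A_k = (I^2(s_k) - 1) / s_k^k, and the values on the
    hypersurface follow by continuity.

    Uniqueness: functions vanishing on the hypersurface are divisible by a
    defining density (Hadamard's lemma in slice charts), so two solutions have a
    smooth positive quotient u. If u = 1 + s^k q with k < d, subtracting the two
    equations for I^2 and dividing by s^k gives (k+1)(d-k) q = 0 on the
    hypersurface, hence s divides q. *)

Set Implicit Arguments.
Unset Strict Implicit.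
Unset Printing Implicit Defensive.

Import Order.TTheory GRing.Theory Num.Theory.
Import numFieldNormedType.Exports.

Local Open Scope classical_set_scope.
Local Open Scope ring_scope.

(** * Calculus on open subsets of R^n *)

(** The corrected density has to be one smooth function on a jet space, the same for every manifold,
    scale and chart. The construction is therefore carried out on formal expressions: variables
    stand for derivatives of the metric and of the density, the operations are those of a ring and
    a^(-1/2) (reciprocals come from a^(-1/2) applied to squares), and a formal derivation matches
    partial derivatives whenever the variables form a system closed under differentiation.
    Smoothness, domains and the order of the jet are read off the syntax, and the Leibniz rules for
    I^2 become algebra at a single point.

    The obstacle is that A_k must be smooth across the hypersurface, so it cannot be defined by
    dividing I^2 - 1 by a power of s_k; each step extracts that power by a polynomial identity. The
    invariance of I^2 is derived from the transformation laws of the Christoffel symbols, stated as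
    identities of functions on open sets so that they can be differentiated again. The process stops
    at k = d, where the factor d - k vanishes. *)

Section Lines.
Variables (R : realType) (V : normedModType R).
Implicit Types (f : V -> R) (x v : V).

Lemma growth_line f x v (t : R) :
  (fun h : R => h^-1 *: (((fun s : R => f (x + s *: v)) \o shift t) (h *: 1) -
      f (x + t *: v))) =
  (fun h : R => h^-1 *: ((f \o shift (x + t *: v)) (h *: v) - f (x + t *: v))).
Proof.
apply/funext => h /=; congr (_ *: (f _ - _)).
by rewrite [h *: 1]mulr1 scalerDl addrCA.
Qed.

Lemma derivable_line f x v (t : R) :
  derivable (fun s : R => f (x + s *: v)) t 1 = derivable f (x + t *: v) v.
Proof. by rewrite /derivable growth_line. Qed.

Lemma derive_line f x v (t : R) :
  'D_1 (fun s : R => f (x + s *: v)) t = 'D_v f (x + t *: v).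
Proof. by rewrite /derive growth_line. Qed.

(** Locating s only by [|s| <= |t|] treats both signs of t alike, and is precise enough for the
    estimates below. *)
Lemma line_mvt f x v (t : R) :
  (forall s : R, `|s| <= `|t| -> derivable f (x + s *: v) v) ->
  exists s : R, `|s| <= `|t| /\ f (x + t *: v) - f x = t * 'D_v f (x + s *: v).
Proof.
move=> df; pose phi (s : R) := f (x + s *: v).
have dphi (s : R) : `|s| <= `|t| -> is_derive s 1 phi ('D_v f (x + s *: v)).
  by move=> /df; rewrite -derivable_line -derive_line => /derivableP.
have cphi (s : R) : `|s| <= `|t| -> {for s, continuous phi}.
  move=> /dphi [/derivable1_diffP + _]; exact: differentiable_continuous.
have phi0 : phi 0 = f x by rewrite /phi scale0r addr0.
have [t0|t0|->] := ltgtP t 0; last first.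
- by exists 0; split=> //; rewrite scale0r addr0 subrr mul0r.
- have h (s : R) : s \in `[0, t] -> `|s| <= `|t|.
    by rewrite in_itv /= => /andP[s0 st]; rewrite !ger0_norm ?(ltW t0).
  have [||c /subset_itv_oo_cc ct E] := @MVT R phi (fun s => 'D_v f (x + s *: v)) 0 t t0.
  + by move=> s /subset_itv_oo_cc/h/dphi.
  + by apply: continuous_in_subspaceT => s; rewrite inE /= => /h/cphi.
  by exists c; split; [exact: h|rewrite -phi0 E subr0 mulrC].
- have h (s : R) : s \in `[t, 0] -> `|s| <= `|t|.
    by rewrite in_itv /= => /andP[s0 st]; rewrite !ler0_norm ?(ltW t0)// lerN2.
  have [||c /subset_itv_oo_cc ct E] := @MVT R phi (fun s => 'D_v f (x + s *: v)) t 0 t0.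
  + by move=> s /subset_itv_oo_cc/h/dphi.
  + by apply: continuous_in_subspaceT => s; rewrite inE /= => /h/cphi.
  exists c; split; first exact: h.
  by rewrite -phi0 -opprB E sub0r mulrN opprK mulrC.
Qed.

End Lines.

(** * Continuous partial derivatives imply differentiability *)

Section C1.
Variables (R : realType) (n : nat).
Implicit Types (A B : set 'rV[R]_n) (f : 'rV[R]_n -> R) (x y h : 'rV[R]_n).

Lemma coord_le_norm h i : `|h 0 i| <= `|h|.
Proof.
rewrite [leRHS]/Num.norm /= mx_normrE.
exact: (le_bigmax _ (fun ij : 'I_1 * 'I_n => `|h ij.1 ij.2|) (0, i)).
Qed.

Lemma norm_le_coord h (r : R) : 0 <= r ->
  (forall i, `|h 0 i| <= r) -> `|h| <= r.
Proof.
move=> r0 hr; rewrite [leLHS]/Num.norm /= mx_normrE.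
by apply: bigmax_le => // -[a i] _ /=; rewrite ord1.
Qed.

Definition lincomb (a : 'I_n -> R) : 'rV[R]_n -> R^o :=
  fun h => \sum_i h 0 i * a i.

Lemma lincomb_linear (a : 'I_n -> R) : linear (lincomb a).
Proof.
move=> k u v; rewrite /lincomb scaler_sumr -big_split /=.
by apply: eq_bigr => i _; rewrite !mxE mulrDl -mulrA.
Qed.

HB.instance Definition _ (a : 'I_n -> R) :=
  GRing.isLinear.Build R 'rV[R]_n R^o _ (lincomb a) (lincomb_linear a).

Lemma lincomb_continuous (a : 'I_n -> R) : continuous (lincomb a).
Proof.
move=> x; apply: (cvg_big (@add_continuous R^o) (nbhs_filter x)) => i _.
by apply: cvgM; [exact: coord_continuous | exact: cvg_cst].
Qed.

(* The increment along h is split into n increments along the axes. *)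
Definition head_part (h : 'rV[R]_n) (k : nat) : 'rV[R]_n :=
  \row_j (if (j < k)%N then h 0 j else 0).

Lemma head_partS h (k : 'I_n) :
  head_part h k.+1 = head_part h k + h 0 k *: 'e_k.
Proof.
apply/rowP => j; rewrite !mxE eqxx /= ltnS leq_eqVlt -val_eqE /=.
case: (ltngtP (nat_of_ord j) k) => [jk|jk|jk]; rewrite ?mulr0 ?mulr1 ?addr0 ?add0r //.
by congr (h 0 _); apply/val_inj.
Qed.

Lemma head_part0 h : head_part h 0 = 0.
Proof. by apply/rowP => j; rewrite !mxE. Qed.

Lemma head_partn h : head_part h n = h.
Proof. by apply/rowP => j; rewrite !mxE ltn_ord. Qed.

(** Each axis step is evaluated by the mean value theorem at a point within |h| of x, where
    continuity keeps the partial derivative close to its value at x; the n errors add up to at most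
    e |h|. *)
Lemma C1_differentiable f x (B : set 'rV[R]_n) : open B -> B x ->
  (forall i y, B y -> derivable f y 'e_i) ->
  (forall i, {for x, continuous (fun y => 'D_('e_i) f y)}) ->
  differentiable f x /\ forall h, 'd f x h = \sum_i h 0 i * 'D_('e_i) f x.
Proof.
move=> oB Bx df cf; pose L := lincomb (fun i => 'D_('e_i) f x).
pose fo : 'rV[R]_n -> R^o := f.
have key : fo \o shift x = cst (fo x) + (L : 'rV[R]_n -> R^o) +o_ (0 : 'rV[R]_n) (@id 'rV[R]_n).
  apply/eqaddoP => _/posnumP[e].
  (* Dividing by n + 1 instead of n keeps e' positive when n = 0. *)
  pose e' := e%:num / n.+1%:R.
  have e'0 : 0 < e' by rewrite divr_gt0.
  have nB : \forall y \near x, B y /\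
      forall i, `|'D_('e_i) f x - 'D_('e_i) f y| < e'.
    near=> y; split; first by near: y; exact: open_nbhs_nbhs.
    near: y; apply: filter_forall => i.
    by have /cvgrPdist_lt/(_ _ e'0) := cf i.
  have /nbhs_ballP[r /= r0 Br] := nB.
  near=> h.
  have hr : `|h| < r.
    near: h; apply/nbhs_ballP; exists r => //= z.
    by rewrite -ball_normE /= sub0r normrN.
  have inB y : `|y - x| <= `|h| -> B y /\
      forall i, `|'D_('e_i) f x - 'D_('e_i) f y| < e'.
    move=> yx; apply: Br; rewrite -ball_normE /= -opprB normrN.
    exact: le_lt_trans yx hr.
  have hp k (i : 'I_n) (s : R) : nat_of_ord i = k -> `|s| <= `|h 0 i| ->
      `|head_part h k + s *: 'e_i| <= `|h|.
    move=> ik si; apply: norm_le_coord => // j; rewrite !mxE eqxx /=.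
    case: (ltngtP (nat_of_ord j) k) => jk.
    - rewrite (_ : (j == i) = false) ?mulr0 ?addr0 ?coord_le_norm //.
      by apply/negbTE; rewrite -val_eqE /= ik neq_ltn jk.
    - rewrite (_ : (j == i) = false) ?mulr0 ?addr0 ?normr0 ?normr_ge0 //.
      by apply/negbTE; rewrite -val_eqE /= ik neq_ltn jk orbT.
    - rewrite (_ : j == i); last by rewrite -val_eqE /= ik jk.
      rewrite mulr1 add0r (le_trans si) //; exact: coord_le_norm.
  have xK u w : x + u + w - x = u + w by rewrite -(addrA x u w) [x + _]addrC addrK.
  have step (k : 'I_n) : `|f (x + head_part h k.+1) - f (x + head_part h k)
       - h 0 k * 'D_('e_k) f x| <= `|h| * e'.
    have [s sh|s [sh E]] := @line_mvt _ _ f (x + head_part h k) 'e_k (h 0 k).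
      by apply: df; apply: (inB _ _).1; rewrite xK hp.
    rewrite head_partS addrA E -mulrBr normrM ler_pM //.
      exact: coord_le_norm.
    rewrite -normrN opprB; apply/ltW/(inB _ _).2.
    by rewrite xK hp.
  have -> : (f \o shift x - (cst (f x) + (L : 'rV[R]_n -> R^o))) h =
      \sum_(k < n) (f (x + head_part h k.+1) - f (x + head_part h k)
       - h 0 k * 'D_('e_k) f x).
    rewrite sumrB.
    have := @telescope_sumr _ 0 n (fun k => f (x + head_part h k)) (leq0n n).
    rewrite big_mkord head_partn head_part0 addr0 => ->.
    by rewrite /= -![(_ + _ : _ -> _) _]/(_ + _) -![(- _ : _ -> _) _]/(- _) /=
       -![(_ + _ : _ -> _) _]/(_ + _) /cst /= [h + x]addrC opprD addrA.
  apply: (le_trans (ler_norm_sum _ _ _)).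
  apply: (@le_trans _ _ (\sum_(k < n) `|h| * e')); first by apply: ler_sum.
  rewrite sumr_const card_ord -mulr_natr -mulrA mulrC ler_wpM2r //.
  rewrite /e' -mulrA ler_piMr // mulrC ler_pdivrMr // mul1r ler_nat //.
have dL : 'd f x = L :> ('rV[R]_n -> R^o).
  by apply: diff_unique key; exact: lincomb_continuous.
split; last by move=> h; rewrite dL.
apply/diff_locallyP; rewrite dL; split=> //.
exact: lincomb_continuous.
Unshelve. all: by end_near. Qed.

End C1.

Section Chain.
Variables (R : realType) (n m : nat).
Implicit Types (T : 'rV[R]_n -> 'rV[R]_m) (F : 'rV[R]_m -> R).

Lemma differentiable_row T x :
  (forall k, differentiable (fun y => T y 0 k) x) -> differentiable T x.
Proof.
move=> dT.
have -> : T = \sum_k (fun y => T y 0 k *: 'e_k).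
  apply/funext => y; rewrite fct_sumE; apply/rowP => j.
  rewrite summxE (bigD1 j) //= !mxE !eqxx mulr1 big1 ?addr0 // => k kj.
  by rewrite !mxE eqxx /= eq_sym (negbTE kj) mulr0.
by apply: differentiable_sum => k; exact: differentiableZl.
Qed.

Lemma jacobian_entry T x i k : (forall l, differentiable (fun y => T y 0 l) x) ->
  jacobian T x i k = 'D_('e_i) (fun y => T y 0 k) x.
Proof.
move=> dT; have dTx := differentiable_row dT.
have := deriveEjacobian 'e_i dTx; rewrite derive_mx; last exact: diff_derivable.
by move=> /rowP/(_ k); rewrite -rowE !mxE => <-.
Qed.

End Chain.

Section SmoothBasics.
Variables (R : realType) (n : nat).
Implicit Types (A B : set 'rV[R]_n) (f g : 'rV[R]_n -> R) (x y : 'rV[R]_n).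

Lemma smooth_sub A B f : A `<=` B -> smooth B f -> smooth A f.
Proof. by move=> AB sf s x /AB; exact: sf. Qed.

Lemma partials_cat s t f : partials (s ++ t) f = partials s (partials t f).
Proof. by rewrite /partials foldr_cat. Qed.

Lemma smooth_partials A s f : smooth A f -> smooth A (partials s f).
Proof. by move=> sf t x Ax; rewrite -partials_cat; exact: sf. Qed.

Lemma smooth_partial A i f : smooth A f -> smooth A (partial i f).
Proof. exact: smooth_partials. Qed.

Lemma smooth_continuous A f x : smooth A f -> A x -> {for x, continuous f}.
Proof. by move=> sf Ax; have [] := sf [::] x Ax. Qed.

Lemma smooth_derivable A f x i : smooth A f -> A x -> derivable f x 'e_i.
Proof. by move=> sf Ax; have [_] := sf [::] x Ax. Qed.

Lemma partials_eq A s f g : open A -> (forall y, A y -> f y = g y) ->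
  forall y, A y -> partials s f y = partials s g y.
Proof.
move=> oA fg; elim: s => [//|i s IH] y Ay /=.
apply: near_eq_derive; near=> z; apply: IH.
by near: z; exact: open_nbhs_nbhs.
Unshelve. all: by end_near. Qed.

Lemma partial_eq A i f g x : open A -> (forall y, A y -> f y = g y) ->
  A x -> partial i f x = partial i g x.
Proof. by move=> oA fg; exact: (partials_eq [:: i] oA fg). Qed.

Lemma smooth_eq A f g : open A -> (forall y, A y -> f y = g y) ->
  smooth A f -> smooth A g.
Proof.
move=> oA fg sf s x Ax; have [cf df] := sf s x Ax.
have E : \forall y \near x, partials s f y = partials s g y.
  near=> y; apply: (partials_eq s oA fg).
  by near: y; exact: open_nbhs_nbhs.
split.
  suff: partials s g @ x --> partials s g x by [].
  rewrite -(partials_eq s oA fg Ax).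
  exact: cvg_trans (near_eq_cvg E) cf.
by move=> i; apply: near_eq_derivable (df i).
Unshelve. all: by end_near. Qed.

Lemma smooth_locally A f :
  (forall x, A x -> exists B, B x /\ smooth B f) -> smooth A f.
Proof. by move=> h s x /h [B [Bx sf]]; exact: sf. Qed.

Lemma smooth_diff A f x : open A -> smooth A f -> A x ->
  differentiable f x /\ forall h, 'd f x h = \sum_i h 0 i * partial i f x.
Proof.
move=> oA sf Ax; apply: (C1_differentiable oA Ax).
  by move=> i y Ay; exact: smooth_derivable sf Ay.
by move=> i; have [] := sf [:: i] x Ax.
Qed.

(** The mean value theorem is used twice: along e_i for the increment of f in direction e_j, then
    along e_j for the i-th partial derivative. *)
Lemma second_difference A f x i j (t : R) : smooth A f ->
  (forall s r : R, `|s| <= `|t| -> `|r| <= `|t| -> A (x + s *: 'e_i + r *: 'e_j)) ->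
  exists s r : R, [/\ `|s| <= `|t|, `|r| <= `|t| &
    f (x + t *: 'e_i + t *: 'e_j) - f (x + t *: 'e_i) - f (x + t *: 'e_j) + f x
    = t * t * partials [:: j; i] f (x + s *: 'e_i + r *: 'e_j)].
Proof.
move=> sf inA; pose g z := f (z + t *: 'e_j) - f z.
have z0 : `|0 : R| <= `|t| by rewrite normr0.
have dshift z : derivable f (z + t *: 'e_j) 'e_i ->
    is_derive z 'e_i (fun z => f (z + t *: 'e_j)) ('D_('e_i) f (z + t *: 'e_j)).
  move=> df; have E : (fun h : R => h^-1 *: (((fun z => f (z + t *: 'e_j)) \o shift z)
      (h *: 'e_i) - f (z + t *: 'e_j))) = (fun h : R => h^-1 *:
      ((f \o shift (z + t *: 'e_j)) (h *: 'e_i) - f (z + t *: 'e_j))).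
    by apply/funext => h /=; rewrite addrA.
  by split; [rewrite /derivable E | rewrite /derive E].
have dg (s : R) : `|s| <= `|t| ->
    is_derive (x + s *: 'e_i) 'e_i g
      ('D_('e_i) f (x + s *: 'e_i + t *: 'e_j) - 'D_('e_i) f (x + s *: 'e_i)).
  move=> st; apply: is_deriveB; first by apply: dshift; apply: (smooth_derivable sf); exact: inA.
  apply: derivableP; apply: (smooth_derivable sf).
  by have := inA s 0 st z0; rewrite scale0r addr0.
have [|s [st E]] := @line_mvt _ _ g x 'e_i t; first by move=> s /dg [].
have [|r [rt E2]] := @line_mvt _ _ (partial i f) (x + s *: 'e_i) 'e_j t.
  by move=> r rt; apply: (smooth_derivable (smooth_partial i sf)); exact: inA.
exists s, r; split=> //.
rewrite -mulrA; rewrite -[RHS]/(t * (t * 'D_('e_j) (partial i f) _)) -E2 /partial /=.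
have [_ <-] := dg s st; rewrite -E /g opprB addrA addrAC.
by rewrite -!addrA; congr (_ + _); rewrite addrCA; congr (_ + _); rewrite addrC.
Qed.

Lemma continuous_near f x (e : R) : {for x, continuous f} -> 0 < e ->
  \forall y \near x, `|f x - f y| < e.
Proof. by move=> c e0; have /cvgrPdist_lt/(_ _ e0) := c. Qed.

Lemma halves_close (a p q e : R) :
  `|p - a| < e / 2 -> `|q - a| < e / 2 -> `|p - q| <= e.
Proof.
rewrite !ltr_norml => /andP[h1 h2] /andP[h3 h4].
by rewrite ler_norml; apply/andP; split; lra.
Qed.

(** The second difference is symmetric in i and j, so a value of one mixed derivative equals a value
    of the other at points arbitrarily close to x; continuity at x concludes. *)
Lemma schwarz A f x i j : open A -> smooth A f -> A x ->
  partials [:: i; j] f x = partials [:: j; i] f x.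
Proof.
move=> oA sf Ax; apply/eqP; rewrite -subr_eq0 -normr_le0.
apply/ler_addgt0Pl => _/posnumP[e]; rewrite addr0.
have e2 : 0 < e%:num / 2 by rewrite divr_gt0.
have H : \forall y \near x, [/\ A y,
   `|partials [:: i; j] f x - partials [:: i; j] f y| < e%:num / 2 &
   `|partials [:: j; i] f x - partials [:: j; i] f y| < e%:num / 2].
  (* Both mixed derivatives are kept within e/2 of their values at x on a common ball inside A. *)
  have [c1 _] := sf [:: i; j] x Ax; have [c2 _] := sf [:: j; i] x Ax.
  move: (open_nbhs_nbhs (conj oA Ax)) (continuous_near c1 e2) (continuous_near c2 e2).
  by apply: filterS3.
have /nbhs_ballP[r /= r0 Br] := H.
pose t := r / 3.
have t0 : 0 < t by rewrite divr_gt0.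
have normE (k : 'I_n) : `|'e_k : 'rV[R]_n| <= 1.
  apply: norm_le_coord => // l; rewrite mxE eqxx /=.
  by case: (_ == _); rewrite ?normr1 ?normr0.
have inB (k l : 'I_n) (s q : R) : `|s| <= `|t| -> `|q| <= `|t| ->
    ball x r (x + s *: 'e_k + q *: 'e_l).
  move=> st qt; rewrite -ball_normE /= -addrA opprD addrA subrr sub0r normrN.
  apply: (le_lt_trans (ler_normD _ _)); rewrite !normrZ.
  apply: (@le_lt_trans _ _ (t + t)); last by rewrite /t; move: r0; lra.
  by rewrite (gtr0_norm t0) in st qt; apply: lerD; rewrite -[leRHS]mulr1 ler_pM.
have [s1 [r1 [s1t r1t E1]]] := @second_difference A f x i j t sf
  (fun s q st qt => let: And3 h _ _ := Br _ (inB i j s q st qt) in h).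
have [s2 [r2 [s2t r2t E2]]] := @second_difference A f x j i t sf
  (fun s q st qt => let: And3 h _ _ := Br _ (inB j i s q st qt) in h).
have EE : partials [:: j; i] f (x + s1 *: 'e_i + r1 *: 'e_j) =
   partials [:: i; j] f (x + s2 *: 'e_j + r2 *: 'e_i).
  apply: (@mulfI _ (t * t)); first by rewrite mulf_neq0 // gt_eqF.
  apply: (etrans (esym E1)); apply: (etrans _ E2); rewrite (addrAC x (t *: 'e_j)).
  by congr (_ + _); exact: addrAC.
have h1 : `|partials [:: j; i] f x -
    partials [:: j; i] f (x + s1 *: 'e_i + r1 *: 'e_j)| < e%:num / 2.
  have [_ _ h] := Br _ (inB i j s1 r1 s1t r1t); exact: h.
have h2 : `|partials [:: i; j] f x -
    partials [:: i; j] f (x + s2 *: 'e_j + r2 *: 'e_i)| < e%:num / 2.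
  have [_ h _] := Br _ (inB j i s2 r2 s2t r2t); exact: h.
rewrite EE in h1; exact: halves_close h2 h1.
Qed.

End SmoothBasics.

Section ChainRule.
Variables (R : realType) (n m : nat).

Lemma partial_comp (A : set 'rV[R]_n) (B : set 'rV[R]_m)
    (T : 'rV[R]_n -> 'rV[R]_m) (F : 'rV[R]_m -> R) y i :
  open A -> open B -> (forall k, smooth A (fun z => T z 0 k)) -> smooth B F ->
  A y -> B (T y) ->
  derivable (fun z => F (T z)) y 'e_i /\
  partial i (fun z => F (T z)) y =
    \sum_k partial i (fun z => T z 0 k) y * partial k F (T y).
Proof.
move=> oA oB sT sF Ay By.
have dT k : differentiable (fun z => T z 0 k) y by have [] := smooth_diff oA (sT k) Ay.
have dTy := differentiable_row dT.
have [dF EF] := smooth_diff oB sF By.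
have dFT : differentiable (F \o T) y by exact: differentiable_comp.
split; first exact: diff_derivable dFT.
rewrite /partial /= (deriveE _ dFT) diff_comp //= EF.
apply: eq_bigr => k _; congr (_ * _).
rewrite -(jacobian_entry _ _ dT) -deriveE // deriveEjacobian //.
by rewrite -rowE mxE.
Qed.

End ChainRule.

(** * Expressions in jets and their derivatives *)

(** [RS a] denotes a^(-1/2). The type V of variables stays open: it is mainly instantiated by the
    partial derivatives of a family of functions, alone or together with those of a coordinate
    change. *)
Inductive expr (K : Type) (V : Type) :=
| Var of V
| Const of K
| Add of expr K V & expr K V
| Mul of expr K V & expr K V
| RS of expr K V.
Arguments Var {K V}.
Arguments Const {K V}.

Section Expr.
Variables (R : realType) (V : Type).
Notation E := (expr R V).

Fixpoint interp (env : V -> R) (e : E) : R :=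
  match e with
  | Var v => env v
  | Const c => c
  | Add a b => interp env a + interp env b
  | Mul a b => interp env a * interp env b
  | RS a => (Num.sqrt (interp env a))^-1
  end.

Fixpoint dom (env : V -> R) (e : E) : Prop :=
  match e with
  | Var _ | Const _ => True
  | Add a b | Mul a b => dom env a /\ dom env b
  | RS a => dom env a /\ 0 < interp env a
  end.

(* (a^(-1/2))' = -1/2 (a^(-1/2))^3 a' *)
Fixpoint deriv (delta : V -> E) (e : E) : E :=
  match e with
  | Var v => delta v
  | Const _ => Const 0
  | Add a b => Add (deriv delta a) (deriv delta b)
  | Mul a b => Add (Mul (deriv delta a) b) (Mul a (deriv delta b))
  | RS a => Mul (Mul (Const (- 2^-1)) (Mul (RS a) (Mul (RS a) (RS a))))
                (deriv delta a)
  end.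

Definition derivs n (delta : 'I_n -> V -> E) (s : seq 'I_n) (e : E) : E :=
  foldr (fun i => deriv (delta i)) e s.

(** Differentiating a^(-1/2) only produces its powers and a', so no positivity condition arises
    beyond those of e and of the derivatives of the variables. *)
Lemma dom_deriv env delta e : (forall v, dom env (delta v)) ->
  dom env e -> dom env (deriv delta e).
Proof.
move=> dd; elim: e => [v _|c|a IHa b IHb|a IHa b IHb|a IHa] //=.
- by case=> /IHa ? /IHb.
- by case=> da db; split; split=> //; [exact: IHa|exact: IHb].
- by case=> da a0; do !split=> //; exact: IHa.
Qed.

Lemma dom_derivs n env (delta : 'I_n -> V -> E) s e :
  (forall i v, dom env (delta i v)) -> dom env e -> dom env (derivs delta s e).
Proof. by move=> dd de; elim: s => //= i s; exact: dom_deriv. Qed.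

Lemma eq_interp env env' e : env =1 env' -> interp env e = interp env' e.
Proof. by move=> /funext ->. Qed.

Lemma RS_sqr env a : dom env (RS a) -> interp env (RS a) ^+ 2 * interp env a = 1.
Proof.
case=> _ a0 /=; rewrite exprVn sqr_sqrtr ?ltW // mulVf //.
exact: lt0r_neq0.
Qed.

End Expr.

Section InvSqrt.
Variable R : realType.

Lemma is_derive_invsqrt (a : R) : 0 < a ->
  is_derive a 1 (fun t => (Num.sqrt t)^-1) (- 2^-1 * (Num.sqrt a)^-1 ^+ 3).
Proof.
move=> a0; have [d E] := is_derive1_sqrt a0.
have s0 : Num.sqrt a != 0 by rewrite sqrtr_eq0 -ltNge.
split; first exact: derivableV.
rewrite deriveV // E exprS mulrA; rewrite -[_ *: _]/(_ * _).
by field.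
Qed.

Lemma derive_invsqrt_comp n (f : 'rV[R]_n -> R) x v : 0 < f x ->
  derivable f x v ->
  derivable (fun y => (Num.sqrt (f y))^-1) x v /\
  'D_v (fun y => (Num.sqrt (f y))^-1) x =
    - 2^-1 * (Num.sqrt (f x))^-1 ^+ 3 * 'D_v f x.
Proof.
pose phi (s : R) := f (x + s *: v); pose g (t : R) := (Num.sqrt t)^-1.
move=> f0 df; have phi0 : phi 0 = f x by rewrite /phi scale0r addr0.
have := derivable_line f x v 0; have := derive_line f x v 0.
have := derivable_line (fun y => g (f y)) x v 0.
have := derive_line (fun y => g (f y)) x v 0.
rewrite scale0r addr0 -/phi => <- <- <-; rewrite -/phi => E; rewrite -E in df.
have [dg Eg] := is_derive_invsqrt f0; rewrite -phi0 in dg Eg.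
split.
  apply/derivable1_diffP; apply: (@differentiable_comp _ _ _ _ phi g);
  exact/derivable1_diffP.
by have := derive1_comp df dg; rewrite !derive1E Eg phi0.
Qed.

Lemma continuous_invsqrt (T : topologicalType) (f : T -> R) x : 0 < f x ->
  {for x, continuous f} -> {for x, continuous (fun y => (Num.sqrt (f y))^-1)}.
Proof.
move=> f0 cf; apply: (@cvgV R _ (nbhs x)).
  by rewrite sqrtr_eq0 -ltNge.
apply: (@continuous_comp _ _ _ f Num.sqrt) => //.
exact: sqrt_continuous.
Qed.

End InvSqrt.

(** * Differentiating expressions over a closed system of variables *)

Section ExprCalculus.
Variables (R : realType) (V : Type) (n : nat) (A : set 'rV[R]_n).
Variables (env : 'rV[R]_n -> V -> R) (delta : 'I_n -> V -> expr R V).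
Hypothesis oA : open A.

(** [env y v] is the value of the variable v at the point y, and [delta i v] an expression for its
    i-th partial derivative. First-order information on the variables then controls all orders for
    all expressions. *)
Definition closed_system :=
  forall v y, A y ->
    {for y, continuous (fun z => env z v)} /\
    forall i, [/\ derivable (fun z => env z v) y 'e_i,
      partial i (fun z => env z v) y = interp (env y) (delta i v) &
      dom (env y) (delta i v)].

Hypothesis sys : closed_system.

Lemma interp_regular e y : A y -> dom (env y) e ->
  {for y, continuous (fun z => interp (env z) e)} /\
  forall i, derivable (fun z => interp (env z) e) y 'e_i /\
    partial i (fun z => interp (env z) e) y = interp (env y) (deriv (delta i) e).
Proof.
move=> Ay; elim: e => [v _|c _|a IHa b IHb|a IHa b IHb|a IHa].
- by have [cv dv] := sys v Ay; split=> // i; have [] := dv i.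
- split; first exact: cst_continuous.
  by move=> i; split; [exact: derivable_cst | rewrite /partial /= derive_cst].
- move=> [/IHa [ca da] /IHb [cb db]]; split; first exact: continuousD.
  move=> i; have [d1 e1] := da i; have [d2 e2] := db i.
  split; first exact: derivableD.
  by rewrite /= -e1 -e2 /partial /= -deriveD.
- move=> [/IHa [ca da] /IHb [cb db]]; split; first exact: continuousM.
  move=> i; have [d1 e1] := da i; have [d2 e2] := db i.
  split; first exact: derivableM.
  rewrite /= -e1 -e2 /partial /=.
  rewrite -[LHS]/('D_('e_i) ((fun z => interp (env z) a) * (fun z => interp (env z) b)) y).
  by rewrite deriveM // addrC; congr (_ + _); rewrite mulrC.
- move=> [/IHa [ca da] a0]; split; first exact: continuous_invsqrt.
  move=> i; have [d1 e1] := da i.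
  have [d2 e2] := derive_invsqrt_comp a0 d1.
  by split=> //; rewrite /= -e1 /partial /= e2 !exprS expr0 mulr1.
Qed.

Lemma open_dom e : open (A `&` [set y | dom (env y) e]).
Proof.
elim: e => [v|c|a IHa b IHb|a IHa b IHb|a IHa] /=.
- by rewrite setIT.
- by rewrite setIT.
- rewrite (_ : _ `&` _ = (A `&` [set y | dom (env y) a]) `&`
      (A `&` [set y | dom (env y) b])); first exact: openI.
  by apply/seteqP; split=> y /= [Ay [? ?]]; do !split=> //; case: Ay.
- rewrite (_ : _ `&` _ = (A `&` [set y | dom (env y) a]) `&`
      (A `&` [set y | dom (env y) b])); first exact: openI.
  by apply/seteqP; split=> y /= [Ay [? ?]]; do !split=> //; case: Ay.
- rewrite openE => y [Ay [da a0]]; rewrite /interior.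
  have [c _] := interp_regular Ay da.
  have : \forall z \near y, 0 < interp (env z) a.
    exact: (@cvgr_gt _ _ _ (nbhs_filter y) _ _ c _ a0).
  have : \forall z \near y, (A `&` [set y | dom (env y) a]) z.
    by apply: open_nbhs_nbhs; split.
  by apply: filterS2 => z [Az dz] z0.
Qed.

Lemma partials_interp e s y : A y -> dom (env y) e ->
  partials s (fun z => interp (env z) e) y = interp (env y) (derivs delta s e).
Proof.
elim: s y => [//|i s IH] y Ay de /=.
have dd z : A z -> forall i v, dom (env z) (delta i v).
  by move=> Az j v; have [_ /(_ j) []] := sys v Az.
rewrite -(proj2 ((interp_regular Ay (dom_derivs s (dd y Ay) de)).2 i)).
apply: (@partial_eq _ _ (A `&` [set y | dom (env y) e])) => //.
  exact: open_dom.
by move=> z [Az dz]; exact: IH.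
Qed.

Lemma partial_interp e i y : A y -> dom (env y) e ->
  partial i (fun z => interp (env z) e) y = interp (env y) (deriv (delta i) e).
Proof. exact: (partials_interp [:: i]). Qed.

(** Every iterated partial derivative is again the value of an expression, defined wherever e is, so
    continuity and derivability of single expressions give all orders. *)
Lemma smooth_interp e :
  smooth (A `&` [set y | dom (env y) e]) (fun y => interp (env y) e).
Proof.
move=> s y [Ay de].
have dd z : A z -> forall i v, dom (env z) (delta i v).
  by move=> Az j v; have [_ /(_ j) []] := sys v Az.
have ne : \forall z \near y,
    interp (env z) (derivs delta s e) = partials s (fun z => interp (env z) e) z.
  have : \forall z \near y, (A `&` [set y | dom (env y) e]) z.
    by apply: open_nbhs_nbhs; split=> //; exact: open_dom.
  by apply: filterS => z [Az dz]; rewrite partials_interp.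
have [c d] := interp_regular Ay (dom_derivs s (dd y Ay) de).
split; last by move=> i; apply: near_eq_derivable ne (d i).1.
suff: partials s (fun z => interp (env z) e) @ y -->
    partials s (fun z => interp (env z) e) y by [].
rewrite partials_interp //.
exact: cvg_trans (near_eq_cvg ne) c.
Qed.

End ExprCalculus.

Section ExprSums.
Variables (R : realType) (V : Type).
Implicit Types (env : V -> R) (delta : V -> expr R V).

Definition esum (I : finType) (e : I -> expr R V) : expr R V :=
  \big[@Add R V/Const 0]_i e i.

Definition eprod (I : finType) (e : I -> expr R V) : expr R V :=
  \big[@Mul R V/Const 1]_i e i.

Lemma interp_esum env (I : finType) (e : I -> expr R V) :
  interp env (esum e) = \sum_i interp env (e i).
Proof. exact: (big_morph (interp env)). Qed.

Lemma interp_eprod env (I : finType) (e : I -> expr R V) :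
  interp env (eprod e) = \prod_i interp env (e i).
Proof. exact: (big_morph (interp env)). Qed.

Lemma dom_esum env (I : finType) (e : I -> expr R V) :
  (forall i, dom env (e i)) -> dom env (esum e).
Proof. by move=> de; apply: big_ind => //= a b. Qed.

Lemma dom_eprod env (I : finType) (e : I -> expr R V) :
  (forall i, dom env (e i)) -> dom env (eprod e).
Proof. by move=> de; apply: big_ind => //= a b. Qed.

Lemma deriv_esum delta (I : finType) (e : I -> expr R V) :
  deriv delta (esum e) = esum (fun i => deriv delta (e i)).
Proof. exact: (big_morph (deriv delta)). Qed.

End ExprSums.

Section ExprMap.
Variables (R : realType) (V W : Type) (f : V -> W).

Fixpoint emap (e : expr R V) : expr R W :=
  match e with
  | Var v => Var (f v)
  | Const c => Const c
  | Add a b => Add (emap a) (emap b)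
  | Mul a b => Mul (emap a) (emap b)
  | RS a => RS (emap a)
  end.

Lemma interp_emap (env : W -> R) e : interp env (emap e) = interp (env \o f) e.
Proof. by elim: e => //= [a -> b ->|a -> b ->|a ->]. Qed.

Lemma dom_emap (env : W -> R) e : dom env (emap e) = dom (env \o f) e.
Proof. by elim: e => //= [a -> b ->|a -> b ->|a ->]; rewrite ?interp_emap. Qed.

End ExprMap.

Section Congruence.
Variables (R : realType) (V : Type) (n : nat) (A : set 'rV[R]_n).
Variables (env : 'rV[R]_n -> V -> R) (delta : 'I_n -> V -> expr R V).
Hypotheses (oA : open A) (sys : closed_system A env delta).

(** [deriv] is syntactic, so equal values at one point say nothing about derivatives; equality on an
    open set does. This is how identities between different expressions are differentiated. *)
Lemma deriv_congr a b i : (forall y, A y -> dom (env y) a) ->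
  (forall y, A y -> dom (env y) b) ->
  (forall y, A y -> interp (env y) a = interp (env y) b) ->
  forall y, A y -> interp (env y) (deriv (delta i) a) = interp (env y) (deriv (delta i) b).
Proof.
move=> da db ab y Ay; rewrite -!(partial_interp oA sys) //; last 2 first.
- exact: db.
- exact: da.
exact: (partial_eq _ oA ab).
Qed.

Lemma smooth_interp_on e : (forall y, A y -> dom (env y) e) ->
  smooth A (fun y => interp (env y) e).
Proof.
move=> de; apply: smooth_sub (smooth_interp oA sys (e := e)) => y Ay.
by split=> //; exact: de.
Qed.

Lemma deriv_comm e i j y : (forall z, A z -> dom (env z) e) -> A y ->
  interp (env y) (deriv (delta i) (deriv (delta j) e)) =
  interp (env y) (deriv (delta j) (deriv (delta i) e)).
Proof.
move=> de Ay; have := schwarz i j oA (smooth_interp_on de) Ay.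
by rewrite !(partials_interp oA sys) //; exact: de.
Qed.

End Congruence.

Section Family.
Variables (R : realType) (n : nat) (A : set 'rV[R]_n) (I : Type).
Variable f : I -> 'rV[R]_n -> R.

(** A variable is a member of the family together with a word of differentiations, so
    differentiating only lengthens the word. *)
Definition fam_env (y : 'rV[R]_n) (v : I * seq 'I_n) : R :=
  partials v.2 (f v.1) y.

Definition fam_delta (i : 'I_n) (v : I * seq 'I_n) : expr R (I * seq 'I_n) :=
  Var (v.1, i :: v.2).

Lemma fam_system : (forall k, smooth A (f k)) ->
  closed_system A fam_env fam_delta.
Proof. by move=> sf [k w] y Ay; have [] := sf k w y Ay. Qed.

End Family.

(** * Closure properties of smooth functions *)

Section SmoothClosure.
Variables (R : realType) (n : nat) (A : set 'rV[R]_n).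
Hypothesis oA : open A.
Implicit Types f g : 'rV[R]_n -> R.

Lemma smooth_cst (c : R) : smooth A (fun=> c).
Proof.
have sys : closed_system A (fun _ (_ : void) => 0 : R) (fun (_ : 'I_n) _ => Const 0).
  by case.
exact: (smooth_interp_on oA sys (e := Const c)).
Qed.

Let two f g (b : bool) := if b then f else g.

Lemma smooth_two f g e : smooth A f -> smooth A g ->
  (forall y, A y -> dom (fam_env (two f g) y) e) ->
  smooth A (fun y => interp (fam_env (two f g) y) e).
Proof.
move=> sf sg de; have sys : closed_system A (fam_env (two f g)) (@fam_delta R n bool).
  by apply: fam_system; case.
exact: (smooth_interp_on oA sys (e := e)).
Qed.

Lemma smoothD f g : smooth A f -> smooth A g -> smooth A (fun y => f y + g y).
Proof.
move=> sf sg.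
exact: (smooth_two sf sg (e := Add (Var (true, [::])) (Var (false, [::])))).
Qed.

Lemma smoothM f g : smooth A f -> smooth A g -> smooth A (fun y => f y * g y).
Proof.
move=> sf sg.
exact: (smooth_two sf sg (e := Mul (Var (true, [::])) (Var (false, [::])))).
Qed.

Lemma smoothN f : smooth A f -> smooth A (fun y => - f y).
Proof.
move=> sf; apply: smooth_eq (smoothM (smooth_cst (-1)) sf) => // y _.
by rewrite mulN1r.
Qed.

Lemma smoothB f g : smooth A f -> smooth A g -> smooth A (fun y => f y - g y).
Proof. by move=> sf sg; exact: (smoothD sf (smoothN sg)). Qed.

Lemma smoothX f k : smooth A f -> smooth A (fun y => f y ^+ k).
Proof.
move=> sf; elim: k => [|k IH].
  by apply: smooth_eq (smooth_cst 1) => // y _; rewrite expr0.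
by apply: smooth_eq (smoothM sf IH) => // y _; rewrite exprS.
Qed.

(** [RS] asks for a positive argument, so 1/f is written as f ((f^2)^(-1/2))^2, whatever the sign of
    f. *)
Lemma smoothV f : smooth A f -> (forall y, A y -> f y != 0) ->
  smooth A (fun y => (f y)^-1).
Proof.
move=> sf f0; pose v := Var (true, [::]) : expr R (bool * seq 'I_n).
pose r := RS (Mul v v).
have := @smooth_two f f (Mul v (Mul r r)) sf sf.
have pos y : A y -> 0 < f y * f y by move=> Ay; rewrite -expr2 exprn_even_gt0 //= f0.
move=> h; apply: smooth_eq (h _) => //= y Ay; last by have := pos y Ay; do !split.
rewrite /fam_env /=; have Ay' := f0 y Ay.
have s0 : Num.sqrt (f y * f y) != 0 by rewrite sqrtr_eq0 -ltNge pos.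
by rewrite -invfM -expr2 sqr_sqrtr ?ltW ?pos // invfM mulVKf.
Qed.

Lemma smooth_div f g : smooth A f -> smooth A g -> (forall y, A y -> g y != 0) ->
  smooth A (fun y => f y / g y).
Proof. by move=> sf sg g0; exact: (smoothM sf (smoothV sg g0)). Qed.

Lemma partialM f g i y : smooth A f -> smooth A g -> A y ->
  partial i (fun z => f z * g z) y = partial i f y * g y + f y * partial i g y.
Proof.
move=> sf sg Ay; have sys : closed_system A (fam_env (two f g)) (@fam_delta R n bool).
  by apply: fam_system; case.
exact: (partial_interp oA sys (e := Mul (Var (true, [::])) (Var (false, [::])))).
Qed.

End SmoothClosure.

Section SmoothComp.
Variables (R : realType) (n m : nat) (A : set 'rV[R]_n) (B : set 'rV[R]_m).
Variables (I : Type) (T : 'rV[R]_n -> 'rV[R]_m) (F : I -> 'rV[R]_m -> R).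
Hypotheses (oA : open A) (oB : open B).
Hypothesis sT : forall k, smooth A (fun z => T z 0 k).
Hypothesis sF : forall i, smooth B (F i).
Hypothesis AB : forall y, A y -> B (T y).

Definition comp_var : Type := ('I_m * seq 'I_n) + (I * seq 'I_m).

Definition comp_env (y : 'rV[R]_n) (v : comp_var) : R :=
  match v with
  | inl (k, w) => partials w (fun z => T z 0 k) y
  | inr (i, w) => partials w (F i) (T y)
  end.

Definition comp_delta (i : 'I_n) (v : comp_var) : expr R comp_var :=
  match v with
  | inl (k, w) => Var (inl (k, i :: w))
  | inr (o, w) => esum (fun k => Mul (Var (inl (k, [:: i]))) (Var (inr (o, k :: w))))
  end.

(** By the chain rule, differentiating a derivative of F at [T y] gives derivatives of F of one
    order more, with first derivatives of T as coefficients. *)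
Lemma comp_system : closed_system A comp_env comp_delta.
Proof.
case=> [[k w]|[p w]] y Ay.
  by have [] := sT k w Ay.
have [c d] := sF p w (AB Ay); split.
  apply: (@continuous_comp _ _ _ T (partials w (F p))) => //.
  apply: differentiable_continuous; apply: differentiable_row => k.
  by have [] := smooth_diff oA (sT k) Ay.
move=> i; have [d1 d2] := partial_comp i oA oB sT (smooth_partials w (sF p)) Ay (AB Ay).
split=> //; last by apply: dom_esum.
by rewrite [LHS]d2 [RHS]interp_esum.
Qed.

Lemma smooth_comp o : smooth A (fun y => F o (T y)).
Proof. exact: (smooth_interp_on oA comp_system (e := Var (inr (o, [::])))). Qed.

End SmoothComp.

(** * Riemannian geometry of expressions *)

Declare Scope expr_scope.
Delimit Scope expr_scope with X.
Notation "a + b" := (Add a b) : expr_scope.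
Notation "a * b" := (Mul a b) : expr_scope.
Notation "a - b" := (Add a (Mul (Const (-1)) b)) : expr_scope.

Section InterpRules.
Variables (R : realType) (V : Type) (env : V -> R).
Implicit Types (a b : expr R V) (c : R).

Lemma interpD a b : interp env (a + b)%X = interp env a + interp env b.
Proof. by []. Qed.

Lemma interpM a b : interp env (a * b)%X = interp env a * interp env b.
Proof. by []. Qed.

Lemma interpB a b : interp env (a - b)%X = interp env a - interp env b.
Proof. by rewrite /= mulN1r. Qed.

Lemma interpC c : interp env (Const c) = c.
Proof. by []. Qed.

Definition interpE := (interpB, interpD, interpM, interpC).

End InterpRules.

(** * Determinants and inverse matrices as expressions *)

Section Determinant.
Variables (R : realType) (V : Type).
Implicit Types (env : V -> R).

Definition edet n (M : 'I_n -> 'I_n -> expr R V) : expr R V :=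
  esum (fun s : {perm 'I_n} => Mul (Const ((-1) ^+ s)) (eprod (fun i => M i (s i)))).

Definition emx env n (M : 'I_n -> 'I_n -> expr R V) : 'M[R]_n :=
  \matrix_(i, j) interp env (M i j).

Lemma interp_edet env n (M : 'I_n -> 'I_n -> expr R V) :
  interp env (edet M) = \det (emx env M).
Proof.
rewrite interp_esum /determinant; apply: eq_bigr => s _ /=.
by rewrite interp_eprod; congr (_ * _); apply: eq_bigr => i _; rewrite mxE.
Qed.

Lemma dom_edet env n (M : 'I_n -> 'I_n -> expr R V) :
  (forall i j, dom env (M i j)) -> dom env (edet M).
Proof. by move=> dM; apply: dom_esum => s /=; split=> //; exact: dom_eprod. Qed.

Definition edet_sq n (M : 'I_n -> 'I_n -> expr R V) : expr R V :=
  Mul (edet M) (edet M).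

(* The inverse matrix by Cramer's rule, with 1 / D = D ((D^2)^(-1/2))^2. *)
Definition einv n (M : 'I_n -> 'I_n -> expr R V) (i j : 'I_n) : expr R V :=
  Mul (Mul (edet M) (Mul (RS (edet_sq M)) (RS (edet_sq M))))
    (Mul (Const ((-1) ^+ (j + i))) (edet (fun a b => M (lift j a) (lift i b)))).

Lemma dom_einv env n (M : 'I_n -> 'I_n -> expr R V) i j :
  (forall i j, dom env (M i j)) -> \det (emx env M) != 0 -> dom env (einv M i j).
Proof.
move=> dM M0; have dd : dom env (edet M) by exact: dom_edet.
have ds : dom env (RS (edet_sq M)).
  by split=> //; rewrite interpM interp_edet -expr2 exprn_even_gt0.
by split; [|split=> //; exact: dom_edet].
Qed.

Lemma interp_einv env n (M : 'I_n -> 'I_n -> expr R V) i j :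
  \det (emx env M) != 0 -> interp env (einv M i j) = invmx (emx env M) i j.
Proof.
move=> M0; rewrite /invmx unitmxE unitfE M0 /= !mxE /cofactor /=.
rewrite !interp_edet; congr (_ * (_ * _)); last congr (\det _).
  have D2 : 0 < \det (emx env M) * \det (emx env M) by rewrite -expr2 exprn_even_gt0.
  by rewrite -invfM -expr2 sqr_sqrtr ?ltW // invfM mulVKf.
by apply/matrixP => a b; rewrite !mxE.
Qed.

End Determinant.

(** * Curvature, Laplacian and I^2 as expressions *)

Section ExprGeometry.
Variables (R : realType) (V : Type) (d : nat).
Variables (delta : 'I_d -> V -> expr R V) (g : 'I_d -> 'I_d -> expr R V).
Implicit Types (env : V -> R) (a b f : expr R V).

Notation D i := (deriv (delta i)).

Definition echr (k i j : 'I_d) : expr R V :=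
  Mul (Const 2^-1) (esum (fun l => Mul (einv g k l)
     (D i (g j l) + D j (g i l) - D l (g i j))%X)).

Definition eriem (i j l k : 'I_d) : expr R V :=
  (D i (echr l j k) - D j (echr l i k)
   + esum (fun m => echr l i m * echr m j k - echr l j m * echr m i k))%X.

Definition eric (j k : 'I_d) : expr R V := esum (fun i => eriem i j i k).

Definition escal : expr R V :=
  esum (fun j => esum (fun k => Mul (einv g j k) (eric j k))).

Definition eJ : expr R V := Mul escal (Const (2 * (d%:R - 1))^-1).

Definition egrad a b : expr R V :=
  esum (fun i => esum (fun j => Mul (Mul (einv g i j) (D i a)) (D j b))).

Definition elap f : expr R V :=
  esum (fun i => esum (fun j => Mul (einv g i j)
    (D i (D j f) - esum (fun k => echr k i j * D k f)%X)%X)).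

Definition eI f : expr R V :=
  (egrad f f - Const (2 / d%:R) * f * (elap f + eJ * f))%X.

Section Dom.
Variable env : V -> R.
Hypothesis dd : forall i v, dom env (delta i v).
Hypothesis dg : forall i j, dom env (g i j).
Hypothesis detg : \det (emx env g) != 0.

Lemma dom_D i e : dom env e -> dom env (D i e).
Proof. exact: dom_deriv. Qed.

Lemma dom_ginv i j : dom env (einv g i j).
Proof. exact: dom_einv. Qed.

Lemma dom_echr k i j : dom env (echr k i j).
Proof.
split=> //; apply: dom_esum => l; split; first exact: dom_ginv.
by do !split=> //; exact: dom_D.
Qed.

Lemma dom_eriem i j l k : dom env (eriem i j l k).
Proof.
split; first by split; [|split=> //]; apply: dom_D; exact: dom_echr.
by apply: dom_esum => m; split; [split|split=> //; split]; exact: dom_echr.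
Qed.

Lemma dom_escal : dom env escal.
Proof.
apply: dom_esum => j; apply: dom_esum => k; split; first exact: dom_ginv.
by apply: dom_esum => i; exact: dom_eriem.
Qed.

Lemma dom_egrad a b : dom env a -> dom env b -> dom env (egrad a b).
Proof.
move=> da db; apply: dom_esum => j; apply: dom_esum => k.
by split; [split; [exact: dom_ginv | exact: dom_D] | exact: dom_D].
Qed.

Lemma dom_elap f : dom env f -> dom env (elap f).
Proof.
move=> df; apply: dom_esum => j; apply: dom_esum => k.
split; first exact: dom_ginv.
split; first by do 2!apply: dom_D.
split=> //; apply: dom_esum => l; split; [exact: dom_echr | exact: dom_D].
Qed.

Lemma dom_eI f : dom env f -> dom env (eI f).
Proof.
move=> df; split; first exact: dom_egrad.
by split=> //; split; [| split; [exact: dom_elap | split=> //; split=> //; exact: dom_escal]].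
Qed.

End Dom.

Lemma interp_echr env k i j : interp env (echr k i j) =
  2^-1 * \sum_l interp env (einv g k l) * (interp env (D i (g j l)) +
    interp env (D j (g i l)) - interp env (D l (g i j))).
Proof.
rewrite interpM interp_esum; congr (_ * _).
by apply: eq_bigr => l _; rewrite interpM interpB.
Qed.

Lemma interp_eriem env i j l k : interp env (eriem i j l k) =
  interp env (D i (echr l j k)) - interp env (D j (echr l i k)) +
  \sum_m (interp env (echr l i m) * interp env (echr m j k) -
          interp env (echr l j m) * interp env (echr m i k)).
Proof.
rewrite interpD interpB interp_esum; congr (_ + _).
by apply: eq_bigr => m _; rewrite interpB.
Qed.

Lemma interp_escal env : interp env escal =
  \sum_j \sum_k interp env (einv g j k) * \sum_i interp env (eriem i j i k).
Proof.
rewrite interp_esum; apply: eq_bigr => j _; rewrite interp_esum.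
by apply: eq_bigr => k _; rewrite interpM interp_esum.
Qed.

(** * Leibniz rules at a single point *)

Section Leibniz.
Variable env : V -> R.
Hypothesis gsym : forall i j, interp env (einv g i j) = interp env (einv g j i).

Notation "⟦ e ⟧" := (interp env e) (at level 0).

Lemma interp_grad a b :
  ⟦egrad a b⟧ = \sum_i \sum_j ⟦einv g i j⟧ * ⟦D i a⟧ * ⟦D j b⟧.
Proof. by rewrite interp_esum; under eq_bigr do rewrite interp_esum. Qed.

Lemma interp_lap f : ⟦elap f⟧ = \sum_i \sum_j ⟦einv g i j⟧ *
   (⟦D i (D j f)⟧ - \sum_k ⟦echr k i j⟧ * ⟦D k f⟧).
Proof.
rewrite interp_esum; apply: eq_bigr => i _; rewrite interp_esum.
by apply: eq_bigr => j _; rewrite /= interp_esum mulN1r.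
Qed.

Lemma egradC a b : ⟦egrad a b⟧ = ⟦egrad b a⟧.
Proof.
rewrite !interp_grad exchange_big; apply: eq_bigr => i _; apply: eq_bigr => j _.
by rewrite gsym mulrAC.
Qed.

Lemma egrad_lin a b c e (p q : R) :
  (forall i, ⟦D i a⟧ = p * ⟦D i b⟧ + q * ⟦D i c⟧) ->
  ⟦egrad a e⟧ = p * ⟦egrad b e⟧ + q * ⟦egrad c e⟧.
Proof.
move=> E; rewrite !interp_grad !mulr_sumr -big_split; apply: eq_bigr => i _.
rewrite !mulr_sumr -big_split; apply: eq_bigr => j _ /=; rewrite E; ring.
Qed.

Lemma egradM a b e :
  ⟦egrad (a * b)%X e⟧ = ⟦a⟧ * ⟦egrad b e⟧ + ⟦b⟧ * ⟦egrad a e⟧.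
Proof. by apply: egrad_lin => i /=; ring. Qed.

Lemma egradD a b e : ⟦egrad (a + b)%X e⟧ = ⟦egrad a e⟧ + ⟦egrad b e⟧.
Proof. by rewrite (@egrad_lin _ a b e 1 1) ?mul1r // => i /=; ring. Qed.

Lemma egradC0 (c : R) e : ⟦egrad (Const c) e⟧ = 0.
Proof.
by rewrite (@egrad_lin _ e e e 0 0) ?mul0r ?addr0 // => i /=; ring.
Qed.

Lemma egradRS a e :
  ⟦egrad (RS a) e⟧ = - 2^-1 * ⟦RS a⟧ ^+ 3 * ⟦egrad a e⟧.
Proof.
rewrite (@egrad_lin _ a a e (- 2^-1 * ⟦RS a⟧ ^+ 3) 0) ?mul0r ?addr0 // => i /=.
ring.
Qed.

(** The sum, product and inverse root rules for the Laplacian are all instances. The Christoffel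
    terms see only first derivatives, and the symmetric remainder contracts to twice r times an
    inner product of gradients. *)
Lemma elap_lin a b c e h (p q r : R) :
  (forall i, ⟦D i a⟧ = p * ⟦D i b⟧ + q * ⟦D i c⟧) ->
  (forall i j, ⟦D i (D j a)⟧ = p * ⟦D i (D j b)⟧ + q * ⟦D i (D j c)⟧ +
     r * (⟦D i e⟧ * ⟦D j h⟧ + ⟦D i h⟧ * ⟦D j e⟧)) ->
  ⟦elap a⟧ = p * ⟦elap b⟧ + q * ⟦elap c⟧ + 2 * r * ⟦egrad e h⟧.
Proof.
move=> E1 E2; have -> : 2 * r * ⟦egrad e h⟧ = r * (⟦egrad e h⟧ + ⟦egrad h e⟧).
  by rewrite (egradC h e); ring.
rewrite !interp_lap !interp_grad -big_split !mulr_sumr -!big_split.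
apply: eq_bigr => i _ /=; rewrite -big_split !mulr_sumr -!big_split.
apply: eq_bigr => j _ /=; rewrite E2.
have -> : \sum_k ⟦echr k i j⟧ * ⟦D k a⟧ =
   p * (\sum_k ⟦echr k i j⟧ * ⟦D k b⟧) + q * (\sum_k ⟦echr k i j⟧ * ⟦D k c⟧).
  rewrite !mulr_sumr -big_split; apply: eq_bigr => k _ /=; rewrite E1; ring.
ring.
Qed.

Lemma elapM a b : ⟦elap (a * b)%X⟧ =
  ⟦a⟧ * ⟦elap b⟧ + ⟦b⟧ * ⟦elap a⟧ + 2 * ⟦egrad a b⟧.
Proof.
rewrite (@elap_lin _ b a a b ⟦a⟧ ⟦b⟧ 1) ?mulr1 // => [i|i j] /=; ring.
Qed.

Lemma elapD a b : ⟦elap (a + b)%X⟧ = ⟦elap a⟧ + ⟦elap b⟧.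
Proof.
rewrite (@elap_lin _ a b a b 1 1 0) ?mulr0 ?mul0r ?addr0 ?mul1r // => [i|i j] /=; ring.
Qed.

Lemma elapC (c : R) : ⟦elap (Const c)⟧ = 0.
Proof.
rewrite (@elap_lin _ (Const c) (Const c) (Const c) (Const c) 0 0 0)
  ?mulr0 ?mul0r ?addr0 // => [i|i j] /=; ring.
Qed.

Lemma elapRS a : ⟦elap (RS a)⟧ =
  - 2^-1 * ⟦RS a⟧ ^+ 3 * ⟦elap a⟧ + 3 / 4 * ⟦RS a⟧ ^+ 5 * ⟦egrad a a⟧.
Proof.
(* The second derivative of a^(-1/2) is 3/4 a^(-5/2); [elap_lin] doubles r, hence 3/8. *)
rewrite (@elap_lin _ a a a a (- 2^-1 * ⟦RS a⟧ ^+ 3) 0 (3 / 8 * ⟦RS a⟧ ^+ 5)).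
- by rewrite mul0r addr0; congr (_ + _ * _); field.
- by move=> i /=; ring.
- by move=> i j /=; move: (Num.sqrt _)^-1 => r; field.
Qed.

(** The term in J contains no derivatives, so it is absorbed in w^2 I^2(f); only the gradient and
    the Laplacian of w are left over. *)
Lemma eI_mul f w : ⟦eI (f * w)%X⟧ = ⟦w⟧ ^+ 2 * ⟦eI f⟧
  + 2 * (1 - 2 / d%:R) * ⟦f⟧ * ⟦w⟧ * ⟦egrad f w⟧
  + ⟦f⟧ ^+ 2 * (⟦egrad w w⟧ - 2 / d%:R * ⟦w⟧ * ⟦elap w⟧).
Proof.
rewrite /= elapM egradM (egradC w) (egradC f (Mul f w)) !egradM (egradC w f); ring.
Qed.

Fixpoint epow k f a : expr R V := if k is k'.+1 then Mul f (epow k' f a) else a.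

Lemma interp_epow k f a : ⟦epow k f a⟧ = ⟦f⟧ ^+ k * ⟦a⟧.
Proof. by elim: k => [|k /= ->]; rewrite ?expr0 ?mul1r // exprS mulrA. Qed.

Lemma dom_epow k f a : dom env f -> dom env a -> dom env (epow k f a).
Proof. by move=> df da; elim: k. Qed.

(** The factor f on the left avoids the exponent k - 1 and treats k = 0 uniformly; the Laplacian
    below takes f^2 for the same reason. *)
Lemma egrad_pow k f a e : ⟦f⟧ * ⟦egrad (epow k f a) e⟧ =
  ⟦f⟧ ^+ k * (k%:R * ⟦a⟧ * ⟦egrad f e⟧ + ⟦f⟧ * ⟦egrad a e⟧).
Proof.
elim: k => [|k IH] /=; first by rewrite expr0 !mul0r add0r mul1r.
rewrite egradM mulrDr mulrCA (mulrA _ ⟦f⟧ ⟦egrad _ _⟧) -(mulrA _ ⟦f⟧ ⟦egrad _ _⟧).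
rewrite IH interp_epow exprS -natr1; ring.
Qed.

Lemma elap_pow k f a : ⟦f⟧ ^+ 2 * ⟦elap (epow k f a)⟧ =
  ⟦f⟧ ^+ k * (k%:R * (k%:R - 1) * ⟦a⟧ * ⟦egrad f f⟧
     + k%:R * ⟦f⟧ * ⟦a⟧ * ⟦elap f⟧
     + 2 * k%:R * ⟦f⟧ * ⟦egrad f a⟧ + ⟦f⟧ ^+ 2 * ⟦elap a⟧).
Proof.
elim: k => [|k IH] /=; first by rewrite expr0 !mul0r !mulr0 !mul0r !add0r mul1r.
rewrite elapM egradC.
have -> : ⟦f⟧ ^+ 2 * (⟦f⟧ * ⟦elap (epow k f a)⟧ + ⟦epow k f a⟧ * ⟦elap f⟧
   + 2 * ⟦egrad (epow k f a) f⟧) = ⟦f⟧ * (⟦f⟧ ^+ 2 * ⟦elap (epow k f a)⟧)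
   + ⟦f⟧ ^+ 2 * ⟦epow k f a⟧ * ⟦elap f⟧
   + 2 * ⟦f⟧ * (⟦f⟧ * ⟦egrad (epow k f a) f⟧) by ring.
rewrite IH egrad_pow interp_epow (egradC a f) (exprS _ k) -[k.+1%:R]natr1; ring.
Qed.

End Leibniz.

End ExprGeometry.

#[global] Opaque einv echr eriem eric escal egrad elap.

(** * Improving the order of an approximate solution *)

Section StepAlgebra.
Variable R : realType.

(** Here x, y, y1 stand for f, f^k, f^(k-1), A for the error, r for (1 + c y A)^(-1/2), G for
    |df|^2, E for the Laplacian of f plus J f. The left side is I^2(x r) as given by [eI_mul]. For k
    = 0 the truncated exponent makes y1 = 1, so y = x y1 is only assumed after multiplication by
    kk. *)
Lemma step_algebra (dd kk x y y1 A r G E L LA GFA GAA c : R) :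
  dd != 0 -> kk + 1 != 0 -> dd - kk != 0 -> c = dd / ((kk + 1) * (dd - kk)) ->
  kk * y = kk * (x * y1) -> r ^+ 2 * (1 + c * (y * A)) = 1 ->
  G - 2 / dd * x * E = 1 + y * A ->
  r ^+ 2 * (1 + y * A)
  - (1 - 2 / dd) * r ^+ 4 * (c * (y * (kk * A * G + x * GFA)))
  + (4^-1 - 3 / (2 * dd)) * r ^+ 6 * (c ^+ 2 * (y ^+ 2 *
       (kk ^+ 2 * A ^+ 2 * G + 2 * kk * A * x * GFA + x ^+ 2 * GAA)))
  + dd^-1 * r ^+ 4 * (c * (y * (kk * (kk - 1) * A * G + kk * x * A * L
       + 2 * kk * x * GFA + x ^+ 2 * LA)))
  = 1 + y * (x * (kk * (dd - kk - 1) / dd * c * r ^+ 4 * A * ((c - 1) * y1 * A - 2 / dd * E)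
     - (1 - 2 / dd) * r ^+ 4 * c * GFA
     + (4^-1 - 3 / (2 * dd)) * r ^+ 6 * c ^+ 2 * (kk ^+ 2 * y1 * A ^+ 2 * G
           + y * (2 * kk * A * GFA + x * GAA))
     + dd^-1 * r ^+ 4 * c * (kk * A * L + 2 * kk * GFA + x * LA))).
Proof.
move=> d0 k0 dk0 cE yE rE GE; pose kap := kk * (dd - kk - 1) / dd.
(* To leading order the coefficient of y A is 1 - c - c kap: 1 from I^2(f), -c from r^2, and -c kap
   from the gradient and Laplacian of y A, because -k (1 - 2/d) + k (k-1)/d = -kap. The value of c
   makes it zero. *)
have cK : 1 - c = c * kap by rewrite cE /kap; field; rewrite d0 k0 dk0.
have h1 : r ^+ 2 * (1 + y * A) = 1 + r ^+ 2 * y * A * (1 - c).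
  transitivity (r ^+ 2 * (1 + c * (y * A)) + r ^+ 2 * y * A * (1 - c)); first ring.
  by rewrite rE.
(* The exact form of this cancellation: r^2 (1 + c y A) = 1 is inserted, and 1 + c y A is rewritten
   through the equation for G, which leaves a remainder divisible by x. *)
have h2 : r ^+ 2 * A * (1 - c) =
    kap * c * r ^+ 4 * A * (G + (c - 1) * y * A - 2 / dd * x * E).
  have -> : G + (c - 1) * y * A - 2 / dd * x * E = 1 + c * (y * A).
    have -> : G = 1 + y * A + 2 / dd * x * E by rewrite -GE; ring.
    ring.
  have -> : kap * c * r ^+ 4 * A * (1 + c * (y * A)) =
    kap * c * r ^+ 2 * A * (r ^+ 2 * (1 + c * (y * A))) by ring.
  by rewrite rE cK; ring.
have h3 : kk * kk * y - kk * kk * (x * y1) = 0 by rewrite -!mulrA yE subrr.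
have h4 : kap * y - kap * (x * y1) = 0.
  have -> : kap * y - kap * (x * y1) = (dd - kk - 1) / dd * (kk * y - kk * (x * y1)).
    by rewrite /kap; ring.
  by rewrite yE subrr mulr0.
rewrite h1 -/kap; apply/eqP; rewrite -subr_eq0; apply/eqP.
transitivity (y * ((r ^+ 2 * A * (1 - c) -
    kap * c * r ^+ 4 * A * (G + (c - 1) * y * A - 2 / dd * x * E))
  + (4^-1 - 3 / (2 * dd)) * r ^+ 6 * c ^+ 2 * A ^+ 2 * G *
     (kk * kk * y - kk * kk * (x * y1))
  + c * r ^+ 4 * A * A * (c - 1) * (kap * y - kap * (x * y1)))).
  by rewrite /kap; field; rewrite ?d0 //.
by rewrite h2 subrr h3 h4 !mulr0 !addr0 mulr0.
Qed.

End StepAlgebra.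

Section Iteration.
Variables (R : realType) (V : Type) (d : nat).
Variables (delta : 'I_d -> V -> expr R V) (g : 'I_d -> 'I_d -> expr R V).
Implicit Types (a f : expr R V).

(** For k >= 1, replacing f by f (1 + f^k b) changes I^2 by (2/d) (k+1) (d-k) f^k b to leading
    order, and the factor (1 + c f^k a)^(-1/2) corresponds to b = -c a / 2; this c cancels f^k a.
    For k = 0 it equals 1, and the step divides f by the square root of I^2. *)
Definition step_cst (k : nat) : R := d%:R / (k.+1%:R * (d%:R - k%:R)).

Definition step_mod k f a : expr R V :=
  (Const 1 + Const (step_cst k) * epow k f a)%X.

Definition step_density k f a : expr R V := Mul f (RS (step_mod k f a)).

(* With w the factor of [step_density], w^-1 = w * step_mod: the last factor
   converts the coefficient of f^(k+1) into that of (f w)^(k+1). *)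
Definition step_error k f a : expr R V :=
  let c := step_cst k in
  let q1 := k%:R * (d%:R - k%:R - 1) / d%:R * c in
  let q2 := 1 - 2 / d%:R in
  let q3 := 4^-1 - 3 / (2 * d%:R) in
  let K r := Const r : expr R V in
  let m := step_mod k f a in
  let w := RS m in
  let w2 := Mul w w in
  let w4 := Mul w2 w2 in
  let G := egrad delta g f f in
  let GFA := egrad delta g f a in
  let GAA := egrad delta g a a in
  let L := elap delta g f in
  let LA := elap delta g a in
  let E := (L + eJ delta g * f)%X in
  let y1 := epow k.-1 f (Const 1) in
  let y := epow k f (Const 1) in
  epow k.+1 (Mul w m)
   (K q1 * w4 * a * (K (c - 1)%R * y1 * a - K (2 / d%:R)%R * E)
     - K q2 * w4 * K c * GFA
     + K q3 * (w4 * w2) * K (c ^+ 2)%R * (K (k%:R ^+ 2)%R * y1 * (a * a) * G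
           + y * (K (2 * k%:R)%R * a * GFA + f * GAA))
     + K d%:R^-1%R * w4 * K c * (K k%:R * a * L + K (2 * k%:R)%R * GFA + f * LA))%X.

Variable env : V -> R.
Hypothesis gsym : forall i j, interp env (einv g i j) = interp env (einv g j i).

Notation "⟦ e ⟧" := (interp env e) (at level 0).

Lemma dom_step_density k f a : dom env (step_density k f a) ->
  [/\ dom env f, dom env a & 0 < ⟦step_mod k f a⟧].
Proof.
case=> df [dm m0]; split=> //; case: dm => _ [_].
by elim: k {m0} => //= k IH [].
Qed.

Lemma dom_step_error k f a : (forall i v, dom env (delta i v)) ->
  (forall i j, dom env (g i j)) -> \det (emx env g) != 0 ->
  dom env a -> dom env (step_density k f a) -> dom env (step_error k f a).
Proof.
move=> dd dg detg da [df dw]; have [dm m0] := dw.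
have G1 := dom_egrad dd dg detg; have L1 := dom_elap dd dg detg.
have J1 := dom_escal dd dg detg.
apply: dom_epow; first by split.
have dy j : dom env (epow j f (Const 1)) by apply: dom_epow.
have dE : dom env (elap delta g f + eJ delta g * f)%X.
  by split; [exact: L1 | split=> //; split].
have w2 : dom env (Mul (RS (step_mod k f a)) (RS (step_mod k f a))) by split.
have w4 := conj w2 w2.
by repeat match goal with
| |- dom env (Add _ _) => split
| |- dom env (Mul _ _) => split
| |- dom env (Const _) => exact: I
| |- dom env (egrad _ _ _ _) => exact: G1
| |- dom env (elap _ _ _) => exact: L1
| |- _ => done
end.
Qed.

(** [eI_mul] with w = [RS (step_mod k f a)] reduces I^2 to gradients and Laplacians of f^k a;
    [egrad_pow] and [elap_pow] expand these, each coming with exactly the powers of f that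
    [step_algebra] expects. *)
Lemma step_correct k f a : (k < d)%N -> dom env (step_density k f a) ->
  ⟦eI delta g f⟧ = 1 + ⟦f⟧ ^+ k * ⟦a⟧ ->
  ⟦eI delta g (step_density k f a)⟧ =
  1 + ⟦step_density k f a⟧ ^+ k.+1 * ⟦step_error k f a⟧.
Proof.
move=> kd [_ dw] If.
have rE : ⟦RS (step_mod k f a)⟧ ^+ 2 * ⟦step_mod k f a⟧ = 1 by exact: RS_sqr.
set m := step_mod k f a in dw rE *.
have mE : ⟦m⟧ = 1 + step_cst k * (⟦f⟧ ^+ k * ⟦a⟧) by rewrite /m /= interp_epow.
have grm e : ⟦egrad delta g m e⟧ = step_cst k * ⟦egrad delta g (epow k f a) e⟧.
  by rewrite egradD egradM !egradC0 /= add0r mulr0 addr0.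
have lpm : ⟦elap delta g m⟧ = step_cst k * ⟦elap delta g (epow k f a)⟧.
  by rewrite elapD // elapM // !elapC // egradC0 /= add0r !mulr0 !addr0.
rewrite {1}/step_density -/m eI_mul // (egradC _ gsym f (RS m)) !egradRS.
rewrite elapRS // (egradC _ gsym m (RS m)) egradRS -[in LHS]/m.
rewrite !grm (egradC _ gsym _ m) grm lpm If.
set r := ⟦RS m⟧ in rE *; set x := ⟦f⟧; set A := ⟦a⟧; set c := step_cst k in mE *.
set P := epow k f a.
have gP e : x * ⟦egrad delta g P e⟧ = x ^+ k * (k%:R * A * ⟦egrad delta g f e⟧ + x * ⟦egrad delta g a e⟧).
  by rewrite egrad_pow.
have lP := elap_pow delta gsym k f a; rewrite -/P -/x -/A in lP.
have gPf := gP f; rewrite (egradC _ gsym a f) in gPf.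
have gPP : x ^+ 2 * ⟦egrad delta g P P⟧ = (x ^+ k) ^+ 2 * (k%:R ^+ 2 * A ^+ 2 * ⟦egrad delta g f f⟧
    + 2 * k%:R * A * x * ⟦egrad delta g f a⟧ + x ^+ 2 * ⟦egrad delta g a a⟧).
  rewrite expr2 -mulrA gP (egradC _ gsym f P) (egradC _ gsym a P).
  have -> : x * (x ^+ k * (k%:R * A * ⟦egrad delta g P f⟧ + x * ⟦egrad delta g P a⟧)) =
     x ^+ k * (k%:R * A * (x * ⟦egrad delta g P f⟧) + x * (x * ⟦egrad delta g P a⟧)) by ring.
  by rewrite gPf gP; ring.
have d0 : d%:R != 0 :> R by rewrite pnatr_eq0 -lt0n (leq_ltn_trans _ kd).
have k0 : k%:R + 1 != 0 :> R by rewrite natr1 pnatr_eq0.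
have dk0 : d%:R - k%:R != 0 :> R by rewrite subr_eq0 eqr_nat gtn_eqF.
have cE : c = d%:R / ((k%:R + 1) * (d%:R - k%:R)) by rewrite natr1.
have yE : k%:R * x ^+ k = k%:R * (x * x ^+ k.-1).
  by case: (k) => [|j]; rewrite ?mul0r // -exprS.
rewrite mE in rE.
have GE : ⟦egrad delta g f f⟧ - 2 / d%:R * x * (⟦elap delta g f⟧ + ⟦eJ delta g⟧ * x)
    = 1 + x ^+ k * A by rewrite -If /x /=; ring.
have := step_algebra (⟦elap delta g f⟧) (⟦elap delta g a⟧) (⟦egrad delta g f a⟧)
   (⟦egrad delta g a a⟧) d0 k0 dk0 cE yE rE GE.
rewrite -gPf -gPP -lP => alg.
transitivity (r ^+ 2 * (1 + x ^+ k * A)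
  - (1 - 2 / d%:R) * r ^+ 4 * (c * (x * ⟦egrad delta g P f⟧))
  + (4^-1 - 3 / (2 * d%:R)) * r ^+ 6 * (c ^+ 2 * (x ^+ 2 * ⟦egrad delta g P P⟧))
  + d%:R^-1 * r ^+ 4 * (c * (x ^+ 2 * ⟦elap delta g P⟧))).
  by field; rewrite d0.
rewrite alg /step_error interp_epow -/m; congr (1 + _).
have -> : ⟦step_density k f a⟧ = x * r by [].
have -> : ⟦(RS m * m)%X⟧ = r * ⟦m⟧ by [].
have rm : (x * r) ^+ k.+1 * (r * ⟦m⟧) ^+ k.+1 = x ^+ k * x.
  have -> : (x * r) ^+ k.+1 * (r * ⟦m⟧) ^+ k.+1 = (x * (r ^+ 2 * ⟦m⟧)) ^+ k.+1.
    by rewrite -exprMn; congr (_ ^+ _); ring.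
  by rewrite mE rE mulr1 exprSr.
rewrite [RHS]mulrA rm -[RHS]mulrA; congr (_ * (_ * _)).
rewrite /r /= !interp_epow /= -/x -/A.
rewrite -/c; move: (x ^+ k.-1) (x ^+ k) (_ / (2 * (d%:R - 1))) => y1 y J.
move: (Num.sqrt _)^-1 => r0; ring.
Qed.

End Iteration.

(** * The geometry of a chart expressed by expressions *)

Section Bridge.
Variables (R : realType) (d : nat) (M : manifold R d) (g : metric M).
Variables (phi : chart R d M) (f : M -> R).
Variables (V : Type) (A : set 'rV[R]_d).
Variables (env : 'rV[R]_d -> V -> R) (delta : 'I_d -> V -> expr R V).
Variables (eg : 'I_d -> 'I_d -> expr R V) (ef : expr R V).
Hypotheses (oA : open A) (sys : closed_system A env delta).
Hypothesis dg : forall y i j, A y -> dom (env y) (eg i j).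
Hypothesis gE : forall y i j, A y -> gcomp g phi i j y = interp (env y) (eg i j).
Hypothesis detg : forall y, A y -> \det (emx (env y) eg) != 0.
Hypothesis df : forall y, A y -> dom (env y) ef.
Hypothesis fE : forall y, A y -> local_expr phi f y = interp (env y) ef.

Let dd y : A y -> forall i v, dom (env y) (delta i v).
Proof. by move=> Ay i v; have [_ /(_ i) []] := sys v Ay. Qed.

Lemma sys_partial (F : 'rV[R]_d -> R) e i y :
  (forall z, A z -> dom (env z) e) -> (forall z, A z -> F z = interp (env z) e) ->
  A y -> partial i F y = interp (env y) (deriv (delta i) e).
Proof.
move=> de FE Ay; rewrite -(partial_interp oA sys) //; last exact: de.
exact: partial_eq FE Ay.
Qed.

Lemma bridge_ginv i j y : A y -> ginv g phi i j y = interp (env y) (einv eg i j).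
Proof.
move=> Ay; rewrite interp_einv; last exact: detg.
rewrite /ginv /local_expr; congr (invmx _ i j).
by apply/matrixP => a b; rewrite mxE -gE.
Qed.

Lemma bridge_chr k i j y : A y ->
  christoffel g phi k i j y = interp (env y) (echr delta eg k i j).
Proof.
move=> Ay; rewrite /christoffel interp_echr; congr (_ * _).
apply: eq_bigr => l _; rewrite bridge_ginv //.
have P a b c := @sys_partial _ _ c y (fun z Az => dg a b Az) (fun z Az => gE a b Az) Ay.
by rewrite !P.
Qed.

Lemma bridge_riem i j l k y : A y ->
  riemann g phi i j l k y = interp (env y) (eriem delta eg i j l k).
Proof.
move=> Ay; rewrite /riemann interp_eriem.
have P a b c e := @sys_partial _ _ e y
  (fun z Az => dom_echr (dd Az) (fun i j => dg i j Az) (detg Az) a b c)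
  (fun z Az => bridge_chr a b c Az) Ay.
rewrite !P; congr (_ + _).
by apply: eq_bigr => m _; rewrite !bridge_chr.
Qed.

Lemma bridge_J y : A y -> schouten_trace g phi y = interp (env y) (eJ delta eg).
Proof.
move=> Ay; rewrite /schouten_trace /scalar_curvature /eJ interpM interp_escal; congr (_ / _).
apply: eq_bigr => j _; apply: eq_bigr => k _.
rewrite bridge_ginv //; congr (_ * _).
by apply: eq_bigr => i _; exact: bridge_riem.
Qed.

Lemma bridge_lap y : A y ->
  laplacian g phi (local_expr phi f) y = interp (env y) (elap delta eg ef).
Proof.
move=> Ay; rewrite interp_lap; apply: eq_bigr => i _; apply: eq_bigr => j _.
have P e z := @sys_partial _ _ e z df fE.
rewrite bridge_ginv //; congr (_ * (_ - _)).
  apply: (sys_partial (F := partial j (local_expr phi f))) => // z Az; last exact: P.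
  by apply: dom_D; [exact: dd | exact: df].
by apply: eq_bigr => k _; rewrite bridge_chr // P.
Qed.

(** Both the closed system and the expressions for metric and function are arbitrary, because this
    is applied to the jets of g and sigma, to rescaled and pulled back metrics, and to the
    approximations s_k. *)
Lemma bridge_Isq x : A (phi x) ->
  Isq g phi f x = interp (env (phi x)) (eI delta eg ef).
Proof.
move=> Ay; rewrite /Isq bridge_lap // bridge_J // interpB !interpM interpD interpM interp_grad !fE //.
congr (_ - _); apply: eq_bigr => i _; apply: eq_bigr => j _.
by rewrite bridge_ginv // !(sys_partial _ df fE).
Qed.

End Bridge.

(** * Conformal change of the metric *)

Section Kronecker.
Variables (R : realType) (I : finType).
Implicit Types (F : I -> R).

Definition krd (i j : I) : R := (i == j)%:R.

Lemma krdC i j : krd i j = krd j i.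
Proof. by rewrite /krd eq_sym. Qed.

Lemma sum_krd F j : \sum_i krd i j * F i = F j.
Proof.
rewrite (bigD1 j) //= /krd eqxx mul1r big1 ?addr0 // => i /negbTE ->.
by rewrite mul0r.
Qed.

Lemma sum_krd' F j : \sum_i krd j i * F i = F j.
Proof. by rewrite -[RHS]sum_krd; apply: eq_bigr => i _; rewrite krdC. Qed.

End Kronecker.

Section Contraction.
Variables (R : realType) (I : finType) (h : I -> I -> R).
Implicit Types X Y : I -> I -> R.

Definition ctr X : R := \sum_i \sum_j h i j * X i j.

Lemma ctrD X Y : ctr (fun i j => X i j + Y i j) = ctr X + ctr Y.
Proof.
rewrite -big_split; apply: eq_bigr => i _; rewrite -big_split.
by apply: eq_bigr => j _; rewrite mulrDr.
Qed.

Lemma ctrZ (r : R) X : ctr (fun i j => r * X i j) = r * ctr X.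
Proof.
rewrite mulr_sumr; apply: eq_bigr => i _; rewrite mulr_sumr.
by apply: eq_bigr => j _; rewrite mulrCA.
Qed.

Lemma ctrN X : ctr (fun i j => - X i j) = - ctr X.
Proof.
rewrite -mulN1r -ctrZ; apply: eq_bigr => i _; apply: eq_bigr => j _.
by rewrite mulN1r.
Qed.

Lemma ctrB X Y : ctr (fun i j => X i j - Y i j) = ctr X - ctr Y.
Proof. by rewrite ctrD ctrN. Qed.

Lemma eq_ctr X Y : (forall i j, X i j = Y i j) -> ctr X = ctr Y.
Proof. by move=> XY; apply: eq_bigr => i _; apply: eq_bigr => j _; rewrite XY. Qed.

Lemma ctr_sum (J : finType) (X : J -> I -> I -> R) :
  ctr (fun i j => \sum_k X k i j) = \sum_k ctr (X k).
Proof.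
rewrite /ctr [RHS]exchange_big /=; apply: eq_bigr => i _ /=.
by rewrite [RHS]exchange_big /=; apply: eq_bigr => j _; rewrite mulr_sumr.
Qed.

Lemma ctrC X : (forall i j, h i j = h j i) -> ctr (fun i j => X j i) = ctr X.
Proof.
move=> hs; rewrite /ctr exchange_big; apply: eq_bigr => i _.
by apply: eq_bigr => j _; rewrite hs.
Qed.

End Contraction.

Section ConformalAlgebra.
Variables (R : realType) (d : nat).
Notation I := 'I_d.
Variables (G h : I -> I -> R) (Gam : I -> I -> I -> R) (dGam : I -> I -> I -> I -> R).
Variables (u uu : I -> R) (du duu : I -> I -> R) (dG : I -> I -> I -> R).
Hypothesis Gs : forall i j, G i j = G j i.
Hypothesis hs : forall i j, h i j = h j i.
Hypothesis hG : forall i j, \sum_k h i k * G k j = krd R i j.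
Hypothesis Gams : forall k i j, Gam k i j = Gam k j i.
Hypothesis compat : forall p i j,
  dG p i j = \sum_m (Gam m p i * G m j + Gam m p j * G m i).
Hypothesis uuE : forall k, uu k = \sum_l h k l * u l.
Hypothesis duuE : forall p k, \sum_i (duu p i * G i k + uu i * dG p i k) = du p k.

(** The change of the Christoffel symbols under g -> Omega^2 g, with u = d(log Omega) and uu its
    gradient. The section works at one point: du, duu and dG are arrays standing for derivatives,
    tied to u, uu and G only by the hypotheses, and [confdC p] is the p-th derivative of [confC]. *)
Definition confC (k i j : I) : R :=
  krd R k j * u i + krd R k i * u j - uu k * G i j.

Definition confdC (p k i j : I) : R :=
  krd R k j * du p i + krd R k i * du p j - duu p k * G i j - uu k * dG p i j.

(** box - vu is the Laplacian of log Omega and nu its squared gradient; t and tu come from traces of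
    Christoffel symbols and must drop out in the end. *)
Let t m := \sum_i Gam i i m.
Let tu := \sum_m t m * uu m.
Let box := ctr h du.
Let vu := ctr h (fun i j => \sum_m Gam m i j * u m).
Let nu := \sum_m u m * uu m.

Lemma Guu k : \sum_i uu i * G i k = u k.
Proof.
under eq_bigr do rewrite uuE mulr_suml.
rewrite exchange_big /= -[RHS](sum_krd u k); apply: eq_bigr => l _.
rewrite -hG mulr_suml; apply: eq_bigr => i _; rewrite hs; ring.
Qed.

Lemma confC_sym k i j : confC k i j = confC k j i.
Proof. by rewrite /confC (Gs i j); ring. Qed.

Lemma confC_covector (x : I -> R) i j : \sum_m x m * confC m i j =
  x j * u i + x i * u j - (\sum_m x m * uu m) * G i j.
Proof.
transitivity (\sum_m (krd R m j * (x m * u i) + krd R m i * (x m * u j)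
   - (x m * uu m) * G i j)).
  by apply: eq_bigr => m _; rewrite /confC; ring.
by rewrite big_split sumrN big_split /= !sum_krd mulr_suml.
Qed.

Lemma confC_endo (Y : I -> I -> R) k : \sum_i \sum_m Y i m * confC m i k =
  \sum_i Y i k * u i + (\sum_i Y i i) * u k - \sum_i \sum_m Y i m * uu m * G i k.
Proof.
rewrite mulr_suml -big_split -sumrB; apply: eq_bigr => i _ /=.
by rewrite confC_covector mulr_suml.
Qed.

Lemma confC_trace m : \sum_i confC i i m = d%:R * u m.
Proof.
rewrite (eq_bigr (fun i => krd R i m * u i + u m - uu i * G i m)); last first.
  by move=> i _; rewrite /confC {2}/krd eqxx mul1r.
rewrite sumrB big_split /= sum_krd Guu sumr_const card_ord -mulr_natl; ring.
Qed.

Lemma confC_C j k : \sum_i \sum_m confC i j m * confC m i k =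
  (d%:R + 2) * (u j * u k) - 2 * nu * G j k.
Proof.
rewrite confC_endo.
have -> : \sum_i confC i j k * u i = 2 * (u j * u k) - nu * G j k.
  under eq_bigr do rewrite mulrC.
  by rewrite confC_covector /nu; ring.
have -> : \sum_i confC i j i = d%:R * u j.
  by rewrite -confC_trace; apply: eq_bigr => i _; exact: confC_sym.
have -> : \sum_i \sum_m confC i j m * uu m * G i k = nu * G j k.
  transitivity (\sum_m (uu m * (\sum_i G i k * confC i j m))).
    rewrite exchange_big; apply: eq_bigr => m _; rewrite mulr_sumr.
    by apply: eq_bigr => i _; ring.
  under eq_bigr => m _.
    rewrite confC_covector (eq_bigr (fun i => uu i * G i k)) ?Guu; last first.
      by move=> i _; rewrite mulrC.
    over.
  transitivity (\sum_m ((u j) * (uu m * G m k) + (u m * uu m) * G j k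
     - u k * (uu m * G m j))).
    by apply: eq_bigr => m _; rewrite (Gs j m); ring.
  rewrite sumrB big_split /= -!mulr_sumr -mulr_suml !Guu /nu; ring.
ring.
Qed.

(** The Ricci tensor as a function of independent arrays: Y for the Christoffel symbols, X for their
    first derivatives, with the direction of differentiation as first index. *)
Definition ric_form (X : I -> I -> I -> I -> R) (Y : I -> I -> I -> R) (j k : I) : R :=
  \sum_i (X i i j k - X j i i k + \sum_m (Y i i m * Y m j k - Y i j m * Y m i k)).

(** The non-tensorial terms are left in place: only the contraction is wanted, and [scal_conf]
    combines them there. *)
Lemma ric_conf j k :
  ric_form (fun p k i j => dGam p k i j + confdC p k i j)
           (fun k i j => Gam k i j + confC k i j) j k =
  ric_form dGam Gam j k
  + (du k j + du j k - (\sum_i duu i i) * G j k - \sum_i uu i * dG i j k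
     - d%:R * du j k + (t k * u j + t j * u k - tu * G j k)
     + d%:R * (\sum_m Gam m j k * u m) + d%:R * (2 * (u j * u k) - nu * G j k)
     - (\sum_i Gam i j k * u i + t j * u k - \sum_i \sum_m Gam i j m * uu m * G i k)
     - (\sum_m Gam m j k * u m + t k * u j - \sum_m \sum_i Gam m i k * uu i * G m j)
     - ((d%:R + 2) * (u j * u k) - 2 * nu * G j k)).
Proof.
have E1 : \sum_i confdC i i j k = du k j + du j k - (\sum_i duu i i) * G j k
    - \sum_i uu i * dG i j k.
  rewrite !sumrB big_split /= -mulr_suml; congr (_ + _ - _ - _).
    by rewrite (sum_krd (fun i => du i j)).
  by rewrite (sum_krd (fun i => du i k)).
have E2 : \sum_i confdC j i i k = d%:R * du j k.
  transitivity (\sum_i (krd R i k * du j i + du j k - (duu j i * G i k + uu i * dG j i k))).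
    by apply: eq_bigr => i _; rewrite /confdC {2}/krd eqxx mul1r; ring.
  rewrite sumrB big_split /= sum_krd duuE sumr_const card_ord -mulr_natl; ring.
have E3 : \sum_i \sum_m (Gam i i m + confC i i m) * (Gam m j k + confC m j k) =
    \sum_i \sum_m Gam i i m * Gam m j k + (t k * u j + t j * u k - tu * G j k)
     + d%:R * (\sum_m Gam m j k * u m) + d%:R * (2 * (u j * u k) - nu * G j k).
  rewrite exchange_big /= [\sum_i \sum_m Gam i i m * _]exchange_big /=.
  transitivity (\sum_m (t m * Gam m j k + t m * confC m j k
     + d%:R * (Gam m j k * u m) + d%:R * (u m * confC m j k))).
    apply: eq_bigr => m _; rewrite -mulr_suml big_split /= confC_trace -/(t m); ring.
  rewrite !big_split /= -!mulr_sumr !confC_covector.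
  under [X in _ = X + _ + _ + _]eq_bigr do rewrite -mulr_suml.
  by rewrite /tu /nu; ring.
have E4 : \sum_i \sum_m (Gam i j m + confC i j m) * (Gam m i k + confC m i k) =
    \sum_i \sum_m Gam i j m * Gam m i k
     + (\sum_i Gam i j k * u i + t j * u k - \sum_i \sum_m Gam i j m * uu m * G i k)
     + (\sum_m Gam m j k * u m + t k * u j - \sum_m \sum_i Gam m i k * uu i * G m j)
     + ((d%:R + 2) * (u j * u k) - 2 * nu * G j k).
  rewrite -confC_C.
  have -> : \sum_i Gam i j k * u i + t j * u k - \sum_i \sum_m Gam i j m * uu m * G i k
      = \sum_i \sum_m Gam i j m * confC m i k.
    rewrite confC_endo; congr (_ + _ * _ - _).
    by apply: eq_bigr => i _.
  have -> : \sum_m Gam m j k * u m + t k * u j - \sum_m \sum_i Gam m i k * uu i * G m j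
      = \sum_i \sum_m confC i j m * Gam m i k.
    rewrite [RHS]exchange_big /=.
    transitivity (\sum_m \sum_i Gam m i k * confC i m j).
      by rewrite (confC_endo (fun m i => Gam m i k) j).
    by apply: eq_bigr => m _; apply: eq_bigr => i _; rewrite confC_sym mulrC.
  rewrite -!big_split; apply: eq_bigr => i _ /=; rewrite -!big_split.
  by apply: eq_bigr => m _ /=; ring.
rewrite /ric_form.
transitivity (\sum_i dGam i i j k + \sum_i confdC i i j k - (\sum_i dGam j i i k +
  \sum_i confdC j i i k) + (\sum_i \sum_m (Gam i i m + confC i i m) * (Gam m j k + confC m j k)
  - \sum_i \sum_m (Gam i j m + confC i j m) * (Gam m i k + confC m i k))).
  rewrite -!big_split -!sumrB -big_split; apply: eq_bigr => i _ /=.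
  by rewrite -sumrB.
rewrite E1 E2 E3 E4.
have -> : \sum_i (dGam i i j k - dGam j i i k + \sum_m (Gam i i m * Gam m j k - Gam i j m * Gam m i k))
  = \sum_i dGam i i j k - \sum_i dGam j i i k + (\sum_i \sum_m Gam i i m * Gam m j k
    - \sum_i \sum_m Gam i j m * Gam m i k).
  rewrite -!sumrB -big_split; apply: eq_bigr => i _ /=.
  by rewrite -sumrB.
ring.
Qed.

Lemma ctrG : ctr h G = d%:R.
Proof.
transitivity (\sum_(i : I) (1 : R)); last by rewrite sumr_const card_ord.
apply: eq_bigr => i _; rewrite (eq_bigr (fun j => h i j * G j i)) ?hG ?/krd ?eqxx //.
by move=> j _; rewrite Gs.
Qed.

Lemma ctr_outer (x : I -> R) : ctr h (fun j k => x j * u k) = \sum_m x m * uu m.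
Proof.
apply: eq_bigr => j _; rewrite uuE mulr_sumr.
by apply: eq_bigr => k _; rewrite mulrCA.
Qed.

Lemma ctr_outer' (x : I -> R) : ctr h (fun j k => x k * u j) = \sum_m x m * uu m.
Proof. by rewrite (ctrC (fun j k => x j * u k)) // ctr_outer. Qed.

Lemma ctr_lower (Y : I -> I -> R) :
  ctr h (fun j k => \sum_i Y i j * G i k) = \sum_j Y j j.
Proof.
apply: eq_bigr => j _; rewrite -(sum_krd (Y^~ j) j).
under eq_bigr do rewrite mulr_sumr.
rewrite exchange_big /=; apply: eq_bigr => i _.
rewrite krdC -hG mulr_suml; apply: eq_bigr => k _; rewrite Gs; ring.
Qed.

Lemma ctr_dG p : ctr h (dG p) = 2 * t p.
Proof.
rewrite (eq_ctr _ (Y := fun j k => \sum_m Gam m p j * G m k + \sum_m Gam m p k * G m j)).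
  rewrite ctrD (ctrC (fun j k => \sum_m Gam m p j * G m k)) // (ctr_lower (fun m j => Gam m p j)).
  have -> : \sum_j Gam j p j = t p by apply: eq_bigr => i _; exact: Gams.
  by ring.
by move=> i j; rewrite compat big_split.
Qed.

(** Contracting [duuE] with h isolates the divergence of uu, and metric compatibility turns the
    derivatives of G into Christoffel terms. *)
Lemma div_uu : \sum_i duu i i = box - vu - tu.
Proof.
rewrite -(ctr_lower (fun i j => duu j i)).
rewrite (eq_ctr _ (Y := fun j k => du j k - \sum_i uu i * dG j i k)); last first.
  by move=> j k; rewrite -duuE big_split /= addrK.
rewrite ctrB -/box -addrA -opprD; congr (_ - _).
rewrite (eq_ctr _ (Y := fun j k => \sum_m Gam m j k * u m +
   \sum_m (\sum_i uu i * Gam m j i) * G m k)); last first.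
  move=> j k; transitivity (\sum_i \sum_m (Gam m j k * (uu i * G i m) + uu i * Gam m j i * G m k)).
    apply: eq_bigr => i _; rewrite compat mulr_sumr; apply: eq_bigr => m _.
    by rewrite (Gs m i); ring.
  rewrite exchange_big -big_split; apply: eq_bigr => m _ /=.
  by rewrite big_split /= -mulr_sumr Guu mulr_suml.
rewrite ctrD (ctr_lower (fun m j => \sum_i uu i * Gam m j i)); congr (_ + _).
rewrite /tu exchange_big; apply: eq_bigr => i _; rewrite -mulr_sumr mulrC.
by [].
Qed.

(** The classical law Sc - 2 (d-1) Delta(log Omega) - (d-1)(d-2) |d log Omega|^2 for the metric
    Omega^2 g, before the factor Omega^(-2) coming from its inverse. *)
Lemma scal_conf :
  ctr h (ric_form (fun p k i j => dGam p k i j + confdC p k i j)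
           (fun k i j => Gam k i j + confC k i j)) =
  ctr h (ric_form dGam Gam) - 2 * (d%:R - 1) * (box - vu)
    - (d%:R - 1) * (d%:R - 2) * nu.
Proof.
have Hv : ctr h (fun j k => \sum_i Gam i j k * u i) = vu by [].
have c7 : ctr h (fun j k => \sum_i \sum_m Gam i j m * uu m * G i k) = tu.
  rewrite (eq_ctr _ (Y := fun j k => \sum_i (\sum_m Gam i j m * uu m) * G i k)).
    rewrite (ctr_lower (fun i j => \sum_m Gam i j m * uu m)) exchange_big /=.
    by apply: eq_bigr => m _; rewrite /t mulr_suml.
  by move=> j k; apply: eq_bigr => i _; rewrite mulr_suml.
have c8 : ctr h (fun j k => \sum_m \sum_i Gam m i k * uu i * G m j) = tu.
  rewrite -c7 -(ctrC _ hs); apply: eq_ctr => j k; apply: eq_bigr => i _.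
  by apply: eq_bigr => m _; rewrite Gams.
have c3 : ctr h (fun j k => \sum_i uu i * dG i j k) = 2 * tu.
  rewrite ctr_sum mulr_sumr; apply: eq_bigr => i _.
  by rewrite ctrZ ctr_dG; ring.
have cnu : ctr h (fun j k => u j * u k) = nu by rewrite ctr_outer.
have cD X Y := ctrD h X Y; have cB X Y := ctrB h X Y; have cZ := ctrZ h.
rewrite (eq_ctr _ ric_conf) cD -!addrA; congr (_ + _).
rewrite cB cB cB cD cD cD cB cB cB cD (ctrC du hs) -/box.
rewrite cZ ctrG c3 cZ -/box !cB !cD !cZ ctrG !ctr_outer !ctr_outer' Hv c7 c8.
rewrite cB !cZ cnu ctrG -/tu -/nu div_uu; ring.
Qed.

Variables (F W : R) (F1 : I -> R) (F2 : I -> I -> R).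
Let F1' i := W * (u i * F + F1 i).
Let n1 := \sum_m F1 m * uu m.

Let outer (x z : I -> R) :
  ctr h (fun i j => x i * z j) = ctr h (fun i j => z i * x j).
Proof. by rewrite -(ctrC (fun i j => x i * z j) hs); apply: eq_ctr => i j; ring. Qed.

Lemma grad_conf : ctr h (fun i j => F1' i * F1' j) =
  W ^+ 2 * (F ^+ 2 * nu + 2 * F * n1 + ctr h (fun i j => F1 i * F1 j)).
Proof.
rewrite (eq_ctr _ (Y := fun i j => W ^+ 2 * (F ^+ 2 * (u i * u j) + F * (u i * F1 j)
  + F * (F1 i * u j) + F1 i * F1 j))); last by move=> i j; rewrite /F1'; ring.
by rewrite ctrZ !ctrD !ctrZ (outer u F1) !ctr_outer -/n1 -/nu; ring.
Qed.

(** The derivative of W being W u, the first term is the second derivative of W F; the final term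
    with d - 2 arises from the trace (2 - d) uu of [confC]. *)
Lemma lap_conf :
  ctr h (fun i j => W * ((du i j + u i * u j) * F + (u j * F1 i + u i * F1 j) + F2 i j)
     - \sum_k F1' k * (Gam k i j + confC k i j)) =
  W * (F * (box + nu) + 2 * n1 + ctr h F2 - F * vu
    - ctr h (fun i j => \sum_m F1 m * Gam m i j) + (d%:R - 2) * (F * nu + n1)).
Proof.
have cG : ctr h (fun i j => G i j) = d%:R by exact: ctrG.
rewrite (eq_ctr _ (Y := fun i j => W * (F * du i j + (F * (u i * u j)
   + (F1 i * u j + (u i * F1 j + F2 i j))) - F * (\sum_m Gam m i j * u m)
   - \sum_m F1 m * Gam m i j - ((2 * F) * (u i * u j) + (u i * F1 j + F1 i * u j)
     - (F * nu + n1) * G i j)))); last first.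
  move=> i j.
  have -> : \sum_k F1' k * (Gam k i j + confC k i j) =
    W * (F * (\sum_m Gam m i j * u m) + \sum_m F1 m * Gam m i j) + \sum_k F1' k * confC k i j.
    by rewrite mulrDr !mulr_sumr -!big_split; apply: eq_bigr => k _; rewrite /F1' /=; ring.
  rewrite confC_covector.
  have -> : \sum_m F1' m * uu m = W * (F * nu + n1).
    by rewrite mulrDr !mulr_sumr -!big_split; apply: eq_bigr => k _; rewrite /F1' /=; ring.
  by rewrite /F1'; ring.
rewrite ctrZ !ctrB !ctrD !ctrZ (outer u F1) !ctr_outer cG -/n1 -/nu -/box -/vu; ring.
Qed.

End ConformalAlgebra.

Section MetricFacts.
Variables (R : realType) (V : Type) (d : nat) (A : set 'rV[R]_d).
Variables (env : 'rV[R]_d -> V -> R) (delta : 'I_d -> V -> expr R V).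
Variable g : 'I_d -> 'I_d -> expr R V.
Hypotheses (oA : open A) (sys : closed_system A env delta).
Hypothesis dg : forall y i j, A y -> dom (env y) (g i j).
Hypothesis gs : forall y i j, A y -> interp (env y) (g i j) = interp (env y) (g j i).
Hypothesis detg : forall y, A y -> \det (emx (env y) g) != 0.

Lemma sys_dom y : A y -> forall i v, dom (env y) (delta i v).
Proof. by move=> Ay i v; have [_ /(_ i) []] := sys v Ay. Qed.

Lemma einv_mul y i j : A y ->
  \sum_k interp (env y) (einv g i k) * interp (env y) (g k j) = krd R i j.
Proof.
move=> Ay; have gu : emx (env y) g \in unitmx by rewrite unitmxE unitfE detg.
have /matrixP/(_ i j) := mulVmx gu; rewrite !mxE /krd => <-.
by apply: eq_bigr => k _; rewrite interp_einv ?detg // mxE.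
Qed.

Lemma einv_sym y i j : A y ->
  interp (env y) (einv g i j) = interp (env y) (einv g j i).
Proof.
move=> Ay; rewrite !interp_einv ?detg //.
have /matrixP/(_ i j) := trmx_inv (emx (env y) g); rewrite mxE => ->.
congr (invmx _ i j); apply/matrixP => a b; rewrite !mxE; exact: gs.
Qed.

Lemma deriv_g_sym y p i j : A y ->
  interp (env y) (deriv (delta p) (g i j)) = interp (env y) (deriv (delta p) (g j i)).
Proof.
move=> Ay; apply: (deriv_congr oA sys) => // z Az; [exact: dg|exact: dg|exact: gs].
Qed.

Lemma echr_sym y k i j : A y ->
  interp (env y) (echr delta g k i j) = interp (env y) (echr delta g k j i).
Proof.
move=> Ay; rewrite !interp_echr; congr (_ * _); apply: eq_bigr => l _.
by rewrite (deriv_g_sym l i j Ay); congr (_ * (_ - _)); rewrite addrC.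
Qed.

Lemma echr_lower y m i j : A y ->
  \sum_k interp (env y) (g m k) * interp (env y) (echr delta g k i j) =
  2^-1 * (interp (env y) (deriv (delta i) (g j m)) +
    interp (env y) (deriv (delta j) (g i m)) - interp (env y) (deriv (delta m) (g i j))).
Proof.
move=> Ay; pose X l := 2^-1 * (interp (env y) (deriv (delta i) (g j l)) +
    interp (env y) (deriv (delta j) (g i l)) - interp (env y) (deriv (delta l) (g i j))).
rewrite -[RHS](sum_krd X m).
transitivity (\sum_k \sum_l interp (env y) (g m k) * (interp (env y) (einv g k l) * X l)).
  apply: eq_bigr => k _; rewrite interp_echr mulr_sumr mulr_sumr.
  by apply: eq_bigr => l _; rewrite /X; ring.
rewrite exchange_big; apply: eq_bigr => l _; rewrite -(einv_mul l m Ay) mulr_suml.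
by apply: eq_bigr => k _; rewrite (einv_sym k l Ay) (gs m k Ay); ring.
Qed.

Lemma echr_compat y p i j : A y ->
  interp (env y) (deriv (delta p) (g i j)) =
  \sum_m (interp (env y) (echr delta g m p i) * interp (env y) (g m j)
        + interp (env y) (echr delta g m p j) * interp (env y) (g m i)).
Proof.
move=> Ay; rewrite big_split /=.
have E a b : \sum_m interp (env y) (echr delta g m p a) * interp (env y) (g m b) =
   2^-1 * (interp (env y) (deriv (delta p) (g a b)) +
    interp (env y) (deriv (delta a) (g p b)) - interp (env y) (deriv (delta b) (g p a))).
  by rewrite -echr_lower //; apply: eq_bigr => m _; rewrite mulrC (gs m b Ay).
rewrite !E (deriv_g_sym p j i Ay).
by field.
Qed.

Lemma lower_inj y (X Y : 'I_d -> R) : A y ->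
  (forall m, \sum_k interp (env y) (g m k) * X k = \sum_k interp (env y) (g m k) * Y k) ->
  forall k, X k = Y k.
Proof.
move=> Ay XY k.
have E (Z : 'I_d -> R) : Z k = \sum_m interp (env y) (einv g k m) *
    \sum_l interp (env y) (g m l) * Z l.
  under [RHS]eq_bigr do rewrite mulr_sumr.
  rewrite exchange_big /= -[LHS](sum_krd Z k); apply: eq_bigr => l _.
  rewrite krdC -(einv_mul k l Ay) mulr_suml; apply: eq_bigr => m _; ring.
by rewrite (E X) (E Y); apply: eq_bigr => m _; rewrite XY.
Qed.

End MetricFacts.

(** Here n = |u|^2, n1 = <dF, u>, a1 = |dF|^2, b - v is the Laplacian of log W, a2 - a3 that of F,
    and S the scalar curvature. The contributions of b - v to the Laplacian and to J cancel each
    other; those of n and n1 cancel once the gradient term is added. *)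
Lemma conf_final (R : realType) (dd W F n n1 a1 b a2 v a3 S : R) :
  dd != 0 -> dd - 1 != 0 -> W != 0 ->
  F ^+ 2 * n + 2 * F * n1 + a1 - 2 / dd * (W * F) *
    (W^-1 * (F * (b + n) + 2 * n1 + a2 - F * v - a3 + (dd - 2) * (F * n + n1))
     + (W ^+ 2)^-1 * (S - 2 * (dd - 1) * (b - v) - (dd - 1) * (dd - 2) * n)
       / (2 * (dd - 1)) * (W * F)) =
  a1 - 2 / dd * F * (a2 - a3 + S / (2 * (dd - 1)) * F).
Proof. by move=> d0 dm W0; field; rewrite W0 d0 dm. Qed.

(** * Conformal invariance of I^2 for expressions *)

Section Conformal.
Variables (R : realType) (V : Type) (d : nat) (A : set 'rV[R]_d).
Variables (env : 'rV[R]_d -> V -> R) (delta : 'I_d -> V -> expr R V).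
Variables (g : 'I_d -> 'I_d -> expr R V) (w f : expr R V).
Hypothesis d1 : (1 < d)%N.
Hypotheses (oA : open A) (sys : closed_system A env delta).
Hypothesis dg : forall y i j, A y -> dom (env y) (g i j).
Hypothesis gs : forall y i j, A y -> interp (env y) (g i j) = interp (env y) (g j i).
Hypothesis detg : forall y, A y -> \det (emx (env y) g) != 0.
Hypothesis dw : forall y, A y -> dom (env y) w.
Hypothesis w0 : forall y, A y -> 0 < interp (env y) w.
Hypothesis df : forall y, A y -> dom (env y) f.

Notation D i := (deriv (delta i)).

Definition conf_metric i j : expr R V := Mul (Mul w w) (g i j).

Lemma emx_conf y : emx (env y) conf_metric = interp (env y) w ^+ 2 *: emx (env y) g.
Proof. by apply/matrixP => i j; rewrite !mxE /= expr2. Qed.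

Lemma det_conf y : A y -> \det (emx (env y) conf_metric) != 0.
Proof. by move=> Ay; rewrite emx_conf detZ mulf_neq0 ?detg // !expf_neq0 // gt_eqF // w0. Qed.

Lemma einv_conf y i j : A y -> interp (env y) (einv conf_metric i j) =
  (interp (env y) w ^+ 2)^-1 * interp (env y) (einv g i j).
Proof.
move=> Ay; rewrite !interp_einv ?detg ?det_conf // emx_conf invmxZ ?mxE //.
by rewrite -emx_conf unitmxE unitfE det_conf.
Qed.

(** [ww] is 1/w, so [eu] is d(log w), [euu] its gradient and [eC] the tensor [confC], all as
    expressions to which [deriv] applies. *)
Let ww : expr R V := Mul (RS w) (RS w).
Let eu i : expr R V := Mul (D i w) ww.
Let euu k : expr R V := esum (fun l => Mul (einv g k l) (eu l)).
Let eC k i j : expr R V :=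
  (Const (krd R k j) * eu i + Const (krd R k i) * eu j - euu k * g i j)%X.

Let dRSw y : A y -> dom (env y) (RS w).
Proof. by move=> Ay; split; [exact: dw | exact: w0]. Qed.

Let deu y i : A y -> dom (env y) (eu i).
Proof.
move=> Ay; split; last by split; exact: dRSw.
by apply: dom_D; [exact: (sys_dom sys) | exact: dw].
Qed.

Let deuu y k : A y -> dom (env y) (euu k).
Proof.
move=> Ay; apply: dom_esum => l; split; last exact: deu.
by apply: dom_ginv => [i j|]; [exact: dg | exact: detg].
Qed.

Let deC y k i j : A y -> dom (env y) (eC k i j).
Proof.
move=> Ay; split; first by split; split=> //; exact: deu.
by split=> //; split; [exact: deuu | exact: dg].
Qed.

Let dchr y k i j : A y -> dom (env y) (echr delta g k i j).
Proof.
by move=> Ay; apply: dom_echr; [exact: (sys_dom sys) | move=> a b; exact: dg | exact: detg].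
Qed.

Let dchr' y k i j : A y -> dom (env y) (echr delta conf_metric k i j).
Proof.
move=> Ay; apply: dom_echr; [exact: (sys_dom sys) | move=> a b | exact: det_conf].
by split; [split; exact: dw | exact: dg].
Qed.

Let wwE y : A y -> interp (env y) ww = (interp (env y) w)^-1.
Proof. by move=> Ay; rewrite /= -invfM -expr2 sqr_sqrtr // ltW // w0. Qed.

Let w_neq0 y : A y -> interp (env y) w != 0.
Proof. by move=> Ay; rewrite gt_eqF // w0. Qed.

Let euE y i : A y -> interp (env y) (D i w) = interp (env y) w * interp (env y) (eu i).
Proof. by move=> Ay; rewrite interpM wwE // mulrCA mulfV ?mulr1 // w_neq0. Qed.

Let confC_E y k i j : interp (env y) (eC k i j) =
  confC (fun i j => interp (env y) (g i j)) (fun i => interp (env y) (eu i))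
    (fun k => interp (env y) (euu k)) k i j.
Proof. by rewrite interpB interpD. Qed.

Let euuE y k : interp (env y) (euu k) =
  \sum_l interp (env y) (einv g k l) * interp (env y) (eu l).
Proof. by rewrite interp_esum. Qed.

Lemma echr_conf y k i j : A y -> interp (env y) (echr delta conf_metric k i j) =
  interp (env y) (echr delta g k i j + eC k i j)%X.
Proof.
move=> Ay; rewrite interpD confC_E /confC !interp_echr euuE.
pose h l := interp (env y) (einv g k l); pose u l := interp (env y) (eu l).
pose G i j := interp (env y) (g i j).
transitivity (\sum_l (2^-1 * (h l * (interp (env y) (D i (g j l)) +
    interp (env y) (D j (g i l)) - interp (env y) (D l (g i j))))
  + (h l * G l j) * u i + (h l * G l i) * u j - (h l * u l) * G i j)).
  rewrite mulr_sumr; apply: eq_bigr => l _.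
  rewrite einv_conf //= !(euE _ Ay) -/(u l) -/(u i) -/(u j) -/(h l).
  rewrite -!/(G _ _) (gs j l Ay : G j l = G l j) (gs i l Ay : G i l = G l i).
  field; exact: w_neq0.
rewrite sumrB !big_split /= -!mulr_suml -mulr_sumr !(einv_mul detg _ _ Ay).
by rewrite -!addrA.
Qed.

Lemma deriv_lin3 (dl : V -> expr R V) v (c1 c2 : R) (a b e k : expr R V) :
  interp v (deriv dl (Const c1 * a + Const c2 * b - e * k)%X) =
  c1 * interp v (deriv dl a) + c2 * interp v (deriv dl b)
  - interp v (deriv dl e) * interp v k - interp v e * interp v (deriv dl k).
Proof. by rewrite /=; ring. Qed.

(** [echr_conf] is an identity on all of A, so it may be differentiated by [deriv_congr]. *)
Lemma deriv_echr_conf y p k i j : A y ->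
  interp (env y) (D p (echr delta conf_metric k i j)) =
  interp (env y) (D p (echr delta g k i j)) +
  confdC (fun i j => interp (env y) (g i j)) (fun k => interp (env y) (euu k))
    (fun p i => interp (env y) (D p (eu i))) (fun p k => interp (env y) (D p (euu k)))
    (fun p i j => interp (env y) (D p (g i j))) p k i j.
Proof.
move=> Ay; rewrite /confdC -deriv_lin3.
apply: (deriv_congr oA sys (b := Add (echr delta g k i j) (eC k i j))) => //.
- by move=> z Az; exact: dchr'.
- by move=> z Az; split; [exact: dchr | exact: deC].
- by move=> z Az; exact: echr_conf.
Qed.

Let uuG y k : A y ->
  \sum_i interp (env y) (euu i) * interp (env y) (g i k) = interp (env y) (eu k).
Proof.
move=> Ay; exact: (Guu (fun i j => einv_sym gs detg i j Ay)
  (fun i j => einv_mul detg i j Ay) (fun l => euuE y l) k).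
Qed.

Let duuG y p k : A y -> \sum_i (interp (env y) (D p (euu i)) * interp (env y) (g i k)
   + interp (env y) (euu i) * interp (env y) (D p (g i k))) = interp (env y) (D p (eu k)).
Proof.
move=> Ay; rewrite -(deriv_congr oA sys (a := esum (fun i => Mul (euu i) (g i k)))) //.
- by rewrite deriv_esum interp_esum.
- by move=> z Az; apply: dom_esum => i; split; [exact: deuu | exact: dg].
- by move=> z Az; exact: deu.
- by move=> z Az; rewrite interp_esum -(uuG k Az); apply: eq_bigr.
Qed.

Let ddw y i j : A y -> interp (env y) (D i (D j w)) = interp (env y) w *
  (interp (env y) (D i (eu j)) + interp (env y) (eu i) * interp (env y) (eu j)).
Proof.
move=> Ay; rewrite (deriv_congr oA sys (b := Mul w (eu j))) //.
- rewrite -[LHS]/(interp (env y) (D i w) * interp (env y) (eu j) +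
    interp (env y) w * interp (env y) (D i (eu j))) (euE i Ay).
  by ring.
- by move=> z Az; apply: dom_D; [exact: (sys_dom sys) | exact: dw].
- by move=> z Az; split; [exact: dw | exact: deu].
- by move=> z Az; rewrite (euE j Az).
Qed.

Lemma escal_ctr (gg : 'I_d -> 'I_d -> expr R V) v : interp v (escal delta gg) =
  ctr (fun i j => interp v (einv gg i j))
    (ric_form (fun p k i j => interp v (D p (echr delta gg k i j)))
              (fun k i j => interp v (echr delta gg k i j))).
Proof.
rewrite interp_escal; apply: eq_bigr => j _; apply: eq_bigr => k _; congr (_ * _).
by apply: eq_bigr => i _; rewrite interp_eriem.
Qed.

Lemma ctr_conf y X : A y -> ctr (fun i j => interp (env y) (einv conf_metric i j)) X =
  (interp (env y) w ^+ 2)^-1 * ctr (fun i j => interp (env y) (einv g i j)) X.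
Proof.
move=> Ay; rewrite /ctr mulr_sumr; apply: eq_bigr => i _; rewrite mulr_sumr.
by apply: eq_bigr => j _; rewrite einv_conf // -mulrA.
Qed.

Lemma interp_eI gg a v : interp v (eI delta gg a) = interp v (egrad delta gg a a)
  - 2 / d%:R * interp v a *
   (interp v (elap delta gg a) + interp v (escal delta gg) / (2 * (d%:R - 1)) * interp v a).
Proof. by rewrite /eI interpB. Qed.

Lemma conf_eI y : A y ->
  interp (env y) (eI delta conf_metric (Mul w f)) = interp (env y) (eI delta g f).
Proof.
move=> Ay.
pose h i j := interp (env y) (einv g i j); pose G i j := interp (env y) (g i j).
pose Gam k i j := interp (env y) (echr delta g k i j).
pose u i := interp (env y) (eu i); pose uu i := interp (env y) (euu i).
pose W := interp (env y) w; pose F := interp (env y) f.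
pose F1 i := interp (env y) (D i f); pose F2 i j := interp (env y) (D i (D j f)).
pose du i j := interp (env y) (D i (eu j)).
have hs i j : h i j = h j i by exact: (einv_sym gs detg i j Ay).
have hG i j : \sum_k h i k * G k j = krd R i j by exact: (einv_mul detg i j Ay).
have Gs i j : G i j = G j i by exact: gs.
have Gams k i j : Gam k i j = Gam k j i by exact: (echr_sym oA sys dg gs k i j Ay).
have W0 : W != 0 by exact: w_neq0.
have scalE := scal_conf (fun p k i j => interp (env y) (D p (echr delta g k i j)))
  Gs hs hG Gams (fun p i j => echr_compat oA sys dg gs detg p i j Ay)
  (fun k => euuE y k) (fun p k => duuG p k Ay).
have JE : interp (env y) (escal delta conf_metric) = (W ^+ 2)^-1 *
  (interp (env y) (escal delta g) - 2 * (d%:R - 1) *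
   (ctr h du - ctr h (fun i j => \sum_m Gam m i j * u m))
    - (d%:R - 1) * (d%:R - 2) * (\sum_m u m * uu m)).
  rewrite !escal_ctr ctr_conf // -scalE; congr (_ * _); apply: eq_ctr => j k.
  have E1 k' i' j' : interp (env y) (echr delta conf_metric k' i' j') =
      Gam k' i' j' + confC G u uu k' i' j'.
    by rewrite echr_conf // interpD confC_E.
  apply: eq_bigr => i _; rewrite !deriv_echr_conf //; congr (_ + _).
  by apply: eq_bigr => m _; rewrite !E1.
pose F1' i := W * (u i * F + F1 i).
have F1E i : interp (env y) (D i (Mul w f)) = F1' i.
  rewrite -[LHS]/(interp (env y) (D i w) * F + W * F1 i) (euE i Ay) -/W -/(u i) /F1'.
  ring.
have F2E i j : interp (env y) (D i (D j (Mul w f))) = W * ((du i j + u i * u j) * F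
   + (u j * F1 i + u i * F1 j) + F2 i j).
  rewrite -[LHS]/((interp (env y) (D i (D j w)) * F + interp (env y) (D j w) * F1 i)
    + (interp (env y) (D i w) * F1 j + W * F2 i j)).
  rewrite ddw // !(euE _ Ay) -/W -/(u i) -/(u j) -/(du i j); ring.
have gradE (gg : 'I_d -> 'I_d -> expr R V) (a : expr R V) :
  interp (env y) (egrad delta gg a a) = ctr (fun i j => interp (env y) (einv gg i j))
    (fun i j => interp (env y) (D i a) * interp (env y) (D j a)).
  rewrite interp_grad; apply: eq_bigr => i _; apply: eq_bigr => j _; by rewrite mulrA.
have lapE (gg : 'I_d -> 'I_d -> expr R V) (a : expr R V) :
  interp (env y) (elap delta gg a) = ctr (fun i j => interp (env y) (einv gg i j))
    (fun i j => interp (env y) (D i (D j a)) -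
       \sum_k interp (env y) (D k a) * interp (env y) (echr delta gg k i j)).
  rewrite interp_lap; apply: eq_bigr => i _; apply: eq_bigr => j _; congr (_ * (_ - _)).
  by apply: eq_bigr => k _; rewrite mulrC.
have cc X : ctr (fun i j => interp (env y) (einv conf_metric i j)) X =
    (W ^+ 2)^-1 * ctr h X by exact: ctr_conf.
have gradE' : interp (env y) (egrad delta conf_metric (Mul w f) (Mul w f)) =
   F ^+ 2 * (\sum_m u m * uu m) + 2 * F * (\sum_m F1 m * uu m) + ctr h (fun i j => F1 i * F1 j).
  rewrite gradE cc; have := grad_conf hs (fun k => euuE y k) F W F1.
  rewrite -/h -/u -/uu => E.
  rewrite (eq_ctr _ (Y := fun i j => F1' i * F1' j)); last by move=> i j; rewrite !F1E.
  by rewrite E mulKf // expf_neq0.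
have lapE' : interp (env y) (elap delta conf_metric (Mul w f)) = W^-1 *
   (F * (ctr h du + \sum_m u m * uu m) + 2 * (\sum_m F1 m * uu m) + ctr h F2
    - F * ctr h (fun i j => \sum_m Gam m i j * u m)
    - ctr h (fun i j => \sum_m F1 m * Gam m i j)
    + (d%:R - 2) * (F * (\sum_m u m * uu m) + \sum_m F1 m * uu m)).
  rewrite lapE cc; have E := lap_conf Gam du Gs hs hG (fun k => euuE y k) F W F1 F2.
  rewrite (eq_ctr _ (Y := fun i j => W * ((du i j + u i * u j) * F
     + (u j * F1 i + u i * F1 j) + F2 i j)
     - \sum_k F1' k * (Gam k i j + confC G u uu k i j))); last first.
    move=> i j; rewrite F2E; congr (_ - _); apply: eq_bigr => k _.
    by rewrite F1E echr_conf // interpD confC_E.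
  by rewrite E expr2 invfM -mulrA mulKf.
have lapR : interp (env y) (elap delta g f) = ctr h F2 - ctr h (fun i j => \sum_m F1 m * Gam m i j).
  by rewrite lapE -ctrB.
have gradR : interp (env y) (egrad delta g f f) = ctr h (fun i j => F1 i * F1 j) by exact: gradE.
have wfE : interp (env y) (Mul w f) = W * F by [].
rewrite !interp_eI gradE' lapE' JE gradR lapR wfE -/F.
have d0 : d%:R != 0 :> R by rewrite pnatr_eq0 -lt0n (ltn_trans _ d1).
have dm1 : d%:R - 1 != 0 :> R by rewrite subr_eq0 -[1]/1%:R eqr_nat gtn_eqF.
exact: conf_final.
Qed.

End Conformal.

(** * Change of coordinates *)

Section Gauge.
Variables (R : realType) (d : nat).
Notation I := 'I_d.
Variables (a b : 'M[R]_d) (a1 Gt Gm : I -> 'M[R]_d) (a2 dGt dGm : I -> I -> 'M[R]_d).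
Hypothesis ab : a *m b = 1%:M.
Hypothesis a1s : forall i k n, a1 i k n = a1 k i n.
Hypothesis a2s : forall s i, a2 s i = a2 i s.

(** The Christoffel symbols are viewed as a matrix-valued connection form, entry (k, l) of [Gm i]
    being Gamma^l_ik, and the Jacobian a as a change of frame. [frame_sum] pulls the form back,
    [gauge] is the transformation law of a connection, and [dgauge] its derivative; a1 and a2 stand
    for the derivatives of a. *)
Definition frame_sum (X : I -> 'M[R]_d) (i : I) : 'M[R]_d := \sum_p a i p *: X p.

Hypothesis gauge : forall i, Gm i *m a = a1 i + a *m frame_sum Gt i.
Hypothesis dgauge : forall s i, dGm s i *m a + Gm i *m a1 s =
  a2 s i + a1 s *m frame_sum Gt i + a *m (\sum_p a1 s i p *: Gt p
    + \sum_p \sum_r (a i p * a s r) *: dGt r p).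

(** The products occur in the opposite of the usual order because the lower index k is the row:
    these matrices act on row vectors. *)
Definition curv (X : I -> 'M[R]_d) (dX : I -> I -> 'M[R]_d) (i j : I) : 'M[R]_d :=
  dX i j - dX j i + (X j *m X i - X i *m X j).

Lemma gauge2 i j : Gm j *m Gm i *m a =
  Gm j *m a1 i + (a1 j *m frame_sum Gt i + a *m (frame_sum Gt j *m frame_sum Gt i)).
Proof. by rewrite -mulmxA gauge mulmxDr [Gm j *m (a *m _)]mulmxA gauge mulmxDl mulmxA. Qed.

(** The derivatives a2 cancel by their symmetry, the terms in a1 i j p by the symmetry of a1, and
    the other inhomogeneous terms between the derivative and the quadratic part. *)
Lemma curv_gauge i j : curv Gm dGm i j *m a =
  a *m \sum_p \sum_q (a i p * a j q) *: curv Gt dGt p q.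
Proof.
have dE s k : dGm s k *m a = a2 s k + a1 s *m frame_sum Gt k + a *m (\sum_p a1 s k p *: Gt p
    + \sum_p \sum_r (a k p * a s r) *: dGt r p) - Gm k *m a1 s.
  by rewrite -dgauge addrK.
have -> : \sum_p \sum_q (a i p * a j q) *: curv Gt dGt p q =
   \sum_p \sum_r (a j p * a i r) *: dGt r p - \sum_p \sum_r (a i p * a j r) *: dGt r p
   + (frame_sum Gt j *m frame_sum Gt i - frame_sum Gt i *m frame_sum Gt j).
  have prodE k l : frame_sum Gt k *m frame_sum Gt l =
      \sum_p \sum_q (a k p * a l q) *: (Gt p *m Gt q).
    rewrite mulmx_suml; apply: eq_bigr => p _; rewrite mulmx_sumr.
    by apply: eq_bigr => q _; rewrite -scalemxAl -scalemxAr scalerA.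
  rewrite !prodE [\sum_p \sum_r (a j p * a i r) *: dGt r p]exchange_big /=.
  rewrite [\sum_p \sum_q (a j p * a i q) *: (Gt p *m Gt q)]exchange_big /=.
  rewrite -!sumrB -big_split; apply: eq_bigr => p _ /=.
  rewrite -!sumrB -big_split; apply: eq_bigr => q _ /=.
  by rewrite (mulrC (a j q)) -!scalerBr -scalerDr.
rewrite /curv !mulmxDl !mulNmx !gauge2 !dE (a2s j i).
have -> : \sum_p a1 j i p *: Gt p = \sum_p a1 i j p *: Gt p.
  by apply: eq_bigr => p _; rewrite a1s.
rewrite !mulmxDr !mulmxN.
apply/matrixP => k n.
have eD (X Y : 'M[R]_d) : (X + Y) k n = X k n + Y k n by rewrite mxE.
have eN (X : 'M[R]_d) : (- X) k n = - X k n by rewrite mxE.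
rewrite !(eD, eN); ring.
Qed.

Lemma ricci_gauge j k : \sum_i curv Gm dGm i j k i =
  \sum_q \sum_r a j q * a k r * (\sum_p curv Gt dGt p q r p).
Proof.
have E i : curv Gm dGm i j = a *m (\sum_p \sum_q (a i p * a j q) *: curv Gt dGt p q) *m b.
  by rewrite -curv_gauge -mulmxA ab mulmx1.
have ba : b *m a = 1%:M by exact: mulmx1C.
transitivity (\sum_i \sum_n \sum_r \sum_p \sum_q
    a k r * (a i p * a j q * curv Gt dGt p q r n) * b n i).
  apply: eq_bigr => i _; rewrite E mxE; apply: eq_bigr => n _.
  rewrite mxE mulr_suml; apply: eq_bigr => r _.
  rewrite summxE mulr_sumr mulr_suml; apply: eq_bigr => p _.
  rewrite summxE mulr_sumr mulr_suml; apply: eq_bigr => q _.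
  by rewrite mxE.
transitivity (\sum_n \sum_r \sum_p \sum_q
    (a j q * a k r * curv Gt dGt p q r n) * \sum_i b n i * a i p).
  rewrite exchange_big; apply: eq_bigr => n _ /=.
  rewrite exchange_big; apply: eq_bigr => r _ /=.
  rewrite exchange_big; apply: eq_bigr => p _ /=.
  rewrite exchange_big; apply: eq_bigr => q _ /=.
  by rewrite mulr_sumr; apply: eq_bigr => i _; ring.
transitivity (\sum_n \sum_r \sum_q a j q * a k r * curv Gt dGt n q r n).
  apply: eq_bigr => n _; apply: eq_bigr => r _.
  rewrite exchange_big; apply: eq_bigr => q _ /=.
  rewrite -(sum_krd' (fun p => a j q * a k r * curv Gt dGt p q r n) n).
  apply: eq_bigr => p _; have /matrixP/(_ n p) := ba; rewrite !mxE => ->.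
  by rewrite mulrC.
rewrite exchange_big [RHS]exchange_big; apply: eq_bigr => r _ /=.
rewrite exchange_big; apply: eq_bigr => q _ /=.
by rewrite mulr_sumr.
Qed.

(** With M = a G a^T one has G^(-1) = a^T M^(-1) a, so the inverse metric absorbs the two Jacobian
    factors of a covariant tensor. *)
Lemma ctr_frame (G : 'M[R]_d) (X : I -> I -> R) :
  G \in unitmx ->
  ctr (fun i j => invmx (a *m G *m a^T) i j) (fun i j => \sum_p \sum_q a i p * a j q * X p q)
  = ctr (fun i j => invmx G i j) X.
Proof.
move=> Gu; have [au bu] := mulmx1_unit ab.
pose M := a *m G *m a^T.
have Mu : M \in unitmx by rewrite !unitmx_mul au Gu unitmx_tr.
pose Y := a^T *m invmx M *m a.
have hE : invmx G = Y.
  have GY : G *m Y = 1%:M.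
    have aGY : a *m (G *m Y) = a by rewrite /Y !mulmxA -/M mulmxV // mul1mx.
    by rewrite -[LHS](mulKmx au) aGY mulVmx.
  by rewrite -[RHS](mulKmx Gu) GY mulmx1.
rewrite /ctr -/M hE.
transitivity (\sum_p \sum_q \sum_i \sum_j (a i p * invmx M i j * a j q) * X p q).
  transitivity (\sum_i \sum_j \sum_p \sum_q (a i p * invmx M i j * a j q) * X p q).
    apply: eq_bigr => i _; apply: eq_bigr => j _; rewrite mulr_sumr.
    by apply: eq_bigr => p _; rewrite mulr_sumr; apply: eq_bigr => q _; ring.
  under eq_bigr => i _ do rewrite exchange_big /=.
  rewrite exchange_big; apply: eq_bigr => p _ /=.
  under eq_bigr => i _ do rewrite exchange_big /=.
  by rewrite exchange_big.
apply: eq_bigr => p _; apply: eq_bigr => q _; rewrite /Y mxE mulr_suml.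
rewrite exchange_big; apply: eq_bigr => j _ /=; rewrite !mxE !mulr_suml.
by apply: eq_bigr => i _; rewrite mxE.
Qed.

End Gauge.

Lemma christoffel_halves (R : realType) (p q r a b c : R) :
  2^-1 * (p + q + a + (p + r + b) - (q + r + c)) = p + 2^-1 * (a + b - c).
Proof. by field. Qed.

Lemma dgauge_term (R : realType) (x1 x2 x3 x4 g S : R) :
  (x1 * x2 + x3 * x4) * g + x3 * x2 * S = x4 * (x3 * g) + x2 * (x1 * g + x3 * S).
Proof. by ring. Qed.

Lemma hess_cancel (R : realType) (x y z : R) : x + y - (x + z) = y - z.
Proof. by ring. Qed.

Lemma metric_leibniz (R : realType) (x G y S z w : R) :
  (x * G + y * S) * z + y * G * w = x * G * z + y * G * w + S * (y * z).
Proof. by ring. Qed.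

(** * Invariance of I^2 for expressions under a coordinate change *)

Section CoordinateChange.
Variables (R : realType) (d : nat) (A B : set 'rV[R]_d) (I : Type).
Variables (T : 'rV[R]_d -> 'rV[R]_d) (F : I -> 'rV[R]_d -> R).
Hypotheses (oA : open A) (oB : open B).
Hypothesis sT : forall k, smooth A (fun z => T z 0 k).
Hypothesis sF : forall i, smooth B (F i).
Hypothesis AB : forall y, A y -> B (T y).

Notation cvar := (comp_var d d I).
Notation cenv := (comp_env T F).
Notation cdel := (@comp_delta R d d I).
Notation fenv := (fam_env F).
Notation fdel := (@fam_delta R d I).

Variables (gt : 'I_d -> 'I_d -> expr R (I * seq 'I_d)) (ft : expr R (I * seq 'I_d)).
Hypothesis dgt : forall z i j, B z -> dom (fenv z) (gt i j).
Hypothesis gts : forall z i j, B z -> interp (fenv z) (gt i j) = interp (fenv z) (gt j i).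
Hypothesis detgt : forall z, B z -> \det (emx (fenv z) gt) != 0.
Hypothesis dft : forall z, B z -> dom (fenv z) ft.

Definition lift_expr (e : expr R (I * seq 'I_d)) : expr R cvar := emap inr e.
Definition ejac (i k : 'I_d) : expr R cvar := Var (inl (k, [:: i])).

Definition pull_metric (i j : 'I_d) : expr R cvar :=
  esum (fun p => esum (fun q => Mul (Mul (ejac i p) (lift_expr (gt p q))) (ejac j q))).

Definition jac_mx y : 'M[R]_d := \matrix_(i, k) interp (cenv y) (ejac i k).
Hypothesis jacu : forall y, A y -> jac_mx y \in unitmx.

Let sysA : closed_system A cenv cdel. Proof. exact: (comp_system oA oB sT sF AB). Qed.
Let sysB : closed_system B fenv fdel. Proof. exact: (fam_system sF). Qed.

Lemma lift_interp y e : interp (cenv y) (lift_expr e) = interp (fenv (T y)) e.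
Proof. by rewrite interp_emap; apply: eq_interp => -[k w]. Qed.

Lemma lift_dom y e : A y -> (forall z, B z -> dom (fenv z) e) -> dom (cenv y) (lift_expr e).
Proof.
move=> Ay de; rewrite dom_emap; have := de _ (AB Ay).
by congr (dom _ e); apply/funext => -[k w].
Qed.

(** The chain rule by induction on the expression: [comp_delta] provides it for variables, and every
    constructor preserves it. *)
Lemma lift_deriv y i e : interp (cenv y) (deriv (cdel i) (lift_expr e)) =
  \sum_k interp (cenv y) (ejac i k) * interp (fenv (T y)) (deriv (fdel k) e).
Proof.
have L := lift_interp; rewrite /lift_expr in L *.
elim: e => [[k w]|c|a IHa b IHb|a IHa b IHb|a IHa] /=.
- by rewrite interp_esum.
- by rewrite big1 // => k _; rewrite mulr0.
- by rewrite IHa IHb -big_split; apply: eq_bigr => k _ /=; rewrite mulrDr.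
- rewrite IHa IHb !L mulr_suml mulr_sumr -big_split; apply: eq_bigr => k _ /=; ring.
- by rewrite IHa !L mulr_sumr; apply: eq_bigr => k _ /=; ring.
Qed.

Lemma jac_deriv_sym y i j k : A y ->
  interp (cenv y) (deriv (cdel i) (ejac j k)) = interp (cenv y) (deriv (cdel j) (ejac i k)).
Proof. by move=> Ay; exact: (schwarz i j oA (sT k) Ay). Qed.

Local Opaque comp_env fam_env.

Section AtPoint.
Variable y : 'rV[R]_d.
Hypothesis Ay : A y.

Let a i k := interp (cenv y) (ejac i k).
Let a' i j k := interp (cenv y) (deriv (cdel i) (ejac j k)).
Let G p q := interp (fenv (T y)) (gt p q).
Let dG r p q := interp (fenv (T y)) (deriv (fdel r) (gt p q)).
Let Gam k i j := interp (cenv y) (echr cdel pull_metric k i j).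
Let Gamt k i j := interp (fenv (T y)) (echr fdel gt k i j).

Lemma pull_interp i j : interp (cenv y) (pull_metric i j) =
  \sum_p \sum_q a i p * G p q * a j q.
Proof.
rewrite interp_esum; apply: eq_bigr => p _; rewrite interp_esum.
by apply: eq_bigr => q _; rewrite !interpM lift_interp.
Qed.

Lemma emx_pull : emx (cenv y) pull_metric = jac_mx y *m emx (fenv (T y)) gt *m (jac_mx y)^T.
Proof.
apply/matrixP => i j; rewrite mxE pull_interp mxE exchange_big.
apply: eq_bigr => q _; rewrite !mxE mulr_suml; apply: eq_bigr => p _.
by rewrite !mxE.
Qed.

Lemma det_pull : \det (emx (cenv y) pull_metric) != 0.
Proof.
rewrite -unitfE -unitmxE emx_pull !unitmx_mul unitmx_tr jacu //= andbT.
by rewrite unitmxE unitfE; apply: detgt; exact: AB.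
Qed.

Lemma pull_sym i j : interp (cenv y) (pull_metric i j) = interp (cenv y) (pull_metric j i).
Proof.
rewrite !pull_interp exchange_big; apply: eq_bigr => p _; apply: eq_bigr => q _.
by rewrite /G gts; [rewrite -mulrA mulrC -mulrA mulrCA mulrA | exact: AB].
Qed.

Lemma pull_dom i j : dom (cenv y) (pull_metric i j).
Proof.
apply: dom_esum => p; apply: dom_esum => q; do !split=> //.
by apply: lift_dom => // z; exact: dgt.
Qed.

End AtPoint.

Section AtPoint2.
Variable y : 'rV[R]_d.
Hypothesis Ay : A y.

Let a i k := interp (cenv y) (ejac i k).
Let a' i j k := interp (cenv y) (deriv (cdel i) (ejac j k)).
Let G p q := interp (fenv (T y)) (gt p q).
Let dG r p q := interp (fenv (T y)) (deriv (fdel r) (gt p q)).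
Let Gam k i j := interp (cenv y) (echr cdel pull_metric k i j).
Let Gamt k i j := interp (fenv (T y)) (echr fdel gt k i j).
Let a's i j k : a' i j k = a' j i k. Proof. exact: jac_deriv_sym. Qed.
Let Gs p q : G p q = G q p. Proof. by apply: gts; exact: AB. Qed.

Let P l i j := \sum_p \sum_q a' l i p * G p q * a j q.
Let Q l i j := \sum_p \sum_q (\sum_r a l r * dG r p q) * (a i p * a j q).

Lemma deriv_pull l i j :
  interp (cenv y) (deriv (cdel l) (pull_metric i j)) = P l i j + P l j i + Q l i j.
Proof.
rewrite deriv_esum interp_esum.
have -> : P l j i = \sum_p \sum_q a i p * G p q * a' l j q.
  rewrite /P exchange_big; apply: eq_bigr => p _; apply: eq_bigr => q _.
  by rewrite (Gs q p); ring.
rewrite -!big_split; apply: eq_bigr => p _; rewrite deriv_esum interp_esum -!big_split.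
apply: eq_bigr => q _.
rewrite -[LHS]/((a' l i p * interp (cenv y) (lift_expr (gt p q)) +
   a i p * interp (cenv y) (deriv (cdel l) (lift_expr (gt p q)))) * a j q +
   (a i p * interp (cenv y) (lift_expr (gt p q))) * a' l j q).
rewrite lift_interp lift_deriv -/(G p q) -/(a i p) -/(a j q) /=.
exact: metric_leibniz.
Qed.

Lemma jac_inj (x z : 'I_d -> R) :
  (forall m, \sum_s a m s * x s = \sum_s a m s * z s) -> forall s, x s = z s.
Proof.
move=> xz s; have /mulVmx ba := jacu Ay.
have E (v : 'I_d -> R) : v s = \sum_m invmx (jac_mx y) s m * \sum_t a m t * v t.
  under eq_bigr do rewrite mulr_sumr.
  rewrite exchange_big /= -[LHS](sum_krd' v s); apply: eq_bigr => t _.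
  have /matrixP/(_ s t) := ba; rewrite !mxE /krd => <-; rewrite mulr_suml.
  by apply: eq_bigr => m _; rewrite mxE mulrA.
by rewrite (E x) (E z); apply: eq_bigr => m _; rewrite xz.
Qed.

(** Both sides are lowered with G and contracted with the Jacobian, which are invertible. The left
    side becomes a Christoffel symbol of the first kind of the pulled back metric; there the second
    derivatives of T, collected in P, combine by symmetry into a single term. *)
Lemma echr_gauge i j q : \sum_m Gam m i j * a m q =
  a' i j q + \sum_p \sum_r a i p * a j r * Gamt q p r.
Proof.
pose X q := \sum_m Gam m i j * a m q.
pose Z q := a' i j q + \sum_p \sum_r a i p * a j r * Gamt q p r.
suff: forall s, \sum_q G s q * X q = \sum_q G s q * Z q.
  by move=> h; exact: (lower_inj (X := X) (Y := Z) detgt (AB Ay) h q).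
apply: jac_inj => m.
have lowT s p r : \sum_q G s q * Gamt q p r = 2^-1 * (dG p r s + dG r p s - dG s p r).
  exact: (echr_lower fdel gts detgt s p r (AB Ay)).
have low : \sum_k interp (cenv y) (pull_metric m k) * Gam k i j =
  2^-1 * (interp (cenv y) (deriv (cdel i) (pull_metric j m)) +
    interp (cenv y) (deriv (cdel j) (pull_metric i m)) -
    interp (cenv y) (deriv (cdel m) (pull_metric i j))).
  apply: (echr_lower (A := A)) => //.
  - by move=> z i' j' Az; exact: pull_sym.
  - by move=> z Az; exact: det_pull.
transitivity (\sum_k interp (cenv y) (pull_metric m k) * Gam k i j).
  transitivity (\sum_s \sum_q \sum_k a m s * G s q * a k q * Gam k i j).
    apply: eq_bigr => s _; rewrite mulr_sumr; apply: eq_bigr => q' _.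
    by rewrite mulrA mulr_sumr; apply: eq_bigr => k _; ring.
  under eq_bigr do rewrite exchange_big /=.
  rewrite exchange_big; apply: eq_bigr => k _ /=.
  rewrite pull_interp mulr_suml; apply: eq_bigr => s _; rewrite mulr_suml.
  by apply: eq_bigr => q' _.
rewrite low !deriv_pull.
have Ps l i' j' : P l i' j' = P i' l j'.
  by apply: eq_bigr => p _; apply: eq_bigr => q' _; rewrite a's.
rewrite (Ps j i m) (Ps m i j) (Ps m j i).
rewrite christoffel_halves.
transitivity (\sum_s a m s * (\sum_q G s q * a' i j q) +
   \sum_s a m s * \sum_p \sum_r a i p * a j r * (\sum_q G s q * Gamt q p r)); last first.
  rewrite -big_split; apply: eq_bigr => s _ /=; rewrite -mulrDr; congr (_ * _).
  transitivity (\sum_q G s q * a' i j q + \sum_q G s q * (\sum_p \sum_r a i p * a j r * Gamt q p r)).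
    congr (_ + _).
    under [RHS]eq_bigr do rewrite mulr_sumr.
    rewrite [RHS]exchange_big; apply: eq_bigr => p _ /=.
    under [RHS]eq_bigr do rewrite mulr_sumr.
    rewrite [RHS]exchange_big; apply: eq_bigr => r _ /=.
    by rewrite mulr_sumr; apply: eq_bigr => q' _; ring.
  by rewrite -big_split; apply: eq_bigr => q' _; rewrite /Z mulrDr.
congr (_ + _).
  rewrite /P exchange_big; apply: eq_bigr => s _ /=; rewrite mulr_sumr.
  by apply: eq_bigr => p _; rewrite (Gs s p); ring.
have Q1 : Q i j m = \sum_s \sum_p \sum_r a m s * (a i p * a j r) * dG p r s.
  rewrite /Q exchange_big; apply: eq_bigr => s _ /=; rewrite exchange_big /=.
  rewrite exchange_big /= ; under eq_bigr do rewrite mulr_suml.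
  rewrite exchange_big; apply: eq_bigr => p _ /=; apply: eq_bigr => r _; ring.
have Q2 : Q j i m = \sum_s \sum_p \sum_r a m s * (a i p * a j r) * dG r p s.
  rewrite /Q exchange_big; apply: eq_bigr => s _ /=; apply: eq_bigr => p _.
  by rewrite mulr_suml; apply: eq_bigr => r _; ring.
have Q3 : Q m i j = \sum_s \sum_p \sum_r a m s * (a i p * a j r) * dG s p r.
  rewrite /Q [RHS]exchange_big; apply: eq_bigr => p _ /=.
  rewrite [RHS]exchange_big; apply: eq_bigr => r _ /=.
  by rewrite mulr_suml; apply: eq_bigr => s _; ring.
rewrite Q1 Q2 Q3 -big_split -sumrB mulr_sumr; apply: eq_bigr => s _ /=.
rewrite -big_split -sumrB !mulr_sumr; apply: eq_bigr => p _ /=.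
rewrite -big_split -sumrB !mulr_sumr; apply: eq_bigr => r _ /=.
by rewrite lowT; ring.
Qed.

End AtPoint2.

Let dchr y k i j : A y -> dom (cenv y) (echr cdel pull_metric k i j).
Proof.
move=> Ay; apply: dom_echr; [exact: (sys_dom sysA) | by move=> a b; exact: pull_dom|].
exact: det_pull.
Qed.

Let dchrt z k i j : B z -> dom (fenv z) (echr fdel gt k i j).
Proof.
by move=> Bz; apply: dom_echr; [exact: (sys_dom sysB) | move=> a b; exact: dgt | exact: detgt].
Qed.

(** [echr_gauge] holds on all of A and can be differentiated; the result supplies the hypothesis
    [dgauge] of the curvature computation. *)
Lemma echr_gauge_deriv y s i j q : A y ->
  \sum_m (interp (cenv y) (deriv (cdel s) (echr cdel pull_metric m i j)) * interp (cenv y) (ejac m q)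
    + interp (cenv y) (echr cdel pull_metric m i j) * interp (cenv y) (deriv (cdel s) (ejac m q))) =
  interp (cenv y) (deriv (cdel s) (deriv (cdel i) (ejac j q))) +
  \sum_p \sum_r ((interp (cenv y) (deriv (cdel s) (ejac i p)) * interp (cenv y) (ejac j r)
     + interp (cenv y) (ejac i p) * interp (cenv y) (deriv (cdel s) (ejac j r))) *
       interp (fenv (T y)) (echr fdel gt q p r) +
     interp (cenv y) (ejac i p) * interp (cenv y) (ejac j r) *
     \sum_k interp (cenv y) (ejac s k) *
        interp (fenv (T y)) (deriv (fdel k) (echr fdel gt q p r))).
Proof.
move=> Ay.
have := @deriv_congr _ _ _ _ _ _ oA sysA
  (esum (fun m => Mul (echr cdel pull_metric m i j) (ejac m q)))
  (Add (deriv (cdel i) (ejac j q)) (esum (fun p => esum (fun r =>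
     Mul (Mul (ejac i p) (ejac j r)) (lift_expr (echr fdel gt q p r)))))) s _ _ _ y Ay.
rewrite deriv_esum interp_esum => E; rewrite E; first last.
- by move=> z Az; rewrite interp_esum interpD interp_esum echr_gauge //; congr (_ + _);
  apply: eq_bigr => p _; rewrite interp_esum; apply: eq_bigr => r _;
  rewrite !interpM lift_interp.
- move=> z Az; split=> //; apply: dom_esum => p; apply: dom_esum => r; split=> //.
  by apply: lift_dom => // t Bt; exact: dchrt.
- by move=> z Az; apply: dom_esum => m; split=> //; exact: dchr.
rewrite -[LHS]/(_ + interp _ (deriv _ (esum _))); congr (_ + _).
rewrite deriv_esum interp_esum; apply: eq_bigr => p _.
rewrite deriv_esum interp_esum; apply: eq_bigr => r _.
rewrite -[LHS]/((interp (cenv y) (deriv (cdel s) (ejac i p)) * interp (cenv y) (ejac j r)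
  + interp (cenv y) (ejac i p) * interp (cenv y) (deriv (cdel s) (ejac j r))) *
    interp (cenv y) (lift_expr (echr fdel gt q p r)) +
  interp (cenv y) (ejac i p) * interp (cenv y) (ejac j r) *
    interp (cenv y) (deriv (cdel s) (lift_expr (echr fdel gt q p r)))).
by rewrite lift_interp lift_deriv.
Qed.

Definition chr_mx (V : Type) (env : V -> R) (delta : 'I_d -> V -> expr R V)
    (g : 'I_d -> 'I_d -> expr R V) (i : 'I_d) : 'M[R]_d :=
  \matrix_(k, l) interp env (echr delta g l i k).

Definition dchr_mx (V : Type) (env : V -> R) (delta : 'I_d -> V -> expr R V)
    (g : 'I_d -> 'I_d -> expr R V) (s i : 'I_d) : 'M[R]_d :=
  \matrix_(k, l) interp env (deriv (delta s) (echr delta g l i k)).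

Lemma ric_form_curv (V : Type) (env : V -> R) (delta : 'I_d -> V -> expr R V) g j k :
  ric_form (fun p k i j => interp env (deriv (delta p) (echr delta g k i j)))
    (fun k i j => interp env (echr delta g k i j)) j k =
  \sum_i curv (chr_mx env delta g) (dchr_mx env delta g) i j k i.
Proof.
apply: eq_bigr => i _; rewrite /curv !mxE; congr (_ + _).
rewrite -sumrB; apply: eq_bigr => m _; rewrite !mxE.
by rewrite mulrC; congr (_ - _); rewrite mulrC.
Qed.

Lemma dom_ejac y i k : dom (cenv y) (ejac i k). Proof. by []. Qed.

Local Opaque ejac lift_expr.

Section AtPoint3.
Variable y : 'rV[R]_d.
Hypothesis Ay : A y.

Let a := jac_mx y.
Let a1 i : 'M[R]_d := \matrix_(k, n) interp (cenv y) (deriv (cdel i) (ejac k n)).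
Let a2 s i : 'M[R]_d :=
  \matrix_(k, n) interp (cenv y) (deriv (cdel s) (deriv (cdel i) (ejac k n))).
Let Gt := chr_mx (fenv (T y)) fdel gt.
Let dGt := dchr_mx (fenv (T y)) fdel gt.
Let Gm := chr_mx (cenv y) cdel pull_metric.
Let dGm := dchr_mx (cenv y) cdel pull_metric.

Lemma gauge_mx i : Gm i *m a = a1 i + a *m frame_sum a Gt i.
Proof.
apply/matrixP => k q; rewrite mxE [RHS]mxE.
transitivity (\sum_m interp (cenv y) (echr cdel pull_metric m i k) * interp (cenv y) (ejac m q)).
  by apply: eq_bigr => m _; rewrite !mxE.
rewrite echr_gauge // mxE; congr (_ + _).
rewrite exchange_big mxE; apply: eq_bigr => r _ /=; rewrite !mxE summxE mulr_sumr.
by apply: eq_bigr => p _; rewrite !mxE; ring.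
Qed.

Lemma dgauge_mx s i : dGm s i *m a + Gm i *m a1 s =
  a2 s i + a1 s *m frame_sum a Gt i + a *m (\sum_p a1 s i p *: Gt p
    + \sum_p \sum_r (a i p * a s r) *: dGt r p).
Proof.
apply/matrixP => k q.
rewrite mxE [RHS]mxE [in RHS]mxE ![in LHS]mxE.
transitivity (\sum_m (interp (cenv y) (deriv (cdel s) (echr cdel pull_metric m i k)) * interp (cenv y) (ejac m q)
    + interp (cenv y) (echr cdel pull_metric m i k) * interp (cenv y) (deriv (cdel s) (ejac m q)))).
  by rewrite big_split; congr (_ + _); apply: eq_bigr => m _; rewrite !mxE.
rewrite (echr_gauge_deriv s i k q Ay).
rewrite -addrA; congr (_ + _); first by rewrite mxE.
transitivity (\sum_r \sum_p
    interp (cenv y) (deriv (cdel s) (ejac k r)) * (interp (cenv y) (ejac i p) *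
      interp (fenv (T y)) (echr fdel gt q p r))
  + \sum_r \sum_p interp (cenv y) (ejac k r) * (interp (cenv y) (deriv (cdel s) (ejac i p)) *
     interp (fenv (T y)) (echr fdel gt q p r) + interp (cenv y) (ejac i p) *
     \sum_l interp (cenv y) (ejac s l) * interp (fenv (T y)) (deriv (fdel l) (echr fdel gt q p r)))).
  rewrite exchange_big -big_split; apply: eq_bigr => r _.
  rewrite -big_split; apply: eq_bigr => p _; exact: dgauge_term.
congr (_ + _); rewrite mxE; apply: eq_bigr => r _.
  rewrite summxE mulr_sumr; apply: eq_bigr => p _.
  by rewrite !mxE.
rewrite -mulr_sumr; congr (_ * _); first by rewrite mxE.
rewrite mxE !summxE -big_split; apply: eq_bigr => p _.
rewrite summxE !mxE; congr (_ + _); rewrite mulr_sumr; apply: eq_bigr => l _.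
by rewrite !mxE mulrA.
Qed.

Lemma ctr_pull (X : 'I_d -> 'I_d -> R) :
  ctr (fun i j => interp (cenv y) (einv pull_metric i j))
    (fun i j => \sum_p \sum_q interp (cenv y) (ejac i p) * interp (cenv y) (ejac j q) * X p q) =
  ctr (fun i j => interp (fenv (T y)) (einv gt i j)) X.
Proof.
have By := AB Ay.
have Gu : emx (fenv (T y)) gt \in unitmx by rewrite unitmxE unitfE detgt.
transitivity (ctr (fun i j => invmx (emx (fenv (T y)) gt) i j) X); last first.
  by apply: eq_bigr => i _; apply: eq_bigr => j _; rewrite interp_einv // detgt.
rewrite -(ctr_frame (mulmxV (jacu Ay)) X Gu) -emx_pull.
apply: eq_bigr => i _; apply: eq_bigr => j _.
rewrite interp_einv ?det_pull //; congr (_ * _).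
by apply: eq_bigr => p _; apply: eq_bigr => q _; rewrite !mxE.
Qed.

Lemma scal_pull : interp (cenv y) (escal cdel pull_metric) = interp (fenv (T y)) (escal fdel gt).
Proof.
have h1 i k n : a1 i k n = a1 k i n.
  rewrite /a1 [LHS]mxE [RHS]mxE.
  exact (jac_deriv_sym i k n Ay).
have h2 s i : a2 s i = a2 i s.
  apply/matrixP => k n; rewrite /a2 [LHS]mxE [RHS]mxE.
  exact (deriv_comm oA sysA s i (fun z _ => dom_ejac z k n) Ay).
rewrite !escal_ctr -ctr_pull; apply: eq_ctr => j k.
rewrite ric_form_curv (ricci_gauge (mulmxV (jacu Ay)) h1 h2 gauge_mx dgauge_mx).
apply: eq_bigr => p _; apply: eq_bigr => q _; rewrite ric_form_curv.
by congr (_ * _ * _); rewrite mxE.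
Qed.

Let lf := lift_expr ft.

Lemma grad_pull : interp (cenv y) (egrad cdel pull_metric lf lf) =
  interp (fenv (T y)) (egrad fdel gt ft ft).
Proof.
have E (V : Type) (env : V -> R) delta gg f : interp env (egrad delta gg f f) =
    ctr (fun i j => interp env (einv gg i j)) (fun i j : 'I_d =>
      interp env (deriv (delta i) f) * interp env (deriv (delta j) f)).
  by rewrite interp_grad; apply: eq_bigr => i _; apply: eq_bigr => j _; rewrite mulrA.
rewrite !E -ctr_pull; apply: eq_ctr => i j; rewrite !lift_deriv mulr_suml.
apply: eq_bigr => p _; rewrite mulr_sumr; apply: eq_bigr => q _; ring.
Qed.

Lemma hess_pull i j : interp (cenv y) (deriv (cdel i) (deriv (cdel j) lf)) =
  \sum_k (interp (cenv y) (deriv (cdel i) (ejac j k)) * interp (fenv (T y)) (deriv (fdel k) ft)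
    + interp (cenv y) (ejac j k) * \sum_l interp (cenv y) (ejac i l) *
        interp (fenv (T y)) (deriv (fdel l) (deriv (fdel k) ft))).
Proof.
have dD k : forall z, B z -> dom (fenv z) (deriv (fdel k) ft).
  by move=> z Bz; apply: dom_deriv; [case | exact: dft].
rewrite (deriv_congr oA sysA (b := esum (fun k => Mul (ejac j k) (lift_expr (deriv (fdel k) ft))))) //.
- rewrite deriv_esum interp_esum; apply: eq_bigr => k _.
  rewrite -[LHS]/(interp (cenv y) (deriv (cdel i) (ejac j k)) *
      interp (cenv y) (lift_expr (deriv (fdel k) ft)) + interp (cenv y) (ejac j k) *
      interp (cenv y) (deriv (cdel i) (lift_expr (deriv (fdel k) ft)))).
  by rewrite lift_interp lift_deriv.
- by move=> z Az; apply: dom_deriv; [exact: (sys_dom sysA Az) | exact: (lift_dom Az dft)].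
- by move=> z Az; apply: dom_esum => k; split; [exact: dom_ejac | exact: (lift_dom Az (dD k))].
- by move=> z Az; rewrite lift_deriv interp_esum; apply: eq_bigr => k _; rewrite interpM lift_interp.
Qed.

(** The same second derivatives of T occur in the Hessian of the lifted function and in
    [echr_gauge]; they cancel, which makes the covariant Hessian a tensor. *)
Lemma lap_pull : interp (cenv y) (elap cdel pull_metric lf) = interp (fenv (T y)) (elap fdel gt ft).
Proof.
have E (V : Type) (env : V -> R) delta gg f : interp env (elap delta gg f) =
    ctr (fun i j => interp env (einv gg i j)) (fun i j : 'I_d =>
      interp env (deriv (delta i) (deriv (delta j) f)) -
      \sum_k interp env (echr delta gg k i j) * interp env (deriv (delta k) f)).
  by rewrite interp_lap.
rewrite !E -ctr_pull; apply: eq_ctr => i j; rewrite hess_pull big_split /=.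
have -> : \sum_k interp (cenv y) (echr cdel pull_metric k i j) * interp (cenv y) (deriv (cdel k) lf)
  = \sum_k (interp (cenv y) (deriv (cdel i) (ejac j k)) +
     \sum_p \sum_r interp (cenv y) (ejac i p) * interp (cenv y) (ejac j r) *
       interp (fenv (T y)) (echr fdel gt k p r)) * interp (fenv (T y)) (deriv (fdel k) ft).
  under eq_bigr => k _ do rewrite lift_deriv mulr_sumr.
  rewrite exchange_big; apply: eq_bigr => k _ /=; rewrite -echr_gauge // mulr_suml.
  by apply: eq_bigr => m _; rewrite mulrA.
under [X in _ - X]eq_bigr do rewrite mulrDl.
rewrite big_split /= hess_cancel.
transitivity (\sum_p \sum_r interp (cenv y) (ejac i p) * interp (cenv y) (ejac j r) *
   interp (fenv (T y)) (deriv (fdel p) (deriv (fdel r) ft)) -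
  \sum_p \sum_r interp (cenv y) (ejac i p) * interp (cenv y) (ejac j r) *
   \sum_k interp (fenv (T y)) (echr fdel gt k p r) * interp (fenv (T y)) (deriv (fdel k) ft)).
  congr (_ - _).
    rewrite exchange_big; apply: eq_bigr => r _ /=; rewrite mulr_sumr.
    by apply: eq_bigr => p _; rewrite mulrA; congr (_ * _); rewrite mulrC.
  under eq_bigr do rewrite mulr_suml.
  rewrite exchange_big; apply: eq_bigr => p _ /=.
  under eq_bigr do rewrite mulr_suml.
  rewrite exchange_big; apply: eq_bigr => r _ /=.
  by rewrite mulr_sumr; apply: eq_bigr => k _; rewrite mulrA.
rewrite -sumrB; apply: eq_bigr => p _; rewrite -sumrB.
by apply: eq_bigr => r _; rewrite mulrBr.
Qed.

Lemma pull_eI : interp (cenv y) (eI cdel pull_metric lf) = interp (fenv (T y)) (eI fdel gt ft).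
Proof. by rewrite !interp_eI scal_pull grad_pull lap_pull /lf lift_interp. Qed.

End AtPoint3.

End CoordinateChange.

(** * Invariance of I^2 *)

Section Charts.
Variables (R : realType) (d : nat) (M : manifold R d).
Implicit Types (phi psi : chart R d M) (U : set M) (f : M -> R) (g : metric M).

Lemma chart_imgP phi U y : (phi @` (chart_dom phi `&` U)) y ->
  [/\ chart_dom phi (chart_inv phi y), U (chart_inv phi y) & phi (chart_inv phi y) = y].
Proof. by move=> [x [dx Ux] <-]; rewrite chart_mapK. Qed.

Lemma chart_img phi U x : chart_dom phi x -> U x -> (phi @` (chart_dom phi `&` U)) (phi x).
Proof. by move=> dx Ux; exists x. Qed.

Lemma chart_img_open_sub phi U : open U -> open (phi @` (chart_dom phi `&` U)).
Proof.
move=> oU; rewrite openE => y Hy; have [dx Ux phix] := chart_imgP Hy.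
have Dy : (phi @` chart_dom phi) y by exists (chart_inv phi y).
have nU : nbhs (chart_inv phi y) U by exact: open_nbhs_nbhs.
have n1 : nbhs y (chart_inv phi @^-1` U) := chart_inv_cont Dy nU.
have n2 : nbhs y (phi @` chart_dom phi).
  by apply: open_nbhs_nbhs; split=> //; exact: chart_img_open.
rewrite /interior; apply: filterS2 n1 n2 => z Uz [z' dx' xz]; exists z' => //; split=> //.
by move: Uz; rewrite /= -xz chart_mapK.
Qed.

Lemma chart_preim_open phi (A : set 'rV[R]_d) : open A ->
  open (chart_dom phi `&` [set x | A (phi x)]).
Proof.
move=> oA; rewrite openE => x [dx Ax]; rewrite /interior.
have n1 : nbhs x (phi @^-1` A) := chart_map_cont dx (open_nbhs_nbhs (conj oA Ax)).
have n2 := open_nbhs_nbhs (conj (@chart_dom_open _ _ _ phi) dx).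
by apply: filterS2 n2 n1.
Qed.

Lemma smooth_on_sub U V f : U `<=` V -> smooth_on V f -> smooth_on U f.
Proof.
move=> UV sf phi aphi; apply: smooth_sub (sf phi aphi).
by move=> y [x [dx Ux] <-]; exists x => //; split=> //; exact: UV.
Qed.

Lemma chart_continuous phi f x (A : set 'rV[R]_d) : chart_dom phi x -> A (phi x) ->
  smooth A (local_expr phi f) -> {for x, continuous f}.
Proof.
move=> dx Ax sf; have c : {for x, continuous (local_expr phi f \o phi)}.
  apply: continuous_comp; first exact: chart_map_cont.
  exact: smooth_continuous sf Ax.
suff: f @ x --> f x by [].
have E : \forall z \near x, (local_expr phi f \o phi) z = f z.
  have n2 := open_nbhs_nbhs (conj (@chart_dom_open _ _ _ phi) dx).
  by apply: filterS n2 => z dz; rewrite /local_expr /= chart_mapK.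
have -> : f x = (local_expr phi f \o phi) x by rewrite /local_expr /= chart_mapK.
exact: cvg_trans (near_eq_cvg E) c.
Qed.

Section Metric.
Variables (g : metric M) (phi : chart R d M).
Hypothesis aphi : atlas phi.

Lemma metric_unit x : chart_dom phi x -> g phi x \in unitmx.
Proof.
move=> dx; rewrite -row_free_unit -kermx_eq0; apply/negPn/negP => /rowV0Pn[v].
move=> /sub_kermxP vG v0; have := metric_pos g aphi dx v0.
by rewrite vG mul0mx mxE ltxx.
Qed.

Definition chart_fam (f : M -> R) (o : option ('I_d * 'I_d)) : 'rV[R]_d -> R :=
  if o is Some (i, j) then gcomp g phi i j else local_expr phi f.

Definition jet_g (i j : 'I_d) : expr R (option ('I_d * 'I_d) * seq 'I_d) :=
  Var (Some (i, j), [::]).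
Definition jet_f : expr R (option ('I_d * 'I_d) * seq 'I_d) := Var (None, [::]).

Lemma chart_fam_smooth U f :
  smooth (phi @` (chart_dom phi `&` U)) (local_expr phi f) ->
  forall o, smooth (phi @` (chart_dom phi `&` U)) (chart_fam f o).
Proof.
move=> sf [[i j]|] //; apply: smooth_sub (metric_smooth g i j aphi).
by move=> y [x [dx _] <-]; exists x.
Qed.

Lemma emx_jet_g f y : emx (fam_env (chart_fam f) y) jet_g = g phi (chart_inv phi y).
Proof. by apply/matrixP => i j; rewrite mxE. Qed.

Lemma jet_g_det U f y : (phi @` (chart_dom phi `&` U)) y ->
  \det (emx (fam_env (chart_fam f) y) jet_g) != 0.
Proof.
by move=> /chart_imgP[dx _ _]; rewrite emx_jet_g -unitfE -unitmxE metric_unit.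
Qed.

Lemma jet_g_sym U f y i j : (phi @` (chart_dom phi `&` U)) y ->
  interp (fam_env (chart_fam f) y) (jet_g i j) = interp (fam_env (chart_fam f) y) (jet_g j i).
Proof.
move=> /chart_imgP[dx _ _]; rewrite /= /fam_env /= /gcomp /local_expr.
by rewrite -[in LHS](Defs.metric_sym g aphi dx) mxE.
Qed.

End Metric.

End Charts.

Section IsqInvariance.
Variables (R : realType) (d : nat) (M : manifold R d).
Hypothesis d1 : (1 < d)%N.
Implicit Types (phi psi : chart R d M) (U : set M) (f : M -> R) (g : metric M).

Lemma transition_inv phi psi x : chart_dom phi x -> transition phi psi (phi x) = psi x.
Proof. by move=> dx; rewrite /transition chart_mapK. Qed.

Lemma chart_Isq g phi U f x : atlas phi -> open U ->
  smooth (phi @` (chart_dom phi `&` U)) (local_expr phi f) ->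
  chart_dom phi x -> U x ->
  Isq g phi f x = interp (fam_env (chart_fam g phi f) (phi x))
    (eI (@fam_delta R d _) (@jet_g R d) (@jet_f R d)).
Proof.
move=> aphi oU sf dx Ux; pose A := phi @` (chart_dom phi `&` U).
have oA : open A by exact: chart_img_open_sub.
have sys := fam_system (chart_fam_smooth g aphi sf).
apply: (bridge_Isq (A := A) oA sys) => //.
- by move=> y; exact: jet_g_det.
- exact: chart_img.
Qed.

Lemma Isq_conformal g g' Omega phi U f f' x :
  rescaled_by Omega g g' -> atlas phi -> open U ->
  smooth (phi @` (chart_dom phi `&` U)) (local_expr phi f) ->
  (forall z, U z -> f' z = Omega z * f z) ->
  chart_dom phi x -> U x -> Isq g' phi f' x = Isq g phi f x.
Proof.
move=> [sO O0 gE] aphi oU sf fE dx Ux; pose A := phi @` (chart_dom phi `&` U).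
have oA : open A by exact: chart_img_open_sub.
(* Omega joins the metric components and f as one more function of the family, at the index None. *)
pose F (o : option (option ('I_d * 'I_d))) : 'rV[R]_d -> R :=
  if o is Some o' then chart_fam g phi f o' else local_expr phi Omega.
have sF o : smooth A (F o).
  case: o => [k|]; first exact: chart_fam_smooth.
  by apply: smooth_sub (sO phi aphi) => y [z [dz _] <-]; exists z.
have sys := fam_system sF.
pose g2 i j : expr R (option (option ('I_d * 'I_d)) * seq 'I_d) := Var (Some (Some (i, j)), [::]).
pose f2 : expr R (option (option ('I_d * 'I_d)) * seq 'I_d) := Var (Some None, [::]).
pose w2 : expr R (option (option ('I_d * 'I_d)) * seq 'I_d) := Var (None, [::]).
have emxE y : emx (fam_env F y) g2 = g phi (chart_inv phi y).
  by apply/matrixP => i j; rewrite mxE.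
have det2 y : A y -> \det (emx (fam_env F y) g2) != 0.
  by move=> /chart_imgP[dy _ _]; rewrite emxE -unitfE -unitmxE metric_unit.
have sym2 y i j : A y -> interp (fam_env F y) (g2 i j) = interp (fam_env F y) (g2 j i).
  by move=> Ay; exact: (jet_g_sym g aphi f i j Ay).
have w0 y : A y -> 0 < interp (fam_env F y) w2 by move=> _; exact: O0.
have Ax : A (phi x) by exact: chart_img.
have E1 : Isq g phi f x = interp (fam_env F (phi x)) (eI (@fam_delta R d _) g2 f2).
  by apply: (bridge_Isq (A := A) oA sys).
have E2 : Isq g' phi f' x = interp (fam_env F (phi x))
    (eI (@fam_delta R d _) (conf_metric g2 w2) (Mul w2 f2)).
  apply: (bridge_Isq (A := A) oA sys) => //.
  - move=> y i j /chart_imgP[dy _ _]; rewrite /gcomp /local_expr (gE _ _ aphi dy) mxE.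
    by rewrite expr2.
  - by move=> y Ay; exact: (det_conf det2 w0 Ay).
  - by move=> y /chart_imgP[_ Uy _]; exact: fE.
have dg2 y i j : A y -> dom (fam_env F y) (g2 i j) by [].
have dw2 y : A y -> dom (fam_env F y) w2 by [].
rewrite E1 E2; exact: (conf_eI f2 d1 oA sys dg2 sym2 det2 dw2 w0 Ax).
Qed.

Lemma Isq_coord g phi psi U f x : atlas phi -> atlas psi -> open U ->
  smooth (psi @` (chart_dom psi `&` U)) (local_expr psi f) ->
  chart_dom phi x -> chart_dom psi x -> U x -> Isq g phi f x = Isq g psi f x.
Proof.
move=> aphi apsi oU sf dx dx' Ux.
pose UA := chart_dom psi `&` U; pose UB := chart_dom phi `&` U.
have oUA : open UA by apply: openI => //; exact: chart_dom_open.
have oUB : open UB by apply: openI => //; exact: chart_dom_open.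
pose A := phi @` (chart_dom phi `&` UA); pose B := psi @` (chart_dom psi `&` UB).
have oA : open A by exact: chart_img_open_sub.
have oB : open B by exact: chart_img_open_sub.
have sB : B `<=` psi @` (chart_dom psi `&` U) by move=> y [z [dz [_ Uz]] <-]; exists z.
pose T := transition phi psi; pose F := chart_fam g psi f.
have sT k : smooth A (fun z => T z 0 k).
  have [h _] := atlas_compatible aphi apsi.
  by apply: smooth_sub (h k) => y [z [dz [dz' _]] <-]; exists z.
have sF o : smooth B (F o) by apply: chart_fam_smooth => //; exact: smooth_sub sf.
have AB y : A y -> B (T y).
  by move=> /chart_imgP[dy [dy' Uy] yE]; exists (chart_inv phi y).
have Ax : A (phi x) by exact: chart_img.
have TxE : T (phi x) = psi x by exact: transition_inv.
have Bx : B (psi x) by exact: chart_img.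
have sysA := comp_system oA oB sT sF AB.
have sysB := fam_system sF.
pose gt := @jet_g R d; pose ft := @jet_f R d.
have jacE y : A y -> jac_mx T F y = transition_jacobian phi psi (chart_inv phi y).
  move=> Ay; have [dy _ yE] := chart_imgP Ay.
  apply/matrixP => i k; rewrite mxE /transition_jacobian yE jacobian_entry //.
  by move=> l; have [] := smooth_diff oA (sT l) Ay.
have jacu y : A y -> jac_mx T F y \in unitmx.
  move=> Ay; rewrite jacE // unitmxE unitfE; have [dy [dy' _] _] := chart_imgP Ay.
  (* The oriented atlas makes the Jacobian determinant positive, hence the Jacobian invertible. *)
  by rewrite gt_eqF //; apply: atlas_oriented.
have detB z : B z -> \det (emx (fam_env F z) gt) != 0 by exact: jet_g_det.
have symB z i j : B z -> interp (fam_env F z) (gt i j) = interp (fam_env F z) (gt j i).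
  by exact: jet_g_sym.
have Kf y : A y -> chart_inv psi (T y) = chart_inv phi y.
  by move=> /chart_imgP[_ [dy' _] _]; rewrite /T /transition chart_mapK.
have E1 : Isq g psi f x = interp (fam_env F (psi x)) (eI (@fam_delta R d _) gt ft).
  by apply: (bridge_Isq (A := B) oB sysB).
have E2 : Isq g phi f x = interp (comp_env T F (phi x))
    (eI (@comp_delta R d d _) (pull_metric gt) (lift_expr ft)).
  apply: (bridge_Isq (A := A) oA sysA) => //.
  - by move=> y i j Ay; apply: (pull_dom (A := A) (B := B)).
  - move=> y i j Ay; have [dy [dy' _] yE] := chart_imgP Ay.
    have E := metric_tensor g aphi apsi (conj dy dy').
    have -> : interp (comp_env T F y) (pull_metric gt i j) =
      (jac_mx T F y *m emx (fam_env F (T y)) gt *m (jac_mx T F y)^T) i j.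
      by rewrite -emx_pull mxE.
    by rewrite jacE // emx_jet_g Kf // -E.
  - by move=> y Ay; apply: (det_pull (A := A) (B := B)).
  - by move=> y Ay; rewrite lift_interp /local_expr /= /fam_env /= /local_expr Kf.
rewrite E1 E2 -TxE.
by apply: (pull_eI (A := A) (B := B)).
Qed.

Lemma Isq_invariant g g' Omega phi psi U f f' x :
  rescaled_by Omega g g' -> atlas phi -> atlas psi -> open U ->
  smooth (phi @` (chart_dom phi `&` U)) (local_expr phi f) ->
  smooth (psi @` (chart_dom psi `&` U)) (local_expr psi f') ->
  (forall z, U z -> f' z = Omega z * f z) ->
  chart_dom phi x -> chart_dom psi x -> U x -> Isq g' psi f' x = Isq g phi f x.
Proof.
move=> resc aphi apsi oU sf sf' fE dx dx' Ux.
by rewrite -(Isq_conformal resc aphi oU sf fE dx Ux) (Isq_coord g' aphi apsi oU sf' dx dx' Ux).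
Qed.

End IsqInvariance.

(** * Existence *)

Section Sequence.
Variables (R : realType) (d : nat).
Notation jexpr := (expr R (option ('I_d * 'I_d) * seq 'I_d)).
Notation jdelta := (@fam_delta R d (option ('I_d * 'I_d))).

(** The pairs (s_k, A_k). No manifold, chart or scale occurs in them, which is what makes the final
    formula universal. *)
Fixpoint approx (k : nat) : jexpr * jexpr :=
  if k is j.+1 then
    (step_density d j (approx j).1 (approx j).2,
     step_error jdelta (@jet_g R d) j (approx j).1 (approx j).2)
  else (@jet_f R d, Add (eI jdelta (@jet_g R d) (@jet_f R d)) (Const (-1))).

Definition sdens k := (approx k).1.
Definition serr k := (approx k).2.

Section Env.
Variable env : option ('I_d * 'I_d) * seq 'I_d -> R.

Lemma dom_sdensS k : dom env (sdens k.+1) ->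
  [/\ dom env (sdens k), dom env (serr k) &
    0 < interp env (step_mod d k (sdens k) (serr k))].
Proof. exact: dom_step_density. Qed.

Lemma sdensS k : interp env (sdens k.+1) = interp env (sdens k) *
  (Num.sqrt (interp env (step_mod d k (sdens k) (serr k))))^-1.
Proof. by []. Qed.

Lemma sdens_sign k : dom env (sdens k) ->
  exists2 v, 0 < v & interp env (sdens k) = interp env (@jet_f R d) * v.
Proof.
elim: k => [_|k IH /dom_sdensS[/IH [v v0 E] _ m0]]; first by exists 1; rewrite ?mulr1.
exists (v * (Num.sqrt (interp env (step_mod d k (sdens k) (serr k))))^-1).
  by rewrite mulr_gt0 // invr_gt0 sqrtr_gt0.
by rewrite sdensS E mulrA.
Qed.

Hypothesis detg : \det (emx env (@jet_g R d)) != 0.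

(** The inverse roots in [step_error] are those of [step_density], of the previous stage and of the
    inverse metric, so A_k is defined wherever s_k is. *)
Lemma dom_serr k : dom env (sdens k) -> dom env (serr k).
Proof.
elim: k => [_|k IH dS].
  by split=> //; apply: (@dom_eI _ _ _ jdelta (@jet_g R d)).
have [dk _ _] := dom_sdensS dS.
by apply: dom_step_error => //; exact: IH.
Qed.

Hypothesis gsym : forall i j, interp env (einv (@jet_g R d) i j) = interp env (einv (@jet_g R d) j i).

Lemma approx_correct k : (k <= d)%N -> dom env (sdens k) ->
  interp env (eI jdelta (@jet_g R d) (sdens k)) =
  1 + interp env (sdens k) ^+ k * interp env (serr k).
Proof.
elim: k => [_ _|k IH kd dS].
  rewrite expr0 mul1r.
  by rewrite -[interp env (serr 0)]/(interp env (eI jdelta (@jet_g R d) (sdens 0)) - 1) addrC subrK.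
have [dk _ _] := dom_sdensS dS.
by apply: step_correct => //; apply: IH => //; exact: ltnW.
Qed.

End Env.
End Sequence.

Section ConformalClass.
Variables (R : realType) (d : nat) (M : manifold R d) (c : conformal_structure M).
Implicit Types (phi psi : chart R d M) (U : set M) (f : M -> R) (g : metric M).

Lemma conf_class_nonempty : exists g, conf_class c g.
Proof.
have [g0 E] := conf_classP c; exists g0; rewrite E; exists (fun=> 1); split=> //.
- move=> phi aphi; apply: smooth_cst; apply: chart_img_open_sub; exact: openT.
- by move=> phi x _ _; rewrite expr1n scale1r.
Qed.

Lemma smooth_onM U f1 f2 : open U -> smooth_on U f1 -> smooth_on U f2 ->
  smooth_on U (fun x => f1 x * f2 x).
Proof.
move=> oU s1 s2 phi aphi; apply: (smoothM _ (s1 phi aphi) (s2 phi aphi)).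
exact: chart_img_open_sub.
Qed.

Lemma smooth_onV U f : open U -> smooth_on U f -> (forall x, U x -> f x != 0) ->
  smooth_on U (fun x => (f x)^-1).
Proof.
move=> oU s1 f0 phi aphi; apply: (smoothV _ (s1 phi aphi)).
  exact: chart_img_open_sub.
by move=> y /chart_imgP[_ Uy _]; exact: f0.
Qed.

Lemma conf_rel g g' : conf_class c g -> conf_class c g' ->
  exists Omega, rescaled_by Omega g g'.
Proof.
have [g0 ->] := conf_classP c; move=> [w1 [s1 p1 E1]] [w2 [s2 p2 E2]].
exists (fun x => w2 x * (w1 x)^-1); split.
- apply: smooth_onM => //; first exact: openT.
  by apply: (smooth_onV openT s1) => x _; rewrite gt_eqF.
- by move=> x; rewrite mulr_gt0 // invr_gt0.
- move=> phi x aphi dx; rewrite (E1 _ _ aphi dx) (E2 _ _ aphi dx) scalerA; congr (_ *: _).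
  by rewrite -exprMn divfK // gt_eqF.
Qed.

Lemma rescaled_refl g : rescaled_by (fun=> 1) g g.
Proof.
split=> //; last by move=> phi x _ _; rewrite expr1n scale1r.
by move=> phi aphi; apply: smooth_cst; apply: chart_img_open_sub; exact: openT.
Qed.

(* Interior points of the zero locus would have vanishing gradient. *)
Lemma vanish_on_zero_locus V S s (O : set M) (h : M -> R) x :
  defining_density c V S s -> open O -> O `<=` V -> O x ->
  {for x, continuous h} -> (forall z, O z -> ~ S z -> h z = 0) -> h x = 0.
Proof.
move=> [ds sS dS] oO OV Ox ch h0; have [Sx|Sx] := pselect (S x); last exact: h0.
apply/eqP/negPn/negP => hx; have [g cg] := conf_class_nonempty.
have [phi aphi dx] := atlas_cover x.
have [i /negP[]] := dS g phi x cg aphi dx (OV _ Ox) Sx.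
have nh : \forall z \near x, O z /\ h z != 0.
  have n1 := open_nbhs_nbhs (conj oO Ox).
  have n2 : \forall z \near x, h z != 0.
    exact: (@cvgr_neq0 _ _ _ _ (nbhs_filter x) _ _ ch hx).
  by apply: filterS2 n1 n2.
have [W [oW Wx] Wh] : exists2 W : set M, open_nbhs x W & W `<=` [set z | O z /\ h z != 0].
  have : nbhs x [set z | O z /\ h z != 0] by exact: nh.
  by rewrite nbhsE.
have oA : open (phi @` (chart_dom phi `&` W)) by exact: chart_img_open_sub.
rewrite (partial_eq i (g := fun=> 0) oA).
- by rewrite /partial /= derive_cst.
- move=> y /chart_imgP[dy Oy _]; have [Oy' hy] := Wh _ Oy.
  apply/(sS g _ cg (OV _ Oy')); apply: contrapT => nS.
  by move: hy; rewrite h0 ?eqxx.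
- exact: chart_img.
Qed.

End ConformalClass.

Section Approximation.
Variables (R : realType) (d : nat) (M : manifold R d) (c : conformal_structure M).
Variables (S V : set M) (s : metric M -> M -> R).
Hypotheses (d1 : (1 < d)%N) (oV : open V) (def : defining_density c V S s).
Implicit Types (phi psi : chart R d M) (g : metric M) (k : nat).

Notation jdelta := (@fam_delta R d (option ('I_d * 'I_d))).
Notation gJ := (@jet_g R d).

Definition jenv g phi : 'rV[R]_d -> option ('I_d * 'I_d) * seq 'I_d -> R :=
  fam_env (chart_fam g phi (s g)).

(** A priori this set and the functions below depend on the scale and the chart through the jet;
    [approx_invariant] controls that dependence. *)
Definition good k g phi : set M :=
  (chart_dom phi `&` V) `&` [set x | dom (jenv g phi (phi x)) (sdens R d k)].

Definition sfun k g phi (x : M) : R := interp (jenv g phi (phi x)) (sdens R d k).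
Definition efun k g phi (x : M) : R := interp (jenv g phi (phi x)) (serr R d k).

Lemma jenv_smooth g phi : conf_class c g -> atlas phi ->
  smooth (phi @` (chart_dom phi `&` V)) (local_expr phi (s g)).
Proof. by move=> cg aphi; have [[ds _] _ _] := def; exact: ds. Qed.

Lemma jenv_system g phi : conf_class c g -> atlas phi ->
  closed_system (phi @` (chart_dom phi `&` V)) (jenv g phi) jdelta.
Proof. by move=> cg aphi; apply: fam_system; apply: chart_fam_smooth => //; exact: jenv_smooth. Qed.

Lemma jenv_det g phi y : atlas phi -> (phi @` (chart_dom phi `&` V)) y ->
  \det (emx (jenv g phi y) gJ) != 0.
Proof. by move=> aphi; exact: jet_g_det. Qed.

Lemma jenv_einv_sym g phi y i j : atlas phi -> (phi @` (chart_dom phi `&` V)) y ->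
  interp (jenv g phi y) (einv gJ i j) = interp (jenv g phi y) (einv gJ j i).
Proof.
move=> aphi Ay; apply: (einv_sym (A := phi @` (chart_dom phi `&` V))) Ay => z.
  by move=> a b Az; exact: (jet_g_sym g aphi (s g) a b Az).
by move=> Az; exact: jenv_det.
Qed.

Lemma good_open k g phi : conf_class c g -> atlas phi -> open (good k g phi).
Proof.
move=> cg aphi.
have oA : open (phi @` (chart_dom phi `&` V)) by exact: chart_img_open_sub.
have := chart_preim_open phi (open_dom oA (jenv_system cg aphi) (e := sdens R d k)).
congr open; apply/seteqP; split=> x /=.
  by move=> [dx [/chart_imgP[_ Vx _] dk]]; rewrite chart_mapK // in Vx.
by move=> [[dx Vx] dk]; split=> //; split=> //; exact: chart_img.
Qed.

Lemma good_err k g phi x : atlas phi -> good k g phi x ->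
  dom (jenv g phi (phi x)) (serr R d k).
Proof.
move=> aphi [[dx Vx] dk]; apply: dom_serr => //.
by apply: jenv_det => //; exact: chart_img.
Qed.

Lemma interp_good_smooth k g phi e : conf_class c g -> atlas phi ->
  (forall x, good k g phi x -> dom (jenv g phi (phi x)) e) ->
  smooth (phi @` (chart_dom phi `&` good k g phi))
    (local_expr phi (fun x => interp (jenv g phi (phi x)) e)).
Proof.
move=> cg aphi de.
have oA : open (phi @` (chart_dom phi `&` V)) by exact: chart_img_open_sub.
apply: (smooth_eq (f := fun y => interp (jenv g phi y) e)).
- by apply: chart_img_open_sub; exact: good_open.
- by move=> y /chart_imgP[_ _ yE]; rewrite /local_expr yE.
apply: smooth_sub (smooth_interp oA (jenv_system cg aphi) (e := e)).
move=> y [x [dx gx] <-]; split; last exact: de.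
by case: gx => -[_ Vx] _; exact: chart_img.
Qed.

Lemma sfun_smooth k g phi : conf_class c g -> atlas phi ->
  smooth (phi @` (chart_dom phi `&` good k g phi)) (local_expr phi (sfun k g phi)).
Proof. by move=> cg aphi; apply: interp_good_smooth => // x []. Qed.

Lemma efun_smooth k g phi : conf_class c g -> atlas phi ->
  smooth (phi @` (chart_dom phi `&` good k g phi)) (local_expr phi (efun k g phi)).
Proof. by move=> cg aphi; apply: interp_good_smooth => // x; exact: good_err. Qed.

Lemma sfun_sign k g phi x : good k g phi x ->
  exists2 v, 0 < v & sfun k g phi x = s g x * v.
Proof.
move=> [[dx Vx] dk]; have [v v0 E] := sdens_sign dk; exists v => //.
by rewrite /sfun E /= /jenv /fam_env /= /local_expr chart_mapK.
Qed.

Lemma Isq_sfun k g phi x : conf_class c g -> atlas phi -> (k <= d)%N ->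
  good k g phi x -> Isq g phi (sfun k g phi) x = 1 + sfun k g phi x ^+ k * efun k g phi x.
Proof.
move=> cg aphi kd gx; pose A := phi @` (chart_dom phi `&` good k g phi).
have AV : A `<=` phi @` (chart_dom phi `&` V) by move=> y [z [dz [[_ Vz] _]] <-]; exists z.
have oA : open A by apply: chart_img_open_sub; exact: good_open.
have sys : closed_system A (jenv g phi) jdelta.
  by move=> v y Ay; exact: (jenv_system cg aphi v (AV _ Ay)).
have [[dx Vx] dk] := gx; have Ax := chart_img dx Vx.
rewrite -(approx_correct _ kd dk); last first.
  by move=> i j; exact: jenv_einv_sym.
apply: (bridge_Isq (A := A) oA sys) => //.
- by move=> y /AV; exact: jenv_det.
- by move=> y /chart_imgP[_ [_ dy] yE]; rewrite -yE.
- by move=> y /chart_imgP[_ _ yE]; rewrite /local_expr /sfun yE.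
- exact: chart_img.
Qed.

Lemma goodS k g phi x : good k.+1 g phi x -> good k g phi x.
Proof. by move=> [h /dom_sdensS[]]. Qed.

Definition smod k g phi x :=
  interp (jenv g phi (phi x)) (step_mod d k (sdens R d k) (serr R d k)).

Lemma goodS_P k g phi x : atlas phi ->
  good k.+1 g phi x <-> good k g phi x /\ 0 < smod k g phi x.
Proof.
move=> aphi; split=> [gx|[gx m0]]; first by split; [exact: goodS | case: gx => _ /dom_sdensS[]].
have de := good_err aphi gx; have [h dk] := gx; split=> //; split=> //; split=> //.
by split=> //; split=> //; exact: dom_epow.
Qed.

Lemma smodE k g phi x : smod k g phi x =
  1 + step_cst R d k * (sfun k g phi x ^+ k * efun k g phi x).
Proof. by rewrite /smod /= interp_epow. Qed.

Lemma sfunS k g phi x :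
  sfun k.+1 g phi x = sfun k g phi x * (Num.sqrt (smod k g phi x))^-1.
Proof. by []. Qed.

(** The three claims support one another: weight 1 of s_k and weight -k of A_k make [smod]
    invariant, which carries the domain and the weight of s_(k+1) to the next stage. *)
Lemma approx_invariant k g g' Omega phi psi x : (k <= d)%N ->
  conf_class c g -> conf_class c g' -> rescaled_by Omega g g' ->
  atlas phi -> atlas psi -> chart_dom phi x -> chart_dom psi x -> V x ->
  good k g phi x -> [/\ good k g' psi x, sfun k g' psi x = Omega x * sfun k g phi x &
    Omega x ^+ k * efun k g' psi x = efun k g phi x].
Proof.
move=> kd cg cg' resc aphi apsi; have [sO O0 _] := resc.
elim: k kd x => [_ x dx dx' Vx gx|k IH kd].
  have [[_ sc] _ _] := def.
  have sE z : V z -> s g' z = Omega z * s g z.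
    by move=> Vz; rewrite (sc g g' Omega cg cg' resc z Vz) powRr1 // ltW.
  split=> //.
    by rewrite /sfun /= /jenv /fam_env /= /local_expr !chart_mapK // sE.
  have E h chi : conf_class c h -> atlas chi -> chart_dom chi x ->
      efun 0 h chi x = Isq h chi (s h) x - 1.
    move=> ch achi dchi; rewrite (chart_Isq h achi oV (jenv_smooth ch achi) dchi Vx).
    by [].
  rewrite expr0 mul1r !E //; congr (_ - _).
  by apply: (Isq_invariant d1 resc aphi apsi oV) => //; exact: jenv_smooth.
have kd' := ltnW kd.
have first z : chart_dom phi z -> chart_dom psi z -> V z -> good k.+1 g phi z ->
    good k.+1 g' psi z /\ sfun k.+1 g' psi z = Omega z * sfun k.+1 g phi z.
  move=> dz dz' Vz gz; have [gk m0] := (goodS_P k g z aphi).1 gz.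
  have [gk' sE eE] := IH kd' z dz dz' Vz gk.
  have mE : smod k g' psi z = smod k g phi z.
    by rewrite !smodE sE -eE exprMn; congr (_ + _ * _); ring.
  split; first by apply/goodS_P => //; rewrite mE.
  by rewrite !sfunS mE sE mulrA.
move=> x dx dx' Vx gx.
have [gx' sE] := first x dx dx' Vx gx; split=> //.
(* I^2 involves derivatives, so s_(k+1) must be compared on an open set around x and not only at
   x. *)
pose W := chart_dom psi `&` good k.+1 g phi.
have oW : open W by apply: openI; [exact: chart_dom_open | exact: good_open].
have Wg z : W z -> [/\ chart_dom phi z, chart_dom psi z, V z & good k.+1 g phi z].
  by case=> dz gz; have [[dz' Vz] _] := gz.
pose h z := Omega z ^+ k.+1 * efun k.+1 g' psi z - efun k.+1 g phi z.
suff: h x = 0 by move/eqP; rewrite subr_eq0 => /eqP.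
have oM : open [set: M] by exact: openT.
apply: (vanish_on_zero_locus def oW) => //.
- by move=> z [_ [[]]].
- have cO : {for x, continuous Omega}.
    by apply: (chart_continuous dx _ (sO phi aphi)); exact: chart_img.
  have c1 : {for x, continuous (efun k.+1 g' psi)}.
    exact: (chart_continuous dx' (chart_img dx' gx') (efun_smooth (k := k.+1) cg' apsi)).
  have c2 : {for x, continuous (efun k.+1 g phi)}.
    by apply: (chart_continuous dx _ (efun_smooth (k := k.+1) cg aphi)); exact: chart_img.
  apply: cvgB c2; apply: cvgM c1.
  exact: (continuous_comp cO (@exprn_continuous R k.+1 _)).
move=> z Wz nS; have [dz dz' Vz gz] := Wg z Wz; have [gz' sEz] := first z dz dz' Vz gz.
have Wsmooth chi ff : smooth (chi @` (chart_dom chi `&` good k.+1 g phi)) ff -> True by [].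
have sub1 : phi @` (chart_dom phi `&` W) `<=` phi @` (chart_dom phi `&` good k.+1 g phi).
  by move=> y [t [dt [_ gt]] <-]; exists t.
have sub2 : psi @` (chart_dom psi `&` W) `<=` psi @` (chart_dom psi `&` good k.+1 g' psi).
  move=> y [t [dt Wt] <-]; have [a1 a2 a3 a4] := Wg t Wt.
  by exists t => //; split=> //; have [] := first t a1 a2 a3 a4.
have I := Isq_invariant d1 resc aphi apsi oW (smooth_sub sub1 (sfun_smooth (k := k.+1) cg aphi))
  (smooth_sub sub2 (sfun_smooth (k := k.+1) cg' apsi))
  (fun t Wt => let: And4 a1 a2 a3 a4 := Wg t Wt in (first t a1 a2 a3 a4).2) dz dz' Wz.
rewrite !Isq_sfun // in I.
have [v v0 vE] := sfun_sign gz.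
have f0 : sfun k.+1 g phi z != 0.
  rewrite vE; apply: mulf_neq0; last by rewrite gt_eqF.
  apply/eqP => sz.
  by have [_ sS _] := def; apply: nS; apply/(sS g).
apply: (mulfI (expf_neq0 k.+1 f0)); rewrite mulr0 /h mulrBr.
move/addrI: I; rewrite sEz exprMn => <-; ring.
Qed.

End Approximation.

(** * Expressions as functions on a finite jet space *)

Section JetFormula.
Variables (R : realType) (d : nat).
Notation jvar := (option ('I_d * 'I_d) * seq 'I_d)%type.

Fixpoint jet_order (e : expr R jvar) : nat :=
  match e with
  | Var v => size v.2
  | Const _ => 0%N
  | Add a b | Mul a b => maxn (jet_order a) (jet_order b)
  | RS a => jet_order a
  end.

Lemma interp_order (env env' : jvar -> R) e :
  (forall v, (size v.2 <= jet_order e)%N -> env v = env' v) ->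
  interp env e = interp env' e /\ (dom env e <-> dom env' e).
Proof.
elim: e => [v|k|a IHa b IHb|a IHa b IHb|a IHa] /= E.
- by split=> //; exact: E.
- by [].
- have [|-> ->] := IHa; first by move=> v va; apply: E; rewrite leq_max va.
  by have [|-> ->] := IHb => // v vb; apply: E; rewrite leq_max vb orbT.
- have [|-> ->] := IHa; first by move=> v va; apply: E; rewrite leq_max va.
  by have [|-> ->] := IHb => // v vb; apply: E; rewrite leq_max vb orbT.
- by have [|-> ->] := IHa.
Qed.

Variable N : nat.

Definition jet_pos (v : jvar) : option 'I_#|jet_index d N| :=
  omap (fun b : N.-bseq 'I_d => enum_rank ((v.1, b) : jet_index d N)) (insub v.2).

(** Words longer than N have no coordinate and receive the value 0, which an expression of order at
    most N never consults. *)
Definition jet_env (J : jet_space R d N) (v : jvar) : R :=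
  if jet_pos v is Some a then J 0 a else 0.

(** Differentiation is now with respect to the jet coordinates themselves, so a variable has a
    Kronecker symbol as derivative; the results on closed systems then yield smoothness on the jet
    space. *)
Definition jet_delta (a : 'I_#|jet_index d N|) (v : jvar) : expr R jvar :=
  Const (if jet_pos v is Some b then (a == b)%:R else 0).

Lemma jet_env_jet (M : manifold R d) (g : metric M) (phi : chart R d M) f x v :
  (size v.2 <= N)%N ->
  jet_env (jet N g phi f x) v = fam_env (chart_fam g phi f) (phi x) v.
Proof.
case: v => k w /= wN; rewrite /jet_env /jet_pos insubT /= mxE enum_rankK /=.
by case: k => [[i j]|].
Qed.

Lemma coord_derive n (y v : 'rV[R]_n) (k : 'I_n) :
  derivable (fun z : 'rV[R]_n => z 0 k) y v /\ 'D_v (fun z : 'rV[R]_n => z 0 k) y = v 0 k.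
Proof.
have di := @derivable_id R 'rV[R]_n y v; split; first exact: (derivable_mxP _ _ _).1.
by have := derive_mx di; rewrite derive_id => /matrixP/(_ 0 k) ->; rewrite mxE.
Qed.

Lemma jet_system : closed_system [set: jet_space R d N] jet_env jet_delta.
Proof.
move=> v J _; rewrite /jet_env /jet_delta; case: (jet_pos v) => [b|]; last first.
  split; first exact: cst_continuous.
  by move=> a; split=> //; rewrite /partial /= derive_cst.
split; first exact: coord_continuous.
move=> a; have [h1 h2] := coord_derive J 'e_a b; split=> //.
by rewrite /partial /= h2 mxE eqxx eq_sym.
Qed.

End JetFormula.

Section Existence.
Variables (R : realType) (d : nat) (M : manifold R d) (c : conformal_structure M).
Variables (S V : set M) (s : metric M -> M -> R).
Hypotheses (d1 : (1 < d)%N) (oV : open V) (def : defining_density c V S s).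
Implicit Types (phi psi : chart R d M) (g : metric M) (k : nat).

Lemma metric_inv_pos g phi x (v : 'rV[R]_d) : atlas phi -> chart_dom phi x -> v != 0 ->
  0 < (v *m invmx (g phi x) *m v^T) 0 0.
Proof.
move=> aphi dx v0; have gu := metric_unit g aphi dx; set G := g phi x in gu *.
have Gs : G^T = G by exact: Defs.metric_sym.
pose w := v *m invmx G.
have w0 : w != 0.
  by apply: contra v0 => /eqP w0; rewrite -(mulmxKV gu v) -/w w0 mul0mx.
have := metric_pos g aphi dx w0; rewrite -/G /w mulmxKV // trmx_mul trmx_inv Gs.
by rewrite mulmxA.
Qed.

Lemma grad_pos g phi x : conf_class c g -> atlas phi -> chart_dom phi x -> V x -> S x ->
  0 < interp (jenv s g phi (phi x)) (egrad (@fam_delta R d _) (@jet_g R d) (@jet_f R d) (@jet_f R d)).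
Proof.
move=> cg aphi dx Vx Sx; have [_ _ dS] := def; have [i Fi] := dS g phi x cg aphi dx Vx Sx.
have Ax := chart_img dx Vx.
pose v : 'rV[R]_d := \row_j partial j (local_expr phi (s g)) (phi x).
have v0 : v != 0.
  by apply: contraNneq Fi => /rowP/(_ i); rewrite !mxE => ->.
have := metric_inv_pos g aphi dx v0; rewrite mxE interp_grad exchange_big /=.
congr (0 < _); apply: eq_bigr => j _; rewrite mxE mulr_suml; apply: eq_bigr => k _.
rewrite interp_einv; last exact: jenv_det Ax.
by rewrite emx_jet_g chart_mapK // !mxE /= mulrAC mulrC mulrA mulrC mulrCA mulrA.
Qed.

(** On the hypersurface s_k = 0, so [smod] is 1 for k >= 1. For k = 0, where [step_cst] is 1, it is
    I^2, which reduces there to the squared gradient of sigma. *)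
Lemma zero_good g phi x k : conf_class c g -> atlas phi -> chart_dom phi x -> V x -> S x ->
  (k <= d)%N -> good V s k g phi x.
Proof.
move=> cg aphi dx Vx Sx; have [_ sS _] := def.
have sx : s g x = 0 by exact/(sS g x cg Vx).
elim: k => [//|k IH kd]; have gk := IH (ltnW kd).
apply/goodS_P => //; split=> //; rewrite smodE.
have [v _ vE] := sfun_sign gk; rewrite vE sx mul0r.
case: k {IH gk v vE} kd => [|k] kd; last by rewrite expr0n mul0r mulr0 addr0.
have -> : step_cst R d 0 = 1.
  by rewrite /step_cst subr0 mul1r divff // pnatr_eq0 -lt0n (ltn_trans _ d1).
rewrite expr0 !mul1r.
rewrite -[efun _ _ _ _ _]/(interp (jenv s g phi (phi x)) (eI _ (@jet_g R d) (@jet_f R d)) - 1).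
rewrite addrC subrK interp_eI.
have -> : interp (jenv s g phi (phi x)) (@jet_f R d) = 0.
  by rewrite /= /jenv /fam_env /= /local_expr chart_mapK.
by rewrite mulr0 mul0r subr0 grad_pos.
Qed.

(** By [approx_invariant] every scale and chart around the point would serve as witness; as a union
    of the sets [good] it is open. *)
Definition exist_dom : set M :=
  [set x | exists g phi, [/\ conf_class c g, atlas phi & good V s d g phi x]].

Definition chart_at (x : M) : chart R d M := s2val (cid2 (atlas_cover x)).

Lemma chart_at_atlas x : atlas (chart_at x).
Proof. exact: s2valP (cid2 (atlas_cover x)). Qed.

Lemma chart_at_dom x : chart_dom (chart_at x) x.
Proof. exact: s2valP' (cid2 (atlas_cover x)). Qed.

(** The chart at x is an arbitrary choice, so smoothness is not visible from this formula;
    [exist_domP] removes the choice. *)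
Definition exist_density g (x : M) : R := sfun s d g (chart_at x) x.
Definition exist_error g (x : M) : R := efun s d g (chart_at x) x.

Lemma exist_domP g phi x : conf_class c g -> atlas phi -> chart_dom phi x ->
  exist_dom x -> [/\ good V s d g phi x, sfun s d g phi x = exist_density g x &
     efun s d g phi x = exist_error g x].
Proof.
move=> cg aphi dx [g0 [phi0 [cg0 aphi0 gx]]]; have [[dx0 Vx] _] := gx.
have [Om resc] := conf_rel cg0 cg.
(* First from the witness of [exist_dom] to the pair (g, phi), then in the fixed scale g from phi to
   the chosen chart. *)
have [gx' _ _] := approx_invariant d1 oV def (leqnn d) cg0 cg resc aphi0 aphi dx0 dx Vx gx.
have [_ E1 E2] := approx_invariant d1 oV def (leqnn d) cg cg (rescaled_refl g) aphi
  (chart_at_atlas x) dx (chart_at_dom x) Vx gx'.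
by split=> //; [rewrite /exist_density E1 mul1r | rewrite /exist_error -E2 expr1n mul1r].
Qed.

Lemma exist_dom_open : open exist_dom.
Proof.
rewrite openE => x [g [phi [cg aphi gx]]]; rewrite /interior.
have := open_nbhs_nbhs (conj (good_open oV def d cg aphi) gx).
by apply: filterS => z gz; exists g, phi.
Qed.

Lemma exist_dom_sub : exist_dom `<=` V.
Proof. by move=> x [g [phi [_ _ [[_ Vx] _]]]]. Qed.

Lemma zero_exist_dom : V `&` S `<=` exist_dom.
Proof.
move=> x [Vx Sx]; have [g cg] := conf_class_nonempty c.
exists g, (chart_at x); split=> //; first exact: chart_at_atlas.
by apply: zero_good => //; [exact: chart_at_atlas | exact: chart_at_dom].
Qed.

Lemma exist_smooth g (h : nat -> metric M -> chart R d M -> M -> R) (h' : metric M -> M -> R) :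
  conf_class c g ->
  (forall phi, atlas phi ->
     smooth (phi @` (chart_dom phi `&` good V s d g phi)) (local_expr phi (h d g phi))) ->
  (forall phi x, atlas phi -> chart_dom phi x -> exist_dom x -> h d g phi x = h' g x) ->
  smooth_on exist_dom (h' g).
Proof.
move=> cg sh hE phi aphi; apply: (smooth_eq (f := local_expr phi (h d g phi))).
- by apply: chart_img_open_sub; exact: exist_dom_open.
- by move=> y /chart_imgP[dy Uy yE]; rewrite /local_expr hE.
apply: smooth_sub (sh phi aphi) => y [x [dx Ux] <-]; exists x => //; split=> //.
by have [] := exist_domP cg aphi dx Ux.
Qed.

Lemma powR_weight (a x y : R) : 0 < a -> a ^+ d * x = y -> x = a `^ (- d%:R) * y.
Proof.
move=> a0 <-; rewrite powRN powR_mulrn ?ltW // mulKf //.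
by rewrite expf_neq0 // gt_eqF.
Qed.

Lemma exist_scaling g g' Omega x : conf_class c g -> conf_class c g' ->
  rescaled_by Omega g g' -> exist_dom x ->
  exist_density g' x = Omega x * exist_density g x /\
  Omega x ^+ d * exist_error g' x = exist_error g x.
Proof.
move=> cg cg' resc Ux; have ax := chart_at_atlas x; have dx := chart_at_dom x.
have [gx _ _] := exist_domP cg ax dx Ux.
by have [] := approx_invariant d1 oV def (leqnn d) cg cg' resc ax ax dx dx (exist_dom_sub Ux) gx.
Qed.

Lemma exist_sign g x : conf_class c g -> exist_dom x ->
  exists2 v, 0 < v & exist_density g x = s g x * v.
Proof.
move=> cg Ux; have [gx _ _] := exist_domP cg (chart_at_atlas x) (chart_at_dom x) Ux.
exact: sfun_sign gx.
Qed.

Lemma exist_Isq g phi x : conf_class c g -> atlas phi -> chart_dom phi x -> exist_dom x ->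
  Isq g phi (exist_density g) x = 1 + exist_density g x ^+ d * exist_error g x.
Proof.
move=> cg aphi dx Ux; have [gx E1 E2] := exist_domP cg aphi dx Ux.
rewrite -E1 -E2 -(Isq_sfun oV def cg aphi (leqnn d) gx).
pose U := chart_dom phi `&` exist_dom.
have oU : open U by apply: openI; [exact: chart_dom_open | exact: exist_dom_open].
(* With Omega = 1 this expresses the locality of I^2: the two functions agree on U. *)
apply: (Isq_conformal (U := U) d1 (rescaled_refl g) aphi oU) => //.
  apply: smooth_sub (sfun_smooth oV def (k := d) cg aphi) => y [z [dz [_ Uz]] <-].
  by exists z => //; split=> //; have [] := exist_domP cg aphi dz Uz.
by move=> z [dz Uz]; rewrite mul1r; have [_ ->] := exist_domP cg aphi dz Uz.
Qed.

Lemma exist_density_smooth g : conf_class c g -> smooth_on exist_dom (exist_density g).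
Proof.
move=> cg; apply: (exist_smooth (h := sfun s)) => // [phi aphi|phi x aphi dx Ux].
  exact: (sfun_smooth oV def cg aphi).
by have [] := exist_domP cg aphi dx Ux.
Qed.

Lemma exist_error_smooth g : conf_class c g -> smooth_on exist_dom (exist_error g).
Proof.
move=> cg; apply: (exist_smooth (h := efun s)) => // [phi aphi|phi x aphi dx Ux].
  exact: (efun_smooth oV def cg aphi).
by have [] := exist_domP cg aphi dx Ux.
Qed.

Lemma exist_distinguished : distinguished_density c exist_dom S exist_density.
Proof.
have [_ sS _] := def.
have Isq0 := exist_Isq.
have z0 g x : conf_class c g -> exist_dom x -> (exist_density g x = 0 <-> S x).
  move=> cg Ux; have [v v0 ->] := exist_sign cg Ux; have Vx := exist_dom_sub Ux.
  rewrite -(sS g x cg Vx); split=> [/eqP|->]; last by rewrite mul0r.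
  by rewrite mulf_eq0 (gt_eqF v0) orbF => /eqP.
split; last first.
  exists exist_error; last by move=> g phi x; exact: exist_Isq.
  split; first by move=> g; exact: exist_error_smooth.
  move=> g g' Om cg cg' resc x Ux; have [_ E] := exist_scaling cg cg' resc Ux.
  by apply: powR_weight E; have [_ ] := resc.
split.
- split; first by move=> g; exact: exist_density_smooth.
  move=> g g' Om cg cg' resc x Ux; have [-> _] := exist_scaling cg cg' resc Ux.
  by rewrite powRr1 // ltW //; have [_ ] := resc.
- exact: z0.
(* If the gradient vanished at a zero of the density, I^2 would be 0 there, whereas it equals 1
   because d > 0. *)
- move=> g phi x cg aphi dx Ux Sx; apply: contrapT => nE.
  have p0 i : partial i (local_expr phi (exist_density g)) (phi x) = 0.
    by apply/eqP/negPn/negP => h; apply: nE; exists i.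
  have sx : exist_density g x = 0 by exact/z0.
  have := exist_Isq cg aphi dx Ux; rewrite sx expr0n.
  rewrite (gtn_eqF (ltnW d1)) mul0r addr0 /Isq.
  rewrite {3}/local_expr chart_mapK // sx mulr0 mul0r subr0 big1 => [/eqP|i _].
    by rewrite eq_sym oner_eq0.
  by rewrite big1 // => j _; rewrite !p0 mulr0.
Qed.

Lemma exist_oriented : compatibly_oriented c exist_dom S exist_density s.
Proof.
move=> g x cg Ux nS; have [v v0 ->] := exist_sign cg Ux; have Vx := exist_dom_sub Ux.
have [_ sS _] := def; rewrite mulrAC divff ?mul1r //.
by apply/eqP => /(sS g x cg Vx).
Qed.

Let N := jet_order (sdens R d d).

Lemma exist_formula : given_by_formula (N := N)
  [set J | dom (jet_env J) (sdens R d d)] (fun J => interp (jet_env J) (sdens R d d))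
  c exist_dom s exist_density.
Proof.
move=> g phi x cg aphi dx Ux; have [gx E _] := exist_domP cg aphi dx Ux.
have [E1 E2] := @interp_order R d (jet_env (jet N g phi (s g) x)) (jenv s g phi (phi x))
  (sdens R d d) (fun v vN => jet_env_jet g phi (s g) x vN).
by split; [apply/E2; case: gx | rewrite E1 -E].
Qed.

End Existence.

(** * Existence of defining densities *)

Section ChartChange.
Variables (R : realType) (d : nat) (M : manifold R d).
Implicit Types (phi psi : chart R d M) (U : set M) (f : M -> R).

(** Slice charts may lie outside the atlas, where [smooth_on] gives no direct information; this
    transfers smoothness and gradients to them and back. *)
Lemma chart_change phi psi U f : smooth_transition psi phi -> open U ->
  smooth (phi @` (chart_dom phi `&` U)) (local_expr phi f) ->
  smooth (psi @` (chart_dom psi `&` (chart_dom phi `&` U))) (local_expr psi f) /\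
  forall x k, chart_dom psi x -> chart_dom phi x -> U x ->
   partial k (local_expr psi f) (psi x) =
   \sum_j partial k (fun z => transition psi phi z 0 j) (psi x) *
      partial j (local_expr phi f) (phi x).
Proof.
move=> st oU sf; pose W := chart_dom phi `&` U.
have oW : open W by apply: openI => //; exact: chart_dom_open.
have oA : open (psi @` (chart_dom psi `&` W)) by exact: chart_img_open_sub.
have oB : open (phi @` (chart_dom phi `&` U)) by exact: chart_img_open_sub.
have sT j : smooth (psi @` (chart_dom psi `&` W)) (fun z => transition psi phi z 0 j).
  by apply: smooth_sub (st j) => y [z [dz [dz' _]] <-]; exists z.
have AB y : (psi @` (chart_dom psi `&` W)) y -> (phi @` (chart_dom phi `&` U)) (transition psi phi y).
  by move=> /chart_imgP[_ [dy Uy] _]; exists (chart_inv psi y).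
have E y : (psi @` (chart_dom psi `&` W)) y ->
    local_expr phi f (transition psi phi y) = local_expr psi f y.
  by move=> /chart_imgP[_ [dy Uy] _]; rewrite /local_expr /transition chart_mapK.
split.
  apply: (smooth_eq oA E).
  exact: (smooth_comp (F := fun _ : unit => local_expr phi f) oA oB sT (fun=> sf) AB tt).
move=> x k dx dx' Ux; have Ax : (psi @` (chart_dom psi `&` W)) (psi x) by exact: chart_img.
rewrite -(partial_eq k oA E Ax).
have [_ ->] := partial_comp k oA oB sT sf Ax (AB _ Ax).
by rewrite transition_inv.
Qed.

End ChartChange.

Section DefiningDensity.
Variables (R : realType) (d : nat) (M : manifold R d) (c : conformal_structure M).
Hypothesis d0 : (0 < d)%N.

Lemma rescaling_unique (g0 g : metric M) w1 w2 x :
  rescaled_by w1 g0 g -> rescaled_by w2 g0 g -> w1 x = w2 x.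
Proof.
move=> [_ p1 E1] [_ p2 E2]; have [phi aphi dx] := atlas_cover x.
pose v : 'rV[R]_d := 'e_(Ordinal d0).
have v0 : v != 0.
  by apply/eqP => /rowP/(_ (Ordinal d0)); rewrite !mxE !eqxx => /eqP; rewrite oner_eq0.
have E : w1 x ^+ 2 *: g0 phi x = w2 x ^+ 2 *: g0 phi x by rewrite -E1 // -E2.
have := metric_pos g0 aphi dx v0.
have := congr1 (fun A : 'M[R]_d => (v *m A *m v^T) 0 0) E.
rewrite /= -!scalemxAr -!scalemxAl; set q := v *m _ *m _.
rewrite [(_ *: q) 0 0]mxE [(w2 x ^+ 2 *: q) 0 0]mxE => EE P0.
move/(mulIf (lt0r_neq0 P0)): EE => /eqP.
by rewrite eqrXn2 ?ltW // => /eqP.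
Qed.

(** In a reference scale g0 the density is the slice coordinate, and in any other scale this
    coordinate times the conformal factor. *)
Lemma defining_density_exists (S : set M) p : hypersurface S -> S p ->
  exists V s, [/\ open V, V p & defining_density c V S s].
Proof.
move=> hS Sp; have [psi [i [cpsi dp Si]]] := hS p Sp.
have [g0 cE] := conf_classP c.
(* The factor of g relative to g0, unique by [rescaling_unique]; metrics outside the class get the
   default 1. *)
pose w g := xget (fun=> 1) [set w | rescaled_by w g0 g].
have wP g : conf_class c g -> rescaled_by (w g) g0 g.
  rewrite cE => -[w0 h].
  have : exists w1, [set w1 | rescaled_by w1 g0 g] w1 by exists w0.
  exact: xgetPex.
pose s g (x : M) := w g x * psi x 0 i.
pose V := chart_dom psi.
have oV : open V by exact: chart_dom_open.
have su : smooth_on V (fun x => psi x 0 i).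
  by move=> phi aphi; have [st _] := cpsi phi aphi; exact: st.
have sw g : conf_class c g -> smooth_on V (w g).
  by move=> cg; have [sw _ _] := wP g cg; exact: smooth_on_sub sw.
have w0 g x : conf_class c g -> 0 < w g x by move=> cg; have [_] := wP g cg.
exists V, s; split; [exact: oV | exact: dp | split].
- split; first by move=> g cg; exact: (smooth_onM oV (sw g cg) su).
  move=> g g' Om cg cg' resc x Vx; have [sO O0 OE] := resc.
  rewrite powRr1 ?ltW // mulrA; congr (_ * _).
  apply: (@rescaling_unique g0 g' (w g') (fun z => Om z * w g z) x); first exact: wP.
  have [s1 p1 E1] := wP g cg; split.
  + by apply: smooth_onM sO s1; exact: openT.
  + by move=> z; rewrite mulr_gt0.
  + by move=> phi z aphi dz; rewrite OE // E1 // scalerA exprMn.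
- move=> g x cg Vx; rewrite Si //; split=> [/eqP|h]; last by rewrite /s h mulr0.
  by rewrite mulf_eq0 gt_eqF ?w0 // => /eqP.
(* A vanishing gradient in phi would, by the chain rule, make the slice coordinate have zero
   derivative along itself in psi. *)
- move=> g phi x cg aphi dx Vx Sx; apply: contrapT => nE.
  have oA : open (phi @` (chart_dom phi `&` V)) by exact: chart_img_open_sub.
  have Ax := chart_img dx Vx.
  have u0 : psi x 0 i = 0 by exact/Si.
  have p0 j : partial j (local_expr phi (fun x => psi x 0 i)) (phi x) = 0.
    have : partial j (local_expr phi (s g)) (phi x) = 0.
      by apply/eqP/negPn/negP => h; apply: nE; exists j.
    rewrite (partialM oA j (sw g cg phi aphi) (su phi aphi) Ax).
    rewrite {2}/local_expr chart_mapK // u0 mulr0 add0r => /eqP.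
    by rewrite mulf_eq0 {1}/local_expr gt_eqF ?w0 //= => /eqP.
  have [st st'] := cpsi phi aphi.
  have [_ /(_ x i Vx dx Vx)] := chart_change st' oV (su phi aphi).
  rewrite big1; last by move=> j _; rewrite p0 mulr0.
  have oB : open (psi @` (chart_dom psi `&` setT)) by apply: chart_img_open_sub; exact: openT.
  rewrite (partial_eq i (g := fun z : 'rV[R]_d => z 0 i) oB).
  + have [_] := coord_derive (psi x) 'e_i i; rewrite /partial /= => ->.
    by rewrite mxE !eqxx => /eqP; rewrite oner_eq0.
  + by move=> y /chart_imgP[_ _ yE]; rewrite /local_expr yE.
  + exact: chart_img.
Qed.

End DefiningDensity.

(** * Division by a defining function *)

Section StraightDivision.
Variables (R : realType) (n : nat) (A : set 'rV[R]_n) (i : 'I_n).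
Hypothesis oA : open A.
Implicit Types (h f g : 'rV[R]_n -> R) (w z : 'rV[R]_n).

Lemma smooth_coord (B : set 'rV[R]_n) (j : 'I_n) : open B -> smooth B (fun z => z 0 j).
Proof.
move=> oB.
pose env (y : 'rV[R]_n) (k : 'I_n) : R := y 0 k.
have sys : closed_system B env (fun a k => Const (a == k)%:R).
  move=> k y By; split=> [|a]; first exact: coord_continuous.
  have [h1 h2] := coord_derive y 'e_a k; split=> //.
  by rewrite /partial /= h2 mxE eqxx eq_sym.
exact: (smooth_interp_on oB sys (e := Var j)).
Qed.

Lemma partials_sub_scale s h g (c : R) y : smooth A h -> smooth A g -> A y ->
  partials s (fun z => h z - c * g z) y = partials s h y - c * partials s g y.
Proof.
move=> sh sg; elim: s y => [//|j s IH] y Ay /=.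
have dh := (sh s y Ay).2 j; have dg := (sg s y Ay).2 j.
have := partial_eq j oA IH Ay; rewrite /partial /= => ->.
have -> : (fun z => partials s h z - c * partials s g z) = partials s h - c \*: partials s g.
  by apply/funext.
by rewrite (deriveB dh (derivableZ (k := c) dg)) (deriveZ c dg).
Qed.

Lemma partial_coordX k y : partial i (fun z => z 0 i ^+ k) y = k%:R * y 0 i ^+ k.-1.
Proof.
have sc := smooth_coord i (@openT 'rV[R]_n).
elim: k => [|k IH].
  rewrite mul0r (_ : (fun z => _) = cst 1); last by apply/funext => z; rewrite expr0.
  exact: derive_cst.
rewrite (_ : (fun z => _) = (fun z => z 0 i * z 0 i ^+ k)); last by apply/funext => z; rewrite exprS.
rewrite (partialM openT i sc (smoothX openT k sc)) // IH.
have [_] := coord_derive y 'e_i i; rewrite mxE !eqxx /partial /= => ->.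
case: k {IH} => [|k] /=; first by rewrite !expr0 mul0r !mul1r mulr0 addr0.
by rewrite mul1r mulrCA -exprS -[in RHS]natr1 mulrDl mul1r addrC.
Qed.

Lemma partials_coordX m k :
  partials (nseq m i) (fun z => z 0 i ^+ k) = fun z => (k ^_ m)%:R * z 0 i ^+ (k - m).
Proof.
elim: m => [|m IH] /=; first by apply/funext => z; rewrite ffactn0 mul1r subn0.
rewrite IH; apply/funext => y.
have sc := smooth_coord i (@openT 'rV[R]_n).
have := partialM openT i (smooth_cst openT (k ^_ m)%:R) (smoothX openT (k - m) sc) (y := y) I.
rewrite partial_coordX /partial /= => ->.
by rewrite derive_cst mul0r add0r mulrA ffactnSr natrM subnS.
Qed.

(** Iterating the mean value theorem gives Taylor's estimate without its factorial, which is enough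
    for limits. *)
Lemma taylor_bound k h w (s e : R) : smooth A h ->
  (forall m, (m < k)%N -> partials (nseq m i) h w = 0) ->
  (forall t : R, `|t| <= `|s| -> A (w + t *: 'e_i) /\
    `|partials (nseq k i) h (w + t *: 'e_i)| <= e) ->
  `|h (w + s *: 'e_i)| <= e * `|s| ^+ k.
Proof.
elim: k h s => [|k IH] h s sh V H.
  by rewrite expr0 mulr1; have [] := H s (lexx _).
have nE m : partials (nseq m i) (partial i h) = partials (nseq m.+1 i) h.
  by rewrite -[m.+1]addn1 nseqD partials_cat.
have e0 : 0 <= e by have [_] := H 0 (ltac:(by rewrite normr0)); exact: le_trans.
have [r|t [ts E]] := @line_mvt _ _ h w 'e_i s.
  by move=> /H[Ar _]; exact: smooth_derivable sh Ar.
have h0 : h w = 0 by exact: (V 0).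
rewrite h0 subr0 in E; rewrite E normrM exprS mulrCA ler_wpM2l //.
have := IH (partial i h) t (smooth_partial i sh).
move=> /(_ _ _)/le_trans; apply.
- by move=> m mk; rewrite nE; exact: V.
- by move=> r rt; rewrite nE; apply: H; exact: le_trans ts.
- by rewrite ler_wpM2l // lerXn2r // nnegrE.
Qed.

Definition foot z : 'rV[R]_n := z - z 0 i *: 'e_i.

(** In the sup norm, replacing the i-th coordinate of z by a smaller one in absolute value does not
    move it further from a point z0 of the hyperplane. *)
Lemma near_line z0 (P : set 'rV[R]_n) : z0 0 i = 0 -> (\forall z \near z0, P z) ->
  \forall z \near z0, forall t : R, `|t| <= `|(z : 'rV[R]_n) 0 i| ->
    P (foot z + t *: 'e_i).
Proof.
move=> z00 /nbhs_ballP[r /= r0 rP]; apply/nbhs_ballP; exists r => //= z.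
rewrite -ball_normE /= => zr t tz; apply: rP; rewrite -ball_normE /=.
apply: le_lt_trans zr; apply: norm_le_coord => // j; rewrite !mxE eqxx /=.
have [->|ji] := eqVneq j i.
  rewrite mulr1 subrr add0r mulr1 z00 sub0r normrN (le_trans tz) //.
  by have := coord_le_norm (z0 - z) i; rewrite !mxE z00 sub0r normrN.
rewrite !mulr0 subr0 addr0.
by have := coord_le_norm (z0 - z) j; rewrite !mxE.
Qed.

Definition vanish k h := forall z m, A z -> z 0 i = 0 -> (m < k)%N ->
  partials (nseq m i) h z = 0.

(* The quotient of h by the k-th power of the coordinate z_i, extended to the
   hyperplane z_i = 0 by its Taylor coefficient. The class of these functions
   is closed under partial derivatives. *)
Definition quot k h z : R :=
  if z 0 i == 0 then partials (nseq k i) h z / k`!%:R else h z / z 0 i ^+ k.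

Lemma footK z : foot z + z 0 i *: 'e_i = z.
Proof. exact: subrK. Qed.

Lemma foot0 z : foot z 0 i = 0.
Proof. by rewrite !mxE !eqxx mulr1 subrr. Qed.

Lemma open_nonzero f : smooth A f -> open (A `&` [set z | f z != 0]).
Proof.
move=> sf; rewrite openE => z [Az fz]; rewrite /interior.
have n1 := open_nbhs_nbhs (conj oA Az).
have n2 := @cvgr_neq0 _ _ _ _ (nbhs_filter z) _ _ (smooth_continuous sf Az) fz.
by apply: filterS2 n1 n2.
Qed.

Lemma open_off_coord : open (A `&` [set z | z 0 i != 0]).
Proof. exact: (open_nonzero (smooth_coord i oA)). Qed.

Lemma quot_smooth_off k h : smooth A h ->
  smooth (A `&` [set z | z 0 i != 0]) (quot k h).
Proof.
move=> sh; have oB := open_off_coord.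
have sB : smooth (A `&` [set z | z 0 i != 0]) h by apply: smooth_sub sh => z [].
have sX := smoothX oB k (smooth_coord i oB).
apply: smooth_eq (smooth_div oB sB sX _) => // z [_ /= z0]; last by rewrite expf_neq0.
by rewrite /quot (negbTE z0).
Qed.

Lemma continuous_dist (f : 'rV[R]_n -> R) z0 :
  (forall e : R, 0 < e -> \forall z \near z0, `|f z0 - f z| <= e) ->
  {for z0, continuous f}.
Proof. by move=> H; apply: (cvgrPdist_le (FF := nbhs_filter z0) f (f z0)).2. Qed.

Lemma quot_continuous k h z0 : smooth A h -> vanish k h -> A z0 ->
  {for z0, continuous (quot k h)}.
Proof.
move=> sh V Az0; have [z00|z00] := eqVneq (z0 0 i) 0; last first.
  exact: smooth_continuous (quot_smooth_off k sh) _.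
have kf : (k`!%:R : R) != 0 by rewrite pnatr_eq0 -lt0n fact_gt0.
pose c := partials (nseq k i) h z0 / k`!%:R.
have sX := smoothX oA k (smooth_coord i oA).
(* With the Taylor term removed, the derivatives of f along e_i of order below k vanish on the
   hyperplane and the one of order k is small near z0, so [taylor_bound] gives |f| <= e |z_i|^k. *)
pose f z := h z - c * z 0 i ^+ k.
have sf : smooth A f by exact: (smoothB oA sh (smoothM oA (smooth_cst oA c) sX)).
have Df m z : A z -> partials (nseq m i) f z =
    partials (nseq m i) h z - c * ((k ^_ m)%:R * z 0 i ^+ (k - m)).
  by move=> Az; rewrite partials_sub_scale // partials_coordX.
apply: continuous_dist => e e0.
have N : \forall z \near z0, A z /\ `|partials (nseq k i) h z0 - partials (nseq k i) h z| <= e.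
  have [ck _] := sh (nseq k i) z0 Az0.
  near=> z; split; first by near: z; exact: open_nbhs_nbhs.
  by apply: ltW; near: z; exact: continuous_near.
near=> z.
have [Az hz] : A z /\ `|partials (nseq k i) h z0 - partials (nseq k i) h z| <= e.
  by near: z.
rewrite {1}/quot z00 eqxx -/c /quot; have [zi|zi] := eqVneq (z 0 i) 0.
  rewrite -mulrBl normrM normfV normr_nat ler_pdivrMr ?ltr0n ?fact_gt0 //.
  by apply: le_trans hz _; rewrite ler_peMr ?ler1n ?fact_gt0 // ltW.
have L : forall t : R, `|t| <= `|z 0 i| -> A (foot z + t *: 'e_i) /\
    `|partials (nseq k i) h z0 - partials (nseq k i) h (foot z + t *: 'e_i)| <= e.
  by near: z; exact: (near_line z00 N).
have Af : A (foot z).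
  by have [] := L 0 (ltac:(by rewrite normr0)); rewrite scale0r addr0.
have := @taylor_bound k f (foot z) (z 0 i) e sf.
rewrite footK => T; rewrite -(mulfK (expf_neq0 k zi) c) -mulrBl normrM normfV normrX.
rewrite ler_pdivrMr ?exprn_gt0 ?normr_gt0 // distrC; apply: T.
  move=> m mk; rewrite Df // foot0 expr0n subn_eq0 leqNgt mk /= !mulr0 subr0.
  by apply: V; rewrite ?foot0.
move=> t /L[At]; split=> //; rewrite Df // subnn expr0 mulr1 ffactnn divfK //.
by rewrite distrC.
Unshelve. all: by end_near. Qed.

Lemma derivable_along (f g : 'rV[R]_n -> R) z v : (forall t : R, f (z + t *: v) = g (z + t *: v)) ->
  (derivable f z v <-> derivable g z v) /\ 'D_v f z = 'D_v g z.
Proof.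
move=> fg; rewrite -[z]addr0 -(scale0r v) -!derivable_line -!derive_line.
by rewrite (_ : (fun s => f _) = (fun s => g (z + s *: v))) //; apply/funext.
Qed.

Lemma partials_comm m j h y : smooth A h -> A y ->
  partials (nseq m i) (partial j h) y = partial j (partials (nseq m i) h) y.
Proof.
move=> sh; elim: m y => [//|m IH] y Ay.
have := partial_eq i oA IH Ay; rewrite /partial /= => ->.
exact: (schwarz i j oA (smooth_partials (nseq m i) sh) Ay).
Qed.

Lemma add_line0 z (t : R) j : j != i -> (z + t *: 'e_j) 0 i = z 0 i.
Proof. by move=> ji; rewrite !mxE eqxx eq_sym (negbTE ji) mulr0 addr0. Qed.

(** Along e_j the coordinate z_i is constant, so the same branch of [quot] applies throughout and is
    a smooth function times a constant. *)
Lemma quot_cross k h z j : j != i -> smooth A h -> A z ->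
  derivable (quot k h) z 'e_j /\ partial j (quot k h) z = quot k (partial j h) z.
Proof.
move=> ji sh Az.
pose L y := if z 0 i == 0 then partials (nseq k i) h y * (k`!%:R)^-1
            else h y * (z 0 i ^+ k)^-1.
have [dE ddE] : (derivable (quot k h) z 'e_j <-> derivable L z 'e_j) /\
    'D_('e_j) (quot k h) z = 'D_('e_j) L z.
  by apply: derivable_along => t; rewrite /quot /L add_line0.
have sD := smooth_partials (nseq k i) sh.
have -> : partial j (quot k h) z = partial j L z by exact: ddE.
rewrite dE /L /quot; case: ifP => z0.
  have sc := smooth_cst oA (k`!%:R)^-1.
  split; first exact: smooth_derivable (smoothM oA sD sc) Az.
  rewrite (partialM oA j sD sc Az) [X in _ + _ * X]derive_cst mulr0 addr0.
  by rewrite partials_comm.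
have sc := smooth_cst oA (z 0 i ^+ k)^-1.
split; first exact: smooth_derivable (smoothM oA sh sc) Az.
by rewrite (partialM oA j sh sc Az) [X in _ + _ * X]derive_cst mulr0 addr0.
Qed.

(** The numerator of the derivative of h / z_i^k once the denominator is z_i^(k+1). *)
Definition euler k h z := z 0 i * partial i h z - k%:R * h z.

Lemma smooth_euler k h : smooth A h -> smooth A (euler k h).
Proof.
move=> sh; have s1 := smoothM oA (smooth_coord i oA) (smooth_partial i sh).
exact: (smoothB oA s1 (smoothM oA (smooth_cst oA _) sh)).
Qed.

Lemma partials_euler m k h y : smooth A h -> A y ->
  partials (nseq m i) (euler k h) y =
  y 0 i * partials (nseq m.+1 i) h y + (m%:R - k%:R) * partials (nseq m i) h y.
Proof.
move=> sh; elim: m y => [|m IH] y Ay; first by rewrite /euler sub0r mulNr.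
have s1 := smooth_partials (nseq m.+1 i) sh; have s2 := smooth_partials (nseq m i) sh.
have sc := smooth_coord i oA.
set D1 := partials (nseq m.+1 i) h in IH s1 *; set D2 := partials (nseq m i) h in IH s2 *.
transitivity (partial i (fun z => z 0 i * D1 z - (k%:R - m%:R) * D2 z) y).
  apply: (partial_eq i oA _ Ay) => z Az; rewrite [LHS](IH z Az).
  by rewrite -[in RHS]mulNr opprB.
have := partials_sub_scale [:: i] (k%:R - m%:R) (smoothM oA sc s1) s2 Ay.
rewrite -/(partial i _ _) => ->; rewrite -!/(partial i _ _) (partialM oA i sc s1 Ay).
have -> : partial i (fun z : 'rV[R]_n => z 0 i) y = 1.
  by have [_] := coord_derive y 'e_i i; rewrite mxE !eqxx.
rewrite -[partials (nseq m.+2 i) h y]/(partial i D1 y) -[partial i D2 y]/(D1 y) mul1r -natr1.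
by move: (partial i D1 y) (D1 y) => a b; ring.
Qed.

(** On the hyperplane the derivative of order m acquires the factor m - k, which kills order k, the
    only one not already zero. *)
Lemma vanish_euler k h : smooth A h -> vanish k h -> vanish k.+1 (euler k h).
Proof.
move=> sh V z m Az z0 mk; rewrite partials_euler // z0 mul0r add0r.
by move: mk; rewrite ltnS leq_eqVlt => /orP[/eqP->|mk]; rewrite ?subrr ?mul0r // V // mulr0.
Qed.

Lemma near_line0 z (P : set 'rV[R]_n) (v : 'rV[R]_n) : (\forall y \near z, P y) ->
  \forall s \near (0 : R), forall t : R, `|t| <= `|s| -> P (z + t *: v).
Proof.
move=> Pz; have c : {for (0 : R), continuous (fun s : R => z + s *: v)}.
  by apply: cvgD; [exact: cvg_cst | apply: cvgZr_tmp; exact: cvg_id].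
have /nbhs_ballP[r /= r0 rP] : \forall s \near (0 : R), P (z + s *: v).
  by apply: c; rewrite scale0r addr0.
apply/nbhs_ballP; exists r => //= s; rewrite -ball_normE /= sub0r normrN => sr t ts.
by apply: rP; rewrite -ball_normE /= sub0r normrN; exact: le_lt_trans sr.
Qed.

Lemma quot_along_off (x q Q : R) k : x != 0 ->
  q = (x * (q * x ^+ k + Q * (k%:R * x ^+ k.-1)) - k%:R * (Q * x ^+ k)) / x ^+ k.+1.
Proof.
move=> x0; case: k => [|k] /=; first by rewrite !expr0 expr1; field.
by rewrite exprS [in x ^+ k.+2]exprS exprS; field; rewrite x0 expf_neq0.
Qed.

Lemma quot_along_on (t a c c' e : R) k : t != 0 ->
  `|a - c * t ^+ k - c' * t ^+ k.+1| <= e * `|t| ^+ k.+1 ->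
  `|c' - t^-1 * (a / t ^+ k - c)| <= e.
Proof.
move=> t0; rewrite -[`|t| ^+ _]normrX -ler_pdivrMr ?normr_gt0 ?expf_neq0 // -normfV -normrM.
rewrite -normrN; congr (`|_| <= _); rewrite exprS; field.
by rewrite t0 expf_neq0.
Qed.

Lemma quot_along k h z : smooth A h -> vanish k h -> A z ->
  derivable (quot k h) z 'e_i /\ partial i (quot k h) z = quot k.+1 (euler k h) z.
Proof.
move=> sh V Az; have [z0|z0] := eqVneq (z 0 i) 0; last first.
  have oB := open_off_coord; have sQ := quot_smooth_off k sh.
  have Bz : (A `&` [set z | z 0 i != 0]) z by [].
  split; first exact: smooth_derivable sQ Bz.
  have E y : (A `&` [set z | z 0 i != 0]) y -> h y = quot k h y * y 0 i ^+ k.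
    by move=> [_ /= y0]; rewrite /quot (negbTE y0) divfK // expf_neq0.
  have sX := smoothX oB k (smooth_coord i oB).
  rewrite {2}/quot (negbTE z0) /euler (partial_eq i oB E Bz) (partialM oB i sQ sX Bz).
  by rewrite partial_coordX (E z Bz); exact: quot_along_off.
pose c := partials (nseq k i) h z / k`!%:R.
pose c' := partials (nseq k.+1 i) h z / k.+1`!%:R.
have fn0 m : (m`!%:R : R) != 0 by rewrite pnatr_eq0 -lt0n fact_gt0.
have sX m := smoothX oA m (smooth_coord i oA).
(* Removing the Taylor terms of orders k and k+1 makes the derivatives at z of order up to k vanish
   and the one of order k+1 small nearby. *)
pose f1 y := h y - c * y 0 i ^+ k; pose f y := f1 y - c' * y 0 i ^+ k.+1.
have sf1 : smooth A f1 by exact: (smoothB oA sh (smoothM oA (smooth_cst oA c) (sX k))).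
have sf : smooth A f by exact: (smoothB oA sf1 (smoothM oA (smooth_cst oA c') (sX k.+1))).
have Df m y : A y -> partials (nseq m i) f y = partials (nseq m i) h y
    - c * ((k ^_ m)%:R * y 0 i ^+ (k - m)) - c' * ((k.+1 ^_ m)%:R * y 0 i ^+ (k.+1 - m)).
  move=> Ay; rewrite (partials_sub_scale _ _ sf1 (sX k.+1) Ay).
  by rewrite (partials_sub_scale _ _ sh (sX k) Ay) !partials_coordX.
have lim0 : (fun t : R => t^-1 *: ((quot k h \o shift z) (t *: 'e_i) - quot k h z)) @ 0^' --> c'.
  apply: (cvgrPdist_le (FF := dnbhs_filter _) _ _).2 => e e0.
  have N : \forall y \near z, A y /\
      `|partials (nseq k.+1 i) h z - partials (nseq k.+1 i) h y| <= e.
    have [ck _] := sh (nseq k.+1 i) z Az.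
    near=> y; split; first by near: y; exact: open_nbhs_nbhs.
    by apply: ltW; near: y; exact: continuous_near.
  near=> t; have t0 : t != 0 by near: t; exact: nbhs_dnbhs_neq.
  have L : forall r : R, `|r| <= `|t| -> A (z + r *: 'e_i) /\
      `|partials (nseq k.+1 i) h z - partials (nseq k.+1 i) h (z + r *: 'e_i)| <= e.
    by near: t; apply: nbhs_dnbhs; exact: (near_line0 'e_i N).
  have zt : (z + t *: 'e_i) 0 i = t by rewrite !mxE !eqxx z0 add0r mulr1.
  have qt : quot k h (z + t *: 'e_i) = h (z + t *: 'e_i) / t ^+ k.
    by rewrite /quot zt (negbTE t0).
  have qz : quot k h z = c by rewrite /quot z0 eqxx.
  rewrite /= [t *: 'e_i + z]addrC qt qz; apply: quot_along_on => //.
  have := @taylor_bound k.+1 f z t e sf; rewrite /f /f1 !zt; apply.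
    move=> m mk; rewrite [LHS](Df m z Az) z0 !expr0n !subn_eq0 [(k.+1 <= m)%N]leqNgt mk /=.
    rewrite !mulr0 subr0; move: mk; rewrite ltnS leq_eqVlt => /orP[/eqP->|mk].
      by rewrite leqnn mulr1 ffactnn divfK ?subrr.
    by rewrite leqNgt mk /= !mulr0 subr0 V.
  move=> r /L[Ar h1]; split=> //; rewrite [X in `|X|](Df k.+1 _ Ar).
  by rewrite ffact_small // subnn ffactnn expr0 mulr1 divfK // mul0r mulr0 subr0 distrC.
have E : partial i (quot k h) z = c' by exact: (cvg_lim (@norm_hausdorff _ _) lim0).
split; first by apply/cvg_ex; exists c'.
(* On the hyperplane the derivative of order k+1 of [euler k h] carries the factor (k+1) - k = 1, so
   it is that of h. *)
by rewrite E /quot z0 eqxx partials_euler // z0 mul0r add0r -natr1 addrAC subrr add0r mul1r.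
Unshelve. all: by end_near. Qed.

Lemma vanish_cross k h j : j != i -> smooth A h -> vanish k h -> vanish k (partial j h).
Proof.
move=> ji sh V z m Az z0 mk; rewrite partials_comm //.
rewrite /partial /= -[z in 'D__ _ z]addr0 -(scale0r 'e_j) -derive_line.
rewrite (@near_eq_derive _ _ _ _ (cst 0)) ?derive_cst //.
have c : {for (0 : R), continuous (fun s : R => z + s *: 'e_j)}.
  by apply: cvgD; [exact: cvg_cst | apply: cvgZr_tmp; exact: cvg_id].
have N : \forall s \near (0 : R), A (z + s *: 'e_j).
  by apply: c; rewrite scale0r addr0; exact: open_nbhs_nbhs.
by near=> s; apply: V; rewrite ?add_line0 //; near: s.
Unshelve. all: by end_near. Qed.

Lemma partials_quot s k h : smooth A h -> vanish k h ->
  exists k' h', [/\ smooth A h', vanish k' h' &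
    forall z, A z -> partials s (quot k h) z = quot k' h' z].
Proof.
move=> sh V; elim: s => [|j s [k' [h' [sh' V' E]]]]; first by exists k, h.
have [->|ji] := eqVneq j i.
  exists k'.+1, (euler k' h'); split; [exact: smooth_euler | exact: vanish_euler |].
  move=> z Az; have [_ <-] := quot_along sh' V' Az; exact: (partial_eq i oA E Az).
exists k', (partial j h'); split; [exact: smooth_partial | exact: vanish_cross |].
by move=> z Az; have [_ <-] := quot_cross k' ji sh' Az; exact: (partial_eq j oA E Az).
Qed.

Lemma smooth_quot k h : smooth A h -> vanish k h -> smooth A (quot k h).
Proof.
move=> sh V s z Az; have [k' [h' [sh' V' E]]] := partials_quot s sh V.
have N : \forall y \near z, quot k' h' y = partials s (quot k h) y.
  by near=> y; rewrite E //; near: y; exact: open_nbhs_nbhs.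
split.
  suff: partials s (quot k h) @ z --> partials s (quot k h) z by [].
  rewrite E //; exact: cvg_trans (near_eq_cvg N) (quot_continuous sh' V' Az).
move=> j; suff dq : derivable (quot k' h') z 'e_j by apply: near_eq_derivable dq.
by have [->|ji] := eqVneq j i; [have [] := quot_along sh' V' Az | have [] := quot_cross k' ji sh' Az].
Unshelve. all: by end_near. Qed.

Lemma coord_division f : smooth A f -> (forall z, A z -> z 0 i = 0 -> f z = 0) ->
  exists2 q, smooth A q & forall z, A z -> f z = z 0 i * q z.
Proof.
move=> sf f0; have V : vanish 1 f by move=> z [|//] Az z0 _; exact: f0.
exists (quot 1 f); first exact: smooth_quot.
move=> z Az; rewrite /quot; case: eqP => [z0|/eqP z0]; first by rewrite z0 mul0r f0.
by rewrite expr1 mulrC divfK.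
Qed.

End StraightDivision.

(** * Global division by a defining function *)

Section Division.
Variables (R : realType) (d : nat) (M : manifold R d) (V S : set M) (tau : M -> R).
Implicit Types (phi psi : chart R d M) (f q : M -> R).
Hypotheses (oV : open V) (hS : hypersurface S) (stau : smooth_on V tau).
Hypothesis tauS : forall x, V x -> (tau x = 0 <-> S x).
Hypothesis dtau : forall phi x, atlas phi -> chart_dom phi x -> V x -> S x ->
  exists i, partial i (local_expr phi tau) (phi x) != 0.

Definition local_quotient f x q B := [/\ open B, B x, B `<=` V, smooth_on B q &
  forall y, B y -> f y = tau y * q y].

(** Off S one divides by tau. On S one differentiates f = tau q: since tau = 0 there, df = q dtau
    with dtau nonzero. *)
Lemma local_quotient_unique f x q1 q2 B1 B2 :
  local_quotient f x q1 B1 -> local_quotient f x q2 B2 -> q1 x = q2 x.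
Proof.
move=> [p1 x1 b1 s1 E1] [p2 x2 b2 s2 E2]; pose B := B1 `&` B2.
have oB : open B by exact: openI.
have Vx := b1 x x1; have [Sx|nS] := pselect (S x); last first.
  have t0 : tau x != 0 by apply/eqP => /(tauS Vx).
  by apply: (mulfI t0); rewrite -E1 // -E2.
have [phi aphi dx] := atlas_cover x; have [i ti] := dtau aphi dx Vx Sx.
have oA : open (phi @` (chart_dom phi `&` B)) by exact: chart_img_open_sub.
have Ax := chart_img dx (conj x1 x2 : B x).
have tx : tau x = 0 by exact/tauS.
have st : smooth (phi @` (chart_dom phi `&` B)) (local_expr phi tau).
  by apply: (smooth_on_sub _ stau) => // y [/b1].
have P q Bq : smooth_on Bq q -> B `<=` Bq -> (forall y, Bq y -> f y = tau y * q y) ->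
    partial i (local_expr phi f) (phi x) = partial i (local_expr phi tau) (phi x) * q x.
  move=> sq BB E.
  have sq' : smooth (phi @` (chart_dom phi `&` B)) (local_expr phi q) by exact: smooth_on_sub sq _ aphi.
  have E' y : (phi @` (chart_dom phi `&` B)) y -> local_expr phi f y = local_expr phi tau y * local_expr phi q y.
    by move=> /chart_imgP[_ By _]; exact/E/BB.
  rewrite (partial_eq i oA E' Ax) (partialM oA i st sq' Ax).
  by rewrite /local_expr chart_mapK // tx mul0r addr0.
apply: (mulfI ti).
by rewrite -(P q1 B1 s1 (@subIsetl _ _ _) E1) -(P q2 B2 s2 (@subIsetr _ _ _) E2).
Qed.

(** Off S, q is f / tau. Near a point of S the slice coordinate divides both f and tau, and q is the
    quotient of the two cofactors. *)
Lemma local_quotient_exists f x : smooth_on V f -> (forall y, V y -> S y -> f y = 0) ->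
  V x -> exists q B, local_quotient f x q B.
Proof.
move=> sf f0 Vx; have [Sx|nS] := pselect (S x); last first.
  have [phi aphi dx] := atlas_cover x; have Ax := chart_img dx Vx.
  have oA : open (phi @` (chart_dom phi `&` V)) by exact: chart_img_open_sub.
  pose O := phi @` (chart_dom phi `&` V) `&` [set y | local_expr phi tau y != 0].
  have oO : open O.
    by apply: open_nonzero => //; exact: stau.
  pose B := chart_dom phi `&` [set y | O (phi y)].
  have oB : open B by exact: chart_preim_open.
  have BV : B `<=` V.
    by move=> y [dy [[z [dz Vz] zy] _]]; rewrite -(chart_mapK dy) -zy chart_mapK.
  have t0 y : B y -> tau y != 0 by move=> [dy [_ /=]]; rewrite /local_expr chart_mapK.
  exists (fun y => f y * (tau y)^-1), B; split=> //.
  - split=> //; split=> //=; rewrite /local_expr chart_mapK //.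
    by apply/eqP => /(tauS Vx).
  - apply: smooth_onM => //; first exact: smooth_on_sub sf.
    by apply: smooth_onV => //; exact: smooth_on_sub stau.
  - by move=> y By; rewrite mulrC divfK // t0.
have [psi [i [cpsi dpx Si]]] := hS Sx; have [phi aphi dx] := atlas_cover x.
have [s1 s2] := cpsi phi aphi.
pose W := chart_dom phi `&` V; pose A := psi @` (chart_dom psi `&` W).
have oW : open W by apply: openI => //; exact: chart_dom_open.
have oA : open A by exact: chart_img_open_sub.
have [sF _] := chart_change s2 oV (sf phi aphi).
have [sT _] := chart_change s2 oV (stau aphi).
have z0 (h : M -> R) : (forall y, V y -> S y -> h y = 0) ->
    forall z, A z -> z 0 i = 0 -> local_expr psi h z = 0.
  by move=> h0 z /chart_imgP[dz [_ Vz] zE] zi; apply: h0 => //; apply/Si => //; rewrite zE.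
have [qF sqF EF] := coord_division oA sF (z0 f f0).
have [qT sqT ET] := coord_division oA sT (z0 tau (fun y Vy => (tauS Vy).2)).
have Ax : A (psi x) by exact: chart_img.
have px0 : psi x 0 i = 0 by exact/Si.
(* If the cofactor of tau vanished as well, tau would vanish to second order at x, contradicting
   [dtau]. *)
have qx : qT (psi x) != 0.
  apply/negP => /eqP q0; have [j] := dtau aphi dx Vx Sx; apply/negP/negPn/eqP.
  have [_ /(_ x j dx dpx (conj dx Vx)) ->] := chart_change s1 oW sT.
  rewrite big1 // => k _.
  rewrite (partial_eq k oA ET Ax) (partialM oA k (smooth_coord i oA) sqT Ax).
  by rewrite q0 px0 mulr0 mul0r addr0 mulr0.
pose O := A `&` [set z | qT z != 0].
have oO : open O by exact: open_nonzero.
have sQ : smooth O (fun z => qF z / qT z).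
  by apply: smooth_div => // [||z []//]; [apply: smooth_sub sqF | apply: smooth_sub sqT] => z [].
pose B := chart_dom psi `&` [set y | O (psi y)].
have oB : open B by exact: chart_preim_open.
have BW : B `<=` W.
  by move=> y [dy [[z [dz Wz] zy] _]]; rewrite -(chart_mapK dy) -zy chart_mapK.
pose q y := qF (psi y) / qT (psi y).
have oBp : open (psi @` (chart_dom psi `&` B)) by exact: chart_img_open_sub.
have sq : smooth (psi @` (chart_dom psi `&` B)) (local_expr psi q).
  apply: (smooth_eq oBp _ (smooth_sub _ sQ)) => z /chart_imgP[dz Bz zE].
    by rewrite /local_expr /q zE.
  by rewrite -zE; case: Bz.
exists q, B; split=> //.
- by move=> y /BW[].
- move=> phi' aphi'; have [s1' _] := cpsi phi' aphi'.
  have [+ _] := chart_change s1' oB sq; apply: smooth_sub => y [z [dz Bz] <-].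
  by exists z => //; split=> //; split=> //; case: Bz.
- move=> y By; have [dy [Ay ty]] := By.
  have := EF _ Ay; rewrite /local_expr chart_mapK // => ->.
  have := ET _ Ay; rewrite /local_expr chart_mapK // => ->.
  by rewrite /q -[RHS]mulrA [qT _ * _]mulrC divfK.
Qed.

(** Local quotients agree wherever they overlap, so their common value at each point, selected by
    [xget], defines q. *)
Lemma division f : smooth_on V f -> (forall y, V y -> S y -> f y = 0) ->
  exists2 q, smooth_on V q & forall y, V y -> f y = tau y * q y.
Proof.
move=> sf f0.
pose q x := xget 0 [set v | exists q B, local_quotient f x q B /\ v = q x].
have qE x p B : local_quotient f x p B -> q x = p x.
  move=> H; have : exists v, [set v | exists q B, local_quotient f x q B /\ v = q x] v.
    by exists (p x), p, B.
  rewrite /q => /(xgetPex 0)[p' [B' [H' ->]]]; exact: local_quotient_unique H' H.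
have qB x p B : local_quotient f x p B -> forall y, B y -> q y = p y.
  by move=> [h1 h2 h3 h4 h5] y By; apply: (qE y p B).
exists q => [phi aphi|y Vy]; last first.
  have [p [B H]] := local_quotient_exists sf f0 Vy.
  by rewrite (qE _ _ _ H); have [_ By _ _ ->] := H.
apply: smooth_locally => z /chart_imgP[dz Vz zE].
have [p [B H]] := local_quotient_exists sf f0 Vz.
have [oB Bz BV sp _] := H.
exists (phi @` (chart_dom phi `&` B)); split; first by rewrite -zE; exact: chart_img.
apply: (smooth_eq _ _ (sp phi aphi)); first exact: chart_img_open_sub.
by move=> y /chart_imgP[dy By _]; rewrite /local_expr (qB _ _ _ H).
Qed.

End Division.

(** * Uniqueness *)

Section UniquenessAlgebra.
Variable R : realType.

(** The letters stand for x = f, y = f^k, y1 = f^(k-1), z = f^(d-k-1), w = 1 + f^k a, W = w^d; [H]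
    is then (w G - 1) / x. *)
Definition uniq_rest (dd k x y1 y z w W A G E L GFA GAA LA B1 B2 : R) : R :=
  let H := y1 * A * G + y * z * B2 + 2 / dd * E in
  y1 * (A * A) + z * (w * w * B2 - W * B1)
  + 2 * (1 - 2 / dd) * (k * A * H + w * GFA)
  + y1 * (k * k * A * A * G + 2 * k * A * x * GFA + x * x * GAA)
  - 2 / dd * (k * (k - 1) * A * H + w * (k * A * L + 2 * k * GFA + x * LA)).

(** The long hypothesis is I^2(f w) = 1 + (f w)^d b1 expanded by [eI_mul]. In the coefficient of y
    A, 2 comes from w^2, 2 k (1 - 2/d) from the gradient term and -(2/d) k (k-1) from the Laplacian;
    the sum is (2/d) (k+1) (d-k). *)
Lemma uniq_algebra (dd k x y1 y z w W A G E L GFA GAA LA B1 B2 : R) :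
  dd != 0 -> y = x * y1 -> w = 1 + y * A -> G - 2 / dd * x * E = 1 + y * (x * z) * B2 ->
  w ^+ 2 * (1 + y * (x * z) * B2) + 2 * (1 - 2 / dd) * w * (y * (k * A * G + x * GFA))
  + y ^+ 2 * (k ^+ 2 * A ^+ 2 * G + 2 * k * A * x * GFA + x ^+ 2 * GAA)
  - 2 / dd * w * (y * (k * (k - 1) * A * G + k * x * A * L + 2 * k * x * GFA + x ^+ 2 * LA))
  = 1 + y * (x * z) * (W * B1) ->
  y * (2 / dd * (k + 1) * (dd - k) * A +
       x * uniq_rest dd k x y1 y z w W A G E L GFA GAA LA B1 B2) = 0.
Proof.
move=> d0 yE wE /(canRL (subrK _)) GE /eqP; rewrite -subr_eq0 => /eqP <-.
rewrite /uniq_rest GE wE; move: yE {GE wE} => ->; field.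
exact: d0.
Qed.

End UniquenessAlgebra.

Section UniquenessExpr.
Variables (R : realType) (V : Type) (d : nat).
Variables (delta : 'I_d -> V -> expr R V) (g : 'I_d -> 'I_d -> expr R V).
Implicit Types (f a b : expr R V).

(* For two solutions f (1 + f^k a) and f, dividing the difference of the two
   equations by f^k leaves (2/d) (k+1) (d-k) a, plus f times this expression. *)
Definition rest_expr k f a b1 b2 : expr R V :=
  let K r := Const r : expr R V in
  let p j := epow j f (Const 1) in
  let G := egrad delta g f f in
  let GFA := egrad delta g f a in
  let GAA := egrad delta g a a in
  let L := elap delta g f in
  let LA := elap delta g a in
  let E := (L + eJ delta g * f)%X in
  let w := (K 1%R + p k * a)%X in
  let H := (p k.-1 * a * G + p k * p (d - k.+1)%N * b2 + K (2 / d%:R)%R * E)%X in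
  (p k.-1 * (a * a) + p (d - k.+1)%N * (w * w * b2 - epow d w (K 1%R) * b1)
   + K (2 * (1 - 2 / d%:R))%R * (K k%:R * a * H + w * GFA)
   + p k.-1 * (K (k%:R * k%:R)%R * a * a * G + K (2 * k%:R)%R * a * f * GFA + f * f * GAA)
   - K (2 / d%:R)%R * (K (k%:R * (k%:R - 1))%R * a * H
       + w * (K k%:R * a * L + K (2 * k%:R)%R * GFA + f * LA)))%X.

Variable env : V -> R.
Hypothesis gsym : forall i j, interp env (einv g i j) = interp env (einv g j i).

Notation "⟦ e ⟧" := (interp env e) (at level 0).

Lemma dom_rest_expr k f a b1 b2 : (forall i v, dom env (delta i v)) ->
  (forall i j, dom env (g i j)) -> \det (emx env g) != 0 ->
  dom env f -> dom env a -> dom env b1 -> dom env b2 ->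
  dom env (rest_expr k f a b1 b2).
Proof.
move=> dd dg detg df da db1 db2.
have G1 := dom_egrad dd dg detg; have L1 := dom_elap dd dg detg.
have J1 := dom_escal dd dg detg.
have dp j : dom env (epow j f (Const 1)) by apply: dom_epow.
have dw : dom env (Const 1 + epow k f (Const 1) * a)%X by do !split.
have dW : dom env (epow d (Const 1 + epow k f (Const 1) * a)%X (Const 1)) by apply: dom_epow.
have dJ : dom env (eJ delta g) by split.
have dE : dom env (elap delta g f + eJ delta g * f)%X by split; [exact: L1 | split].
by repeat match goal with
| |- dom env (rest_expr _ _ _ _ _) => split
| |- dom env (Add _ _) => split
| |- dom env (Mul _ _) => split
| |- dom env (Const _) => exact: I
| |- dom env (egrad _ _ _ _) => exact: G1
| |- dom env (elap _ _ _) => exact: L1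
| |- _ => done
end.
Qed.

Lemma leading_coefficient k f a b1 b2 : (0 < k < d)%N ->
  ⟦eI delta g f⟧ = 1 + ⟦f⟧ ^+ d * ⟦b2⟧ ->
  ⟦eI delta g (f * (Const 1%R + epow k f a))%X⟧ =
    1 + (⟦f⟧ * (1 + ⟦f⟧ ^+ k * ⟦a⟧)) ^+ d * ⟦b1⟧ ->
  ⟦f⟧ ^+ k * (2 / d%:R * (k%:R + 1) * (d%:R - k%:R) * ⟦a⟧
    + ⟦f⟧ * ⟦rest_expr k f a b1 b2⟧) = 0.
Proof.
move=> /andP[k0 kd] I2 I1.
have d0 : d%:R != 0 :> R by rewrite pnatr_eq0 -lt0n (leq_ltn_trans _ kd).
set P := epow k f a in I1; set w := (_ + P)%X in I1.
set x := ⟦f⟧ in I1 I2 *; set A := ⟦a⟧ in I1 *.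
have wE : ⟦w⟧ = 1 + x ^+ k * A by rewrite /w /= interp_epow.
have gw e : ⟦egrad delta g w e⟧ = ⟦egrad delta g P e⟧ by rewrite egradD egradC0 add0r.
have lw : ⟦elap delta g w⟧ = ⟦elap delta g P⟧ by rewrite elapD // elapC // add0r.
have gP e : x * ⟦egrad delta g P e⟧ = x ^+ k * (k%:R * A * ⟦egrad delta g f e⟧ + x * ⟦egrad delta g a e⟧).
  by rewrite egrad_pow.
have lP := elap_pow delta gsym k f a; rewrite -/P -/x -/A in lP.
have gPf := gP f; rewrite (egradC _ gsym a f) in gPf.
have gPP : x ^+ 2 * ⟦egrad delta g P P⟧ = (x ^+ k) ^+ 2 * (k%:R ^+ 2 * A ^+ 2 * ⟦egrad delta g f f⟧
    + 2 * k%:R * A * x * ⟦egrad delta g f a⟧ + x ^+ 2 * ⟦egrad delta g a a⟧).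
  rewrite expr2 -mulrA gP (egradC _ gsym f P) (egradC _ gsym a P).
  have -> : x * (x ^+ k * (k%:R * A * ⟦egrad delta g P f⟧ + x * ⟦egrad delta g P a⟧)) =
     x ^+ k * (k%:R * A * (x * ⟦egrad delta g P f⟧) + x * (x * ⟦egrad delta g P a⟧)) by ring.
  by rewrite gPf gP; ring.
have yE : x ^+ k = x * x ^+ k.-1 by rewrite -exprS prednK.
have dE : x ^+ d = x ^+ k * (x * x ^+ (d - k.+1)).
  by rewrite -exprS -exprD -subSn // subSS subnKC // ltnW.
have GE : ⟦egrad delta g f f⟧ - 2 / d%:R * x * (⟦elap delta g f⟧ + ⟦eJ delta g⟧ * x)
    = 1 + x ^+ k * (x * x ^+ (d - k.+1)) * ⟦b2⟧ by rewrite -dE -I2 /x /=; ring.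
rewrite eI_mul // I2 (egradC _ gsym f w) !gw (egradC _ gsym P w) gw lw -wE exprMn dE in I1.
have := uniq_algebra (k := k%:R) (W := ⟦w⟧ ^+ d) (B1 := ⟦b1⟧) (GFA := ⟦egrad delta g f a⟧)
  (GAA := ⟦egrad delta g a a⟧) (LA := ⟦elap delta g a⟧) (L := ⟦elap delta g f⟧) d0 yE wE GE.
rewrite -gPf -gPP -lP => alg.
have {alg} := alg _; move=> <-; last first.
  rewrite [_ * (_ * ⟦b1⟧)]mulrA -I1 -/x; ring.
congr (_ * (_ + _ * _)).
rewrite /rest_expr !(interpE, interp_epow) -/x -/A !mulr1 /uniq_rest.
move: (x ^+ k.-1) (x ^+ k) (x ^+ (d - k.+1)) => y1 y z.
move: ((1 + y * A) ^+ d) => W.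
ring.
Qed.

End UniquenessExpr.

Section ListOfFunctions.
Variables (R : realType) (d : nat) (M : manifold R d) (c : conformal_structure M).
Variables (U S : set M) (s : metric M -> M -> R) (g : metric M).
Hypotheses (oU : open U) (def : defining_density c U S s) (cg : conf_class c g).

(** Past the end of the list the family is the zero function, so plain numbers can index it. *)
Definition list_fam phi (L : seq (M -> R)) (v : 'I_d * 'I_d + nat) : 'rV[R]_d -> R :=
  match v with
  | inl (i, j) => gcomp g phi i j
  | inr n => local_expr phi (nth (fun=> 0) L n)
  end.

Definition list_g (i j : 'I_d) : expr R (('I_d * 'I_d + nat) * seq 'I_d) :=
  Var (inl (i, j), [::]).
Definition list_f n : expr R (('I_d * 'I_d + nat) * seq 'I_d) := Var (inr n, [::]).

Variables (phi : chart R d M) (L : seq (M -> R)).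
Hypotheses (aphi : atlas phi) (sL : forall n, smooth_on U (nth (fun=> 0) L n)).
Let A := phi @` (chart_dom phi `&` U).
Let env := fam_env (list_fam phi L).

Lemma list_system : closed_system A env (@fam_delta R d _).
Proof.
apply: fam_system => -[[i j]|n]; last exact: sL.
by apply: smooth_sub (metric_smooth g i j aphi) => y [x [dx _] <-]; exists x.
Qed.

Lemma emx_list_g y : emx (env y) list_g = g phi (chart_inv phi y).
Proof. by apply/matrixP => i j; rewrite mxE. Qed.

Lemma list_g_det y : A y -> \det (emx (env y) list_g) != 0.
Proof.
by move=> /chart_imgP[dx _ _]; rewrite emx_list_g -unitfE -unitmxE metric_unit.
Qed.

Lemma list_einv_sym y i j : A y ->
  interp (env y) (einv list_g i j) = interp (env y) (einv list_g j i).
Proof.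
move=> Ay; apply: (einv_sym (A := A)) Ay => z; last exact: list_g_det.
move=> a b /chart_imgP[dx _ _]; rewrite /= /env /fam_env /= /gcomp /local_expr.
by rewrite -[in LHS](Defs.metric_sym g aphi dx) mxE.
Qed.

Lemma list_Isq f e x : chart_dom phi x -> U x -> (forall y, A y -> dom (env y) e) ->
  (forall z, chart_dom phi z -> U z -> f z = interp (env (phi z)) e) ->
  Isq g phi f x = interp (env (phi x)) (eI (@fam_delta R d _) list_g e).
Proof.
move=> dx Ux de fE; have oA : open A by exact: chart_img_open_sub.
apply: (bridge_Isq (A := A) oA list_system) => //; last exact: chart_img.
- by move=> y; exact: list_g_det.
- by move=> y /chart_imgP[dy Uy yE]; rewrite /local_expr fE // yE.
Qed.

Lemma list_fE n x : chart_dom phi x -> interp (env (phi x)) (list_f n) = nth (fun=> 0) L n x.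
Proof. by move=> dx; rewrite /= /env /fam_env /= /local_expr chart_mapK. Qed.

End ListOfFunctions.

Lemma smooth_on_cst (R : realType) (d : nat) (M : manifold R d) (U : set M) (a : R) :
  open U -> smooth_on U (fun=> a).
Proof. by move=> oU phi _; apply: smooth_cst; exact: chart_img_open_sub. Qed.

Section Uniqueness.
Variables (R : realType) (d : nat) (M : manifold R d) (c : conformal_structure M).
Variables (U S : set M) (s : metric M -> M -> R) (g : metric M).
Hypotheses (oU : open U) (def : defining_density c U S s) (cg : conf_class c g).
Variables (f1 u b1 b2 : M -> R).
Hypotheses (su : smooth_on U u) (sb1 : smooth_on U b1) (sb2 : smooth_on U b2).
Let f := s g.
Hypothesis I1 : forall phi x, atlas phi -> chart_dom phi x -> U x ->
  Isq g phi f1 x = 1 + f1 x ^+ d * b1 x.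
Hypothesis f1E : forall x, U x -> f1 x = f x * u x.
Hypothesis I2 : forall phi x, atlas phi -> chart_dom phi x -> U x ->
  Isq g phi f x = 1 + f x ^+ d * b2 x.

Let sf : smooth_on U f. Proof. by have [[sf _] _ _] := def; exact: sf. Qed.
Let f0 x : U x -> (f x = 0 <-> S x). Proof. by move=> Ux; have [_ f0 _] := def; exact: f0. Qed.

(** Where f = 0, [eI_mul] leaves I^2(f u) = u^2 I^2(f), and both values of I^2 are 1. *)
Lemma quotient_sqr x : (0 < d)%N -> U x -> S x -> u x ^+ 2 = 1.
Proof.
move=> d0 Ux Sx; have fx : f x = 0 by exact/f0.
have [phi aphi dx] := atlas_cover x; pose L := [:: f; u].
have sL n : smooth_on U (nth (fun=> 0) L n).
  case: n => [|[|n]]; [exact: sf | exact: su | rewrite /= nth_nil].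
  exact: smooth_on_cst.
have Ax := chart_img dx Ux.
have gsym := list_einv_sym g L aphi _ _ Ax.
have := I2 aphi dx Ux; rewrite fx expr0n gtn_eqF //= mul0r addr0.
rewrite (list_Isq oU aphi sL (e := list_f R d 0)) // => [J2|z dz Uz]; last by rewrite list_fE.
have := I1 aphi dx Ux; rewrite f1E // fx mul0r expr0n gtn_eqF //= mul0r addr0.
rewrite (list_Isq oU aphi sL (e := Mul (list_f R d 0) (list_f R d 1))) // => [|z dz Uz]; last first.
  by rewrite f1E // interpM !list_fE.
rewrite eI_mul // J2 !list_fE //= fx => <-; ring.
Qed.

Lemma vanishing_order k q x : (0 < k < d)%N -> smooth_on U q ->
  (forall z, U z -> u z = 1 + f z ^+ k * q z) -> U x -> S x -> q x = 0.
Proof.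
move=> kd sq uE Ux Sx; have fx : f x = 0 by exact/f0.
have [phi aphi dx] := atlas_cover x; pose L := [:: f; q; b1; b2].
have sL n : smooth_on U (nth (fun=> 0) L n).
  case: n => [|[|[|[|n]]]]; [exact: sf | exact: sq | exact: sb1 | exact: sb2 | rewrite /= nth_nil].
  exact: smooth_on_cst.
have oA : open (phi @` (chart_dom phi `&` U)) by exact: chart_img_open_sub.
have sys := list_system g aphi sL.
pose v n := list_f R d n; pose env := fam_env (list_fam g phi L).
pose C : R := 2 / d%:R * (k%:R + 1) * (d%:R - k%:R).
pose e := (Const C * v 1%N + v 0%N * rest_expr (@fam_delta R d _) (@list_g R d) k (v 0%N) (v 1%N) (v 2%N) (v 3%N))%X.
have de y : (phi @` (chart_dom phi `&` U)) y -> dom (env y) e.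
  move=> Ay; split=> //; split=> //; apply: dom_rest_expr => //.
  exact: (list_g_det g L aphi Ay).
pose h z := interp (env (phi z)) e.
have sh : smooth (phi @` (chart_dom phi `&` U)) (local_expr phi h).
  apply: smooth_eq (smooth_interp_on oA sys de) => // y /chart_imgP[_ _ yE].
  by rewrite /local_expr /h yE.
have vE n z : chart_dom phi z -> interp (env (phi z)) (v n) = nth (fun=> 0) L n z.
  by move=> dz; rewrite /v /env list_fE.
(* [leading_coefficient] still carries the factor f^k, which can only be cancelled where f is
   nonzero. *)
have hx : h x = 0.
  apply: (vanish_on_zero_locus def (O := chart_dom phi `&` U)) => //.
  - by apply: openI => //; exact: chart_dom_open.
  - exact: (chart_continuous dx (chart_img dx Ux) sh).
  move=> z [dz Uz] nSz; have fz : f z != 0 by apply/eqP => /(f0 Uz).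
  have gsym := list_einv_sym g L aphi _ _ (chart_img dz Uz).
  have J2 : interp (env (phi z)) (eI (@fam_delta R d _) (@list_g R d) (v 0%N)) =
      1 + interp (env (phi z)) (v 0%N) ^+ d * interp (env (phi z)) (v 3%N).
    rewrite !vE // -(I2 aphi dz Uz) (list_Isq oU aphi sL (e := v 0%N)) // => y dy Uy.
    by rewrite vE.
  pose w := (v 0%N * (Const 1 + epow k (v 0%N) (v 1%N)))%X.
  have J1 : interp (env (phi z)) (eI (@fam_delta R d _) (@list_g R d) w) =
      1 + (interp (env (phi z)) (v 0%N) * (1 + interp (env (phi z)) (v 0%N) ^+ k *
        interp (env (phi z)) (v 1%N))) ^+ d * interp (env (phi z)) (v 2%N).
    rewrite !vE // -(uE z Uz) -(f1E Uz) -(I1 aphi dz Uz) (list_Isq oU aphi sL (e := w)) // => [y Ay|y dy Uy].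
      by split=> //; split=> //; exact: dom_epow.
    by rewrite /w interpM interpD interpC interp_epow !vE //= f1E // uE.
  have := leading_coefficient gsym kd J2 J1; rewrite (vE 0%N) // => H.
  by apply: (mulfI (expf_neq0 k fz)); rewrite mulr0 -[RHS]H /h /e interpD !interpM interpC (vE 0%N).
move: hx; rewrite /h /e interpD !interpM interpC !vE //= fx mul0r addr0 => /eqP.
(* C is nonzero because k < d; its factor d - k would vanish at k = d. *)
rewrite mulf_eq0 => /orP[|/eqP//]; rewrite /C; case/andP: kd => k0 kd.
rewrite !mulf_eq0 invr_eq0 !pnatr_eq0 subr_eq0 eqr_nat natr1 pnatr_eq0 /=.
by rewrite !gtn_eqF // (leq_ltn_trans _ kd).
Qed.

Lemma quotient_expansion k : hypersurface S -> (0 < d)%N ->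
  (forall x, U x -> S x -> u x = 1) -> (k < d)%N ->
  exists2 q, smooth_on U q & forall z, U z -> u z = 1 + f z ^+ k.+1 * q z.
Proof.
move=> hS d0 u1.
have div h : smooth_on U h -> (forall y, U y -> S y -> h y = 0) ->
    exists2 q, smooth_on U q & forall y, U y -> h y = f y * q y.
  by apply: division => // phi x aphi; have [_ _ df] := def; exact: df.
elim: k => [_|k IH kd].
  have [|y Uy Sy|q sq E] := div (fun z => u z - 1).
  - move=> phi aphi; apply: (smoothB _ (su aphi) (smooth_on_cst 1 oU aphi)).
    exact: chart_img_open_sub.
  - by rewrite u1 ?subrr.
  - by exists q => // z Uz; rewrite expr1 -E // addrC subrK.
have [q sq E] := IH (ltnW kd).
have [//|y Uy Sy|r sr Er] := div q; first exact: (vanishing_order _ sq E).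
by exists r => // z Uz; rewrite E // Er // [in RHS]exprSr mulrA.
Qed.

End Uniqueness.

Section UniquenessDensity.
Variables (R : realType) (d : nat) (M : manifold R d) (c : conformal_structure M).
Variables (S V U : set M) (sigma s1 s2 : metric M -> M -> R).
Hypotheses (d0 : (0 < d)%N) (hS : hypersurface S) (oU : open U) (UV : U `<=` V).
Hypothesis def : defining_density c V S sigma.
Hypotheses (D1 : distinguished_density c U S s1) (D2 : distinguished_density c U S s2).
Hypotheses (p1 : compatibly_oriented c U S s1 sigma).
Hypotheses (p2 : compatibly_oriented c U S s2 sigma).

Lemma defining_density_sub (W : set M) t : W `<=` V -> defining_density c V S t ->
  defining_density c W S t.
Proof.
move=> WV [[st wt] t0 dt]; split.
- split=> [g cg|g g' Om cg cg' resc x /WV]; first exact: smooth_on_sub (st g cg).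
  exact: wt.
- by move=> g x cg /WV; exact: t0.
- by move=> g phi x cg aphi dx /WV; exact: dt.
Qed.

Lemma defining_division (W : set M) t g f : open W -> defining_density c W S t ->
  conf_class c g -> smooth_on W f -> (forall x, W x -> S x -> f x = 0) ->
  exists2 q, smooth_on W q & forall x, W x -> f x = t g x * q x.
Proof.
move=> oW [[st _] t0 dt] cg sf f0; apply: (division oW hS (st g cg)) => //.
  by move=> x; exact: t0.
by move=> phi x; exact: dt.
Qed.

Lemma ratio_gt0 (a b e : R) : 0 < a / e -> 0 < b / e -> 0 < a / b.
Proof.
move=> ae be; have e0 : e != 0 by apply: contraL ae => /eqP ->; rewrite invr0 mulr0 ltxx.
have -> : a / b = (a / e) / (b / e) by rewrite invfM invrK mulrACA mulVf ?mulr1.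
exact: divr_gt0.
Qed.

Lemma uniqueness_scale g : conf_class c g -> exists G, smooth_on U G /\
  forall x, U x -> s1 g x - s2 g x = sigma g x ^+ d.+1 * G x.
Proof.
move=> cg; have [def1 [B1 [sB1 _] I1]] := D1; have [def2 [B2 [sB2 _] I2]] := D2.
have [[st1 _] z1 _] := def1; have [_ z2 _] := def2.
have defU := defining_density_sub UV def; have [_ z0 _] := defU.
have [u su uE] : exists2 u, smooth_on U u & forall x, U x -> s1 g x = s2 g x * u x.
  have v1 x : U x -> S x -> s1 g x = 0 by move=> Ux; have [_] := z1 g x cg Ux.
  exact: (defining_division oU def2 cg (st1 g cg) v1).
have upos x : U x -> ~ S x -> 0 < u x.
  move=> Ux nS; have := ratio_gt0 (p1 cg Ux nS) (p2 cg Ux nS).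
  by rewrite uE // mulrAC divff ?mul1r //; apply/eqP => /(z2 g x cg Ux).
have u1 x : U x -> S x -> u x = 1.
  move=> Ux Sx; have [phi aphi dx] := atlas_cover x.
  have cu := chart_continuous dx (chart_img dx Ux) (su phi aphi).
  (* Positivity of u off S passes to S in the form u = |u|, which excludes the root -1 of u^2 =
     1. *)
  have ch : {for x, continuous (fun z => u z - `|u z|)}.
    by apply: cvgB; [exact: cu | apply: cvg_norm; exact: cu].
  have un : u x - `|u x| = 0.
    apply: (vanish_on_zero_locus def2 oU (fun _ => id) Ux ch) => z Uz nS.
    by rewrite gtr0_norm ?subrr //; exact: upos.
  have /eqP := quotient_sqr oU def2 cg su (fun phi x => I1 g phi x cg) uE
    (fun phi x => I2 g phi x cg) d0 Ux Sx.
  by rewrite sqrf_eq1 => /orP[/eqP//|/eqP ux]; move: un; rewrite ux normrN normr1; lra.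
(* With k = d - 1 this gives u = 1 + s2^d q, and s1 - s2 = s2 (u - 1) gains one more order. *)
have [|q sq qE] := quotient_expansion oU def2 cg su (sB1 g cg) (sB2 g cg)
  (fun phi x => I1 g phi x cg) uE (fun phi x => I2 g phi x cg) hS d0 u1 (k := d.-1).
  by rewrite prednK.
have [v sv vE] : exists2 v, smooth_on U v & forall x, U x -> s2 g x = sigma g x * v x.
  have v2 x : U x -> S x -> s2 g x = 0 by move=> Ux; have [_] := z2 g x cg Ux.
  have [[st2 _] _ _] := def2; exact: (defining_division oU defU cg (st2 g cg) v2).
exists (fun x => v x ^+ d.+1 * q x); split.
  have sX : smooth_on U (fun x => v x ^+ d.+1).
    by move=> phi aphi; exact: (smoothX (chart_img_open_sub oU) d.+1 (sv phi aphi)).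
  exact: (smooth_onM oU sX sq).
move=> x Ux; rewrite uE // qE // prednK // mulrDr mulr1 addrAC subrr add0r.
by rewrite vE // [LHS]mulrA -exprS exprMn mulrA.
Qed.

Lemma uniqueness : eq_mod_bigO c 1 d.+1 U sigma s1 s2.
Proof.
(* G is chosen separately in each scale; the weight law is proved afterwards, off the hypersurface
   by cancelling sigma^(d+1) and on it by continuity. *)
have ex g : exists G, conf_class c g -> smooth_on U G /\
    forall x, U x -> s1 g x - s2 g x = sigma g x ^+ d.+1 * G x.
  have [/uniqueness_scale[G H]|n] := pselect (conf_class c g); last by exists (fun=> 0).
  by exists G => _.
have [G GP] := boolp.choice ex.
exists G; last by move=> g x cg Ux; have [_] := GP g cg; exact.
split=> [g cg|g g' Om cg cg' resc x Ux]; first by have [] := GP g cg.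
have [sG EG] := GP g cg; have [sG' EG'] := GP g' cg'; have [sO O0 _] := resc.
have sOU : smooth_on U Om by exact: smooth_on_sub sO.
have -> : 1 - d.+1%:R = - d%:R :> R by rewrite -natr1 opprD addrCA subrr addr0.
apply: powR_weight => //; apply/eqP; rewrite -subr_eq0; apply/eqP.
have defU := defining_density_sub UV def; have [[_ w0] z0 _] := defU.
have [[[_ w1] _ _] _] := D1; have [[[_ w2] _ _] _] := D2.
have sh : smooth_on U (fun z => Om z ^+ d * G g' z - G g z).
  move=> phi aphi; have oA : open (phi @` (chart_dom phi `&` U)) by exact: chart_img_open_sub.
  exact: (smoothB oA (smoothM oA (smoothX oA d (sOU phi aphi)) (sG' phi aphi)) (sG phi aphi)).
have [phi aphi dx] := atlas_cover x.
have ch := chart_continuous dx (chart_img dx Ux) (sh phi aphi).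
apply: (vanish_on_zero_locus defU oU (fun _ => id) Ux ch) => z Uz nS.
have sz : sigma g z != 0 by apply/eqP => /(z0 g z cg Uz).
have := EG' z Uz; rewrite (w0 g g' Om) // (w1 g g' Om) // (w2 g g' Om) // powRr1 ?ltW //.
rewrite -mulrBr EG // exprMn [Om z ^+ d.+1]exprS -!mulrA => /(mulfI (lt0r_neq0 (O0 z))) E.
apply/eqP; rewrite subr_eq0; apply/eqP; apply: (mulfI (expf_neq0 d.+1 sz)).
by rewrite E mulrCA.
Qed.

End UniquenessDensity.

Theorem theorem4p5 (R : realType) (d : nat) (hd : (3 <= d)%N) :
  exists (N : nat) (W : set (jet_space R d N)) (Phi : jet_space R d N -> R),
  [/\ open W, smooth W Phi &
    forall (M : manifold R d) (c : conformal_structure M) (Sigma : set M),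
    hypersurface Sigma ->
    (forall p, Sigma p -> exists V sigma,
      [/\ open V, V p & defining_density c V Sigma sigma]) /\
    (forall (V : set M) (sigma : metric M -> M -> R),
      open V -> defining_density c V Sigma sigma ->
      (exists U sbar,
        [/\ open U, U `<=` V & V `&` Sigma `<=` U] /\
        [/\ distinguished_density c U Sigma sbar,
            compatibly_oriented c U Sigma sbar sigma &
            given_by_formula W Phi c U sigma sbar]) /\
      (forall U sbar1 sbar2,
        open U -> U `<=` V ->
        distinguished_density c U Sigma sbar1 ->
        distinguished_density c U Sigma sbar2 ->
        compatibly_oriented c U Sigma sbar1 sigma ->
        compatibly_oriented c U Sigma sbar2 sigma ->
        eq_mod_bigO c 1 d.+1 U sigma sbar1 sbar2))].
Proof.
have d1 : (1 < d)%N by exact: ltnW.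
have d0 : (0 < d)%N by exact: ltnW.
pose e := sdens R d d; pose N := jet_order e.
pose W := [set J : jet_space R d N | dom (jet_env J) e].
pose Phi (J : jet_space R d N) := interp (jet_env J) e.
have sys := @jet_system R d N.
(* The variables are now the jet coordinates, over the whole jet space, so the general facts on
   expressions give that W is open and Phi smooth on it. *)
have := open_dom openT sys (e := e); rewrite setTI => oW.
have := smooth_interp openT sys (e := e); rewrite setTI => sPhi.
exists N, W, Phi; split=> // M c Sigma hS; split.
  by move=> p; exact: defining_density_exists.
move=> V sigma oV def; split.
  exists (exist_dom c V sigma), (exist_density sigma); split; split.
  - exact: exist_dom_open oV def.
  - exact: exist_dom_sub.
  - exact: zero_exist_dom.
  - exact: exist_distinguished.
  - exact: exist_oriented oV def.
  - exact: exist_formula oV def.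
by move=> U t1 t2 oU UV D1 D2 c1 c2; exact: (uniqueness d0 hS oU UV def D1 D2 c1 c2).
Qed.
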